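(* Let $0<\alpha<\frac12$, let $\Omega\subset\mathbb{R}^3$ be a bounded, simply connected open set with $\partial\Omega\in C^4$, and let $u\in C^{0,\alpha}(\Omega;\mathbb{R}^3)$ be a divergence-free velocity field which is tangential to the boundary, i.e. $(u\cdot n)|_{\partial\Omega}=0$. Let $p\in C^{0,\alpha}(\Omega)$ be the pressure associated with $u$ (see context). Then for every $\eta>0$ one has $p\in C^{0,2\alpha}(\Omega\setminus V_\eta)$, where $V_\eta=\{x\in\Omega:d(x,\partial\Omega)<\eta\}$, and $$\|p\|_{C^{0,2\alpha}(\Omega\setminus V_\eta)}\le C\,\|u\|_{C^{0,\alpha}(\Omega)}^2,$$ where the constant $C$ depends on $\eta$ (but not on $u$).
   Context: $n$ is the outward unit normal. Fix $\delta>0$ small (depending on $\Omega$) so that points within distance $2\delta$ of $\partial\Omega$ have a unique nearest boundary point $\widetilde\sigma(x)$, and extend $n$ by $n(x)=n(\widetilde\sigma(x))$. Let $\phi(x)=\widetilde\phi(d(x,\partial\Omega))$, where $\widetilde\phi:[0,\infty)\to[0,1]$ is a smooth nonincreasing function equal to $1$ on $[0,\delta]$ and $0$ on $[2\delta,\infty)$. The pressure associated with $u$ is $p:=P-\phi\,(u\cdot n)^2\in C^{0,\alpha}(\Omega)$, where $P\in C^{0,\alpha}(\Omega)$ is the unique function such that: $-\Delta P=\partial_i\partial_j(u_iu_j)-\Delta(\phi(u\cdot n)^2)$ in the sense of distributions in $\Omega$; $s\mapsto\partial_sP(\cdot,s)$ belongs to $C([0,\delta);H^{-2}(\partial\Omega))$,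 where $P(y,s):=P(y-s\,n(y))$ for $y\in\partial\Omega$, $s\in[0,\delta)$; $\partial_nP:=-\partial_sP(\cdot,0)=(u\otimes u):\nabla n=u_iu_j\partial_in_j$ in $H^{-2}(\partial\Omega)$; and $\int_\Omega P\,dx=\int_\Omega\phi(u\cdot n)^2\,dx$ (equivalently $\int_\Omega p\,dx=0$). Existence and uniqueness of this $P$, together with the bound $\|P\|_{C^{0,\alpha}(\Omega)}\le C(\Omega,\alpha)\|u\otimes u\|_{C^{0,\alpha}(\Omega)}$, may be taken as known. *)

(* Defs.v *)
From HB Require Import structures.
From mathcomp Require Import all_boot all_order all_algebra.
From mathcomp Require Import all_classical all_reals all_analysis.

Set Implicit Arguments.
Unset Strict Implicit.
Unset Printing Implicit Defensive.

Import Order.TTheory GRing.Theory Num.Theory.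
Import numFieldNormedType.Exports.

Local Open Scope classical_set_scope.
Local Open Scope ring_scope.

(* The library norm on matrices is the sup norm; it is used
   only for the topology and for boundedness.  All lengths and distances below
   are Euclidean ([fnorm]). *)

Section Euclidean.
Context {R : realType}.

(* Euclidean norm of a vector, Frobenius norm of a matrix. *)
Definition fnorm (m n : nat) (A : 'M[R]_(m, n)) : R :=
  Num.sqrt (\sum_(i < m) \sum_(j < n) A i j ^+ 2).

Definition dot (n : nat) (v w : 'rV[R]_n) : R := \sum_(i < n) v 0 i * w 0 i.

Definition tensor (n : nat) (v w : 'rV[R]_n) : 'M[R]_n := v^T *m w.

Definition eball (n : nat) (x : 'rV[R]_n) (r : R) : set 'rV[R]_n :=
  [set y | fnorm (y - x) < r].

Definition bd (n : nat) (D : set 'rV[R]_n.+1) : set 'rV[R]_n.+1 :=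
  closure D `\` interior D.

Definition dist (n : nat) (x : 'rV[R]_n) (S : set 'rV[R]_n) : R :=
  inf [set fnorm (x - y) | y in S].

Definition path_connected (n : nat) (D : set 'rV[R]_n.+1) : Prop :=
  forall x y, D x -> D y -> exists g : R -> 'rV[R]_n.+1,
    [/\ {within `[0, 1], continuous g}, g 0 = x, g 1 = y
      & forall t, 0 <= t <= 1 -> D (g t)].

Definition simply_connected (n : nat) (D : set 'rV[R]_n.+1) : Prop :=
  path_connected D /\
  forall g : R -> 'rV[R]_n.+1,
    {within `[0, 1], continuous g} -> (forall t, 0 <= t <= 1 -> D (g t)) ->
    g 0 = g 1 ->
    exists H : R * R -> 'rV[R]_n.+1,
      [/\ {within `[0, 1] `*` `[0, 1], continuous H},
          forall s t, 0 <= s <= 1 -> 0 <= t <= 1 -> D (H (s, t)),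
          forall t, 0 <= t <= 1 -> H (0, t) = g t,
          forall t, 0 <= t <= 1 -> H (1, t) = g 0
        & forall s, 0 <= s <= 1 -> H (s, 0) = g 0 /\ H (s, 1) = g 0].

End Euclidean.

Arguments fnorm {R m n} A.

Section Calculus.
Context {R : realType}.

Definition basis_vec (n : nat) (i : 'I_n.+1) : 'rV[R]_n.+1 := delta_mx 0 i.

Definition partial (n : nat) (i : 'I_n.+1) (f : 'rV[R]_n.+1 -> R) :
    'rV[R]_n.+1 -> R :=
  fun x => 'D_(basis_vec i) f x.

Definition grad (n : nat) (f : 'rV[R]_n.+1 -> R) (x : 'rV[R]_n.+1) :
    'rV[R]_n.+1 :=
  \row_i partial i f x.

Definition laplacian (n : nat) (f : 'rV[R]_n.+1 -> R) (x : 'rV[R]_n.+1) : R :=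
  \sum_i partial i (partial i f) x.

Fixpoint classC (k n : nat) (f : 'rV[R]_n.+1 -> R) : Prop :=
  continuous f /\
  if k is k'.+1 then
    forall i, (forall x, derivable f x (basis_vec i)) /\ classC k' (partial i f)
  else True.

Definition smooth (n : nat) (f : 'rV[R]_n.+1 -> R) : Prop :=
  forall k, classC k f.

Definition test_fun (n : nat) (D : set 'rV[R]_n.+1) (psi : 'rV[R]_n.+1 -> R) :
    Prop :=
  smooth psi /\
  exists K : set 'rV[R]_n.+1,
    [/\ compact K, K `<=` D & forall x, ~ K x -> psi x = 0].

(* Value at x of the continuous extension of f : D -> V to closure D: the limit
   of f at x along D.  It is f x when x is in D and f is continuous on D. *)
Definition cont_ext (n : nat) (V : normedModType R) (D : set 'rV[R]_n.+1)
    (f : 'rV[R]_n.+1 -> V) (x : 'rV[R]_n.+1) : V :=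
  lim (f y @[y --> within D (nbhs x)]).

Definition holder_seminorm (n : nat) (V : zmodType) (nm : V -> R) (a : R)
    (D : set 'rV[R]_n.+1) (f : 'rV[R]_n.+1 -> V) : \bar R :=
  ereal_sup [set e | exists x y,
    [/\ D x, D y & e = (nm (f x - f y) / (fnorm (x - y) `^ a))%:E]].

(* C^{0,a}(D) norm; f belongs to C^{0,a}(D) iff it is finite.  The maximum with
   0 only matters for D = set0.  On the diagonal the quotient is 0 / 0 = 0. *)
Definition holder_norm (n : nat) (V : zmodType) (nm : V -> R) (a : R)
    (D : set 'rV[R]_n.+1) (f : 'rV[R]_n.+1 -> V) : \bar R :=
  (maxe 0 (ereal_sup [set (nm (f x))%:E | x in D]) +
   maxe 0 (holder_seminorm nm a D f))%E.

End Calculus.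

Section Lebesgue.
Context {R : realType}.

Definition leb2 := (@lebesgue_measure R \x @lebesgue_measure R)%E.
Definition leb3 := (leb2 \x @lebesgue_measure R)%E.

Definition vec2 (z : R * R) : 'rV[R]_2 :=
  \row_(i < 2) nth 0 [:: z.1; z.2] i.
Definition vec3 (z : R * R * R) : 'rV[R]_3 :=
  \row_(i < 3) nth 0 [:: z.1.1; z.1.2; z.2] i.

Definition int2 (f : 'rV[R]_2 -> R) : R :=
  \int[leb2]_(z in setT) f (vec2 z).

Definition int3 (D : set 'rV[R]_3) (f : 'rV[R]_3 -> R) : R :=
  \int[leb3]_(z in [set z | D (vec3 z)]) f (vec3 z).

Definition L2 (v : 'rV[R]_2 -> R) : Prop :=
  measurable_fun setT (fun z : R * R => v (vec2 z)) /\
  leb2.-integrable setT (fun z => (v (vec2 z) ^+ 2)%:E).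

Definition weak_partial (i : 'I_2) (v w : 'rV[R]_2 -> R) : Prop :=
  forall psi, test_fun setT psi ->
    int2 (fun y => v y * partial i psi y) = - int2 (fun y => w y * psi y).

(* v is in the Sobolev space H^2(R^2) and M is the square of its norm. *)
Definition H2_sqnorm (v : 'rV[R]_2 -> R) (M : R) : Prop :=
  exists (v1 : 'I_2 -> 'rV[R]_2 -> R) (v2 : 'I_2 -> 'I_2 -> 'rV[R]_2 -> R),
    [/\ L2 v,
        forall i, L2 (v1 i) /\ weak_partial i v (v1 i),
        forall i j, L2 (v2 i j) /\ weak_partial j (v1 i) (v2 i j)
      & M = int2 (fun y => v y ^+ 2)
            + \sum_i int2 (fun y => v1 i y ^+ 2)
            + \sum_i \sum_j int2 (fun y => v2 i j y ^+ 2)].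

End Lebesgue.

Section Boundary.
Context {R : realType}.

(* Local description of an open set as the region below a graph: in the
   orthonormal coordinates z = (x - gc_center) *m gc_frame, inside the ball
   B(gc_center, gc_radius), the set is { z_3 < gc_height (z_1, z_2) }. *)
Record graph_chart := GraphChart {
  gc_center : 'rV[R]_3;
  gc_radius : R;
  gc_frame : 'M[R]_3;
  gc_height : 'rV[R]_2 -> R }.

Definition gc_local (c : graph_chart) (x : 'rV[R]_3) : 'rV[R]_(2 + 1) :=
  (x - gc_center c) *m gc_frame c.

Definition gc_flat (c : graph_chart) (x : 'rV[R]_3) : 'rV[R]_2 :=
  lsubmx (gc_local c x).

Definition gc_vert (c : graph_chart) (x : 'rV[R]_3) : R :=
  rsubmx (gc_local c x) 0 0.

Definition C4_chart (Omega : set 'rV[R]_3) (c : graph_chart) : Prop :=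
  [/\ 0 < gc_radius c,
      gc_frame c *m (gc_frame c)^T = 1%:M,
      classC 4 (gc_height c)
    & forall x, eball (gc_center c) (gc_radius c) x ->
        (Omega x <-> gc_vert c x < gc_height c (gc_flat c x))].

Definition C4_boundary (Omega : set 'rV[R]_3) : Prop :=
  forall y, bd Omega y -> exists c, C4_chart Omega c /\ gc_center c = y.

Definition gc_param (c : graph_chart) (y : 'rV[R]_2) : 'rV[R]_3 :=
  gc_center c +
  (row_mx y (gc_height c y)%:M : 'rV[R]_(2 + 1)) *m (gc_frame c)^T.

Definition gc_jac (c : graph_chart) (y : 'rV[R]_2) : R :=
  Num.sqrt (1 + fnorm (grad (gc_height c) y) ^+ 2).

Definition gc_normal (c : graph_chart) (y : 'rV[R]_2) : 'rV[R]_3 :=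
  (gc_jac c y)^-1 *:
  ((row_mx (- grad (gc_height c) y) 1%:M : 'rV[R]_(2 + 1)) *m (gc_frame c)^T).

Definition is_outward_normal (Omega : set 'rV[R]_3) (y v : 'rV[R]_3) : Prop :=
  exists c, [/\ C4_chart Omega c, eball (gc_center c) (gc_radius c) y
    & v = gc_normal c (gc_flat c y)].

(* The outward unit normal at y in bd Omega (it does not depend on the chart). *)
Definition outward_normal (Omega : set 'rV[R]_3) (y : 'rV[R]_3) : 'rV[R]_3 :=
  xget 0 [set v | is_outward_normal Omega y v].

Definition is_nearest (Omega : set 'rV[R]_3) (x y : 'rV[R]_3) : Prop :=
  bd Omega y /\ fnorm (x - y) = dist x (bd Omega).

Definition unique_nearest (Omega : set 'rV[R]_3) (delta : R) : Prop :=
  forall x, dist x (bd Omega) <= 2 * delta -> exists! y, is_nearest Omega x y.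

Definition nearest (Omega : set 'rV[R]_3) (x : 'rV[R]_3) : 'rV[R]_3 :=
  xget 0 [set y | is_nearest Omega x y].

Definition normal_ext (Omega : set 'rV[R]_3) (x : 'rV[R]_3) : 'rV[R]_3 :=
  outward_normal Omega (nearest Omega x).

(* Finite atlas of bd Omega with a partition of unity.  It is used to compute
   surface integrals and the norm of H^2(bd Omega): another atlas gives the
   same integrals and an equivalent norm. *)
Record bd_atlas := BdAtlas {
  at_size : nat;
  at_chart : 'I_at_size -> graph_chart;
  at_cutoff : 'I_at_size -> 'rV[R]_3 -> R }.

Definition C4_atlas (Omega : set 'rV[R]_3) (A : bd_atlas) : Prop :=
  (forall k : 'I_(at_size A),
    let c := at_chart k in
    [/\ C4_chart Omega c, smooth (at_cutoff k), forall x, 0 <= at_cutoff k x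
      & exists2 r : R, r < gc_radius c &
          forall x, r <= fnorm (x - gc_center c) -> at_cutoff k x = 0]) /\
  forall y, bd Omega y -> \sum_(k < at_size A) at_cutoff k y = 1.

Definition surface_integral (A : bd_atlas) (g : 'rV[R]_3 -> R) : R :=
  \sum_(k < at_size A)
    int2 (fun y => at_cutoff k (gc_param (at_chart k) y) *
                   g (gc_param (at_chart k) y) * gc_jac (at_chart k) y).

(* f restricted to bd Omega is in H^2(bd Omega) and M is its squared norm. *)
Definition H2bd_sqnorm (A : bd_atlas) (f : 'rV[R]_3 -> R) (M : R) : Prop :=
  exists m : 'I_(at_size A) -> R,
    (forall k, H2_sqnorm
       (fun y => at_cutoff k (gc_param (at_chart k) y) *
                 f (gc_param (at_chart k) y)) (m k)) /\
    M = \sum_k m k.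

Definition H2bd (A : bd_atlas) (f : 'rV[R]_3 -> R) : Prop :=
  exists M, H2bd_sqnorm A f M.

(* H^{-2}(bd Omega), the dual of H^2(bd Omega): functionals are total functions
   of which only the values on H^2(bd Omega) matter. *)
Definition functional := ('rV[R]_3 -> R) -> R.

Definition Hm2_norm (A : bd_atlas) (T : functional) : \bar R :=
  ereal_sup [set e | exists f M,
    [/\ H2bd_sqnorm A f M, M <= 1 & e = `|T f|%:E]].

Definition Hm2 (A : bd_atlas) (T : functional) : Prop :=
  (forall (a : R) f g, H2bd A f -> H2bd A g ->
     T (fun x => a * f x + g x) = a * T f + T g) /\
  (Hm2_norm A T < +oo)%E.

Definition Hm2_eq (A : bd_atlas) (T1 T2 : functional) : Prop :=
  forall f, H2bd A f -> T1 f = T2 f.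

(* A continuous function g on bd Omega, seen as an element of H^{-2}. *)
Definition Hm2_of_fun (A : bd_atlas) (g : 'rV[R]_3 -> R) : functional :=
  fun f => surface_integral A (fun x => g x * f x).

(* DT is the derivative of T on [0, b[ for the norm of H^{-2}(bd Omega)
   (one-sided at 0), and it is continuous for that norm. *)
Definition Hm2_C1 (A : bd_atlas) (b : R) (T DT : R -> functional) : Prop :=
  [/\ forall s : R, 0 <= s < b -> Hm2 A (T s) /\ Hm2 A (DT s),
      forall s : R, 0 <= s < b -> forall e : R, 0 < e -> exists2 r : R, 0 < r &
        forall t : R, 0 <= t < b -> 0 < `|t - s| < r ->
          (Hm2_norm A (fun f => (t - s)^-1 * (T t f - T s f) - DT s f)%R
             <= e%:E)%E
    & forall s : R, 0 <= s < b -> forall e : R, 0 < e -> exists2 r : R, 0 < r &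
        forall t : R, 0 <= t < b -> `|t - s| < r ->
          (Hm2_norm A (fun f => DT t f - DT s f)%R <= e%:E)%E].

End Boundary.

Section Pressure.
Context {R : realType}.

Definition divergence_free (Omega : set 'rV[R]_3) (u : 'rV[R]_3 -> 'rV[R]_3) :
    Prop :=
  forall psi, test_fun Omega psi ->
    int3 Omega (fun x => dot (u x) (grad psi x)) = 0.

Definition tangential (Omega : set 'rV[R]_3) (u : 'rV[R]_3 -> 'rV[R]_3) :
    Prop :=
  forall y, bd Omega y -> dot (cont_ext Omega u y) (outward_normal Omega y) = 0.

Definition velocity (Omega : set 'rV[R]_3) (a : R)
    (u : 'rV[R]_3 -> 'rV[R]_3) : Prop :=
  [/\ (holder_norm fnorm a Omega u < +oo)%E,
      divergence_free Omega u & tangential Omega u].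

(* Profile of the cutoff function; smoothness at 0 holds since phi is constant
   on [0, delta]. *)
Definition cutoff_profile (delta : R) (phi : R -> R) : Prop :=
  [/\ forall (k : nat) r, 0 < r -> derivable (derive1n k phi) r 1,
      forall r, 0 <= r -> 0 <= phi r <= 1,
      forall r s : R, 0 <= r -> r <= s -> phi s <= phi r,
      forall r, 0 <= r <= delta -> phi r = 1
    & forall r, 2 * delta <= r -> phi r = 0].

(* phi (u . n)^2 *)
Definition normal_part (Omega : set 'rV[R]_3) (phi : R -> R)
    (u : 'rV[R]_3 -> 'rV[R]_3) (x : 'rV[R]_3) : R :=
  phi (dist x (bd Omega)) * dot (u x) (normal_ext Omega x) ^+ 2.

(* (u (x) u) : grad n = u_i u_j d_i n_j at a point of bd Omega *)
Definition curvature_term (Omega : set 'rV[R]_3) (u : 'rV[R]_3 -> 'rV[R]_3)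
    (y : 'rV[R]_3) : R :=
  let v := cont_ext Omega u y in
  \sum_(i < 3) \sum_(j < 3)
    v 0 i * v 0 j * partial i (fun x => normal_ext Omega x 0 j) y.

(* P(y, s) = P(y - s n(y)) for y in bd Omega; at s = 0 this is the boundary
   value of P. *)
Definition slice (Omega : set 'rV[R]_3) (P : 'rV[R]_3 -> R) (s : R)
    (y : 'rV[R]_3) : R :=
  cont_ext Omega P (y - s *: outward_normal Omega y).

Definition pressure_equation (Omega : set 'rV[R]_3) (phi : R -> R)
    (u : 'rV[R]_3 -> 'rV[R]_3) (P : 'rV[R]_3 -> R) : Prop :=
  forall psi, test_fun Omega psi ->
    - int3 Omega (fun x => P x * laplacian psi x) =
    int3 Omega (fun x => \sum_(i < 3) \sum_(j < 3)
      u x 0 i * u x 0 j * partial i (partial j psi) x) -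
    int3 Omega (fun x => normal_part Omega phi u x * laplacian psi x).

Definition is_P (Omega : set 'rV[R]_3) (A : bd_atlas) (delta : R)
    (phi : R -> R) (a : R) (u : 'rV[R]_3 -> 'rV[R]_3) (P : 'rV[R]_3 -> R) :
    Prop :=
  [/\ (holder_norm Num.norm a Omega P < +oo)%E,
      pressure_equation Omega phi u P,
      exists DP : R -> functional,
        Hm2_C1 A delta (fun s => Hm2_of_fun A (slice Omega P s)) DP /\
        Hm2_eq A (fun f => - DP 0 f) (Hm2_of_fun A (curvature_term Omega u))
    & int3 Omega P = int3 Omega (normal_part Omega phi u)].

Definition is_pressure (Omega : set 'rV[R]_3) (A : bd_atlas) (delta : R)
    (phi : R -> R) (a : R) (u : 'rV[R]_3 -> 'rV[R]_3) (p : 'rV[R]_3 -> R) :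
    Prop :=
  exists2 P, is_P Omega A delta phi a u P &
    forall x, Omega x -> p x = P x - normal_part Omega phi u x.

(* Existence and uniqueness of P and its Hölder bound, known background results
   on which the notion of associated pressure rests. *)
Definition P_wellposed (Omega : set 'rV[R]_3) (A : bd_atlas) (delta : R)
    (phi : R -> R) (a : R) : Prop :=
  [/\ forall u, velocity Omega a u -> exists P, is_P Omega A delta phi a u P,
      forall u P P', velocity Omega a u ->
        is_P Omega A delta phi a u P -> is_P Omega A delta phi a u P' ->
        forall x, Omega x -> P x = P' x
    & exists C : R, forall u P, velocity Omega a u ->
        is_P Omega A delta phi a u P ->
        (holder_norm Num.norm a Omega P <=
         C%:E * holder_norm fnorm a Omega (fun x => tensor (u x) (u x)))%E].

Definition collar (Omega : set 'rV[R]_3) (eta : R) : set 'rV[R]_3 :=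
  [set x | Omega x /\ dist x (bd Omega) < eta].

End Pressure.

(* Main.v *)
From HB Require Import structures.
From mathcomp Require Import all_boot all_order all_algebra.
From mathcomp Require Import all_classical all_reals all_analysis measurable_realfun.
Require Import Defs.
From mathcomp Require Import ring lra.
Set Implicit Arguments.
Unset Strict Implicit.
Unset Printing Implicit Defensive.
Import Order.TTheory GRing.Theory Num.Theory.
Import numFieldNormedType.Exports.
Local Open Scope classical_set_scope.
Local Open Scope ring_scope.

(* Let [Gamma] be smooth, radial and equal to a multiple of [1 / |x|] outside the
   unit ball, with [rho = Delta Gamma >= 0]. The dyadic rescalings of the
   mollifier [rho] differ by Laplacians of compactly supported functions,
   [rho_(n+1) - rho_n = Delta Psi_n]. Testing the pressure equation with
   [Psi_n (. - x)], and using [div u = 0] to replace [u] by [u - u x] in the double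
   divergence, shows that the averages [rho_n * p] at [x] change by
   [O(N^2 2^(-2 alpha n))], with [N] the Hoelder norm of [u], and that the
   differences of these increments at [x] and [y] are
   [O(N^2 |x - y| 2^n 2^(-2 alpha n))]. Using the second bound for [2^n |x - y| <= 1]
   and the first one beyond gives [|p x - p y| = O(N^2 |x - y|^(2 alpha))]. The
   boundary enters only through the continuity of [phi (u . n)^2], that is of the
   nearest-point map and of the normal, and through the bound on [P]. *)

(** The equation holds only against smooth test functions with compact support in [Omega], and [p]
    is merely continuous, so no Green representation or singular integral is formed. The only
    integration by parts needed is that a partial derivative of a compactly supported function has
    integral zero. The compact support of [Psi] comes from homogeneity: [1 / |x|] has degree -1, so
    [2 Gamma (2 x) - Gamma x] vanishes where [Gamma] is a multiple of it. The mass of [rho] is never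
    computed: nonnegativity makes it positive, all rescalings share it, the averages tend to the
    mass times [p x], and one divides by it at the end. Scales start at an [n0] fixed by [eta],
    since the supports must stay in [Omega]; this is how the constant comes to depend on [eta]. The
    averages at scale [n0], and pairs farther apart than [2^(-n0)], are handled by the sup bound on
    [p]. The condition [alpha < 1/2] enters as [1 < 2 * 2^(-2 alpha)]: the bounds on the differences
    of increments then grow geometrically in [n], so their sum is controlled by its last term, at
    the scale [|x - y|]. *)

(** * Integrals of continuous compactly supported functions on three-space *)

Section Integration.
Context {R : realType}.
Implicit Types (F : 'rV[R]_3 -> R) (g G : R -> R).

(** The sigma-algebra on the triple product is generated by measurable rectangles, so openness has
    to be reduced to them: an open set is the countable union of the cubes with rational centre and
    radius [1 / (k + 1)] that it contains. *)
Lemma open_measurable3 (U : set (R * R * R)) : open U -> measurable U.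
Proof.
move=> oU.
pose B (q : rat * rat * rat * nat) : set (R * R * R) :=
  [set z | ball (ratr q.1.1.1 : R) (q.2.+1%:R^-1) z.1.1] `&`
  [set z | ball (ratr q.1.1.2 : R) (q.2.+1%:R^-1) z.1.2] `&`
  [set z | ball (ratr q.1.2 : R) (q.2.+1%:R^-1) z.2].
have -> : U = \bigcup_q (if `[< B q `<=` U >] then B q else set0).
  apply/seteqP; split; last first.
    by move=> z [q _]; case: ifPn => [/asboolP|//]; apply.
  move=> z Uz; have /nbhs_ballP[e /= e0 zU] := open_nbhs_nbhs (conj oU Uz).
  have [k ke] : exists k, k.+1%:R^-1 < e / 2.
    have e20 : 0 < (e / 2)^-1 by rewrite invr_gt0 divr_gt0.
    exists (Num.truncn (e / 2)^-1); rewrite -[ltRHS]invrK ltf_pV2 ?posrE//.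
    exact: truncnS_gt.
  have k0 : (0 : R) < k.+1%:R^-1 by rewrite invr_gt0.
  have rat_near (x : R) : exists r : rat, ball (ratr r : R) k.+1%:R^-1 x.
    have xk : x - k.+1%:R^-1 < x + k.+1%:R^-1 by rewrite ltrD2l gtrN.
    have [r rx] := rat_in_itvoo xk.
    by exists r; move: rx; rewrite /ball/= distrC ltr_distlC in_itv.
  have [q0 z0] := rat_near z.1.1; have [q1 z1] := rat_near z.1.2.
  have [q2 z2] := rat_near z.2.
  exists (q0, q1, q2, k) => //; rewrite ifT//; apply/asboolP => w.
  rewrite /B/= => -[[w0 w1] w2]; apply: zU.
  have tri (x y c : R) : ball c k.+1%:R^-1 x -> ball c k.+1%:R^-1 y -> ball x e y.
    by move=> cx cy; apply: (@ball_splitr _ _ c); apply: le_ball (ltW ke) _ _.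
  by repeat split => /=; [exact: tri z0 w0|exact: tri z1 w1|exact: tri z2 w2].
apply: countable_bigcupT_measurable => [|q]; first exact: countableP.
case: ifPn => // _.
have mB (h : R * R * R -> R) (r : rat) n : measurable_fun setT h ->
    measurable [set z | ball (ratr r : R) (n.+1%:R^-1) (h z)].
  move=> mh; rewrite -[X in measurable X]setTI; apply: mh => //.
  by apply: open_measurable; apply: ball_open; rewrite invr_gt0.
apply: measurableI; first apply: measurableI; apply: mB.
- exact: (measurableT_comp measurable_fst measurable_fst).
- exact: (measurableT_comp measurable_snd measurable_fst).
- exact: measurable_snd.
Qed.

Lemma continuous_measurable3 (f : R * R * R -> R) :
  continuous f -> measurable_fun setT f.
Proof.
move=> /continuousP cf; apply: (measurability _ (RGenOpens.measurableE R)).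
move=> _ [_ [a [b ->]] <-]; rewrite setTI.
apply: open_measurable3; apply: cf; exact: interval_open.
Qed.

Lemma mx_norm_lt (n : nat) (x : 'rV[R]_n) (e : R) : 0 < e ->
  (forall i, `|x 0 i| < e) -> `|x| < e.
Proof.
move=> e0 xe; rewrite /Num.norm/= mx_normrE; apply/bigmax_ltP; split => // -[i j] _ /=.
by rewrite ord1.
Qed.

Lemma vec3_continuous : continuous (@vec3 R).
Proof.
move=> z; apply/cvgrPdist_lt => e e0.
have : nbhs z (ball z e) by exact: nbhsx_ballx.
apply: filterS => w [[w0 w1] w2].
apply: mx_norm_lt => // j; rewrite !mxE; case: j => -[|[|[|//]]] ? /=.
- exact: w0.
- exact: w1.
- exact: w2.
Qed.

Local Notation mu := (@lebesgue_measure R).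

Lemma integral_support_FTC2 g G (a b : R) : a < b -> continuous g ->
  (forall t : R, is_derive t 1 G (g t)) -> (forall t, ~~ (a < t < b) -> g t = 0) ->
  (\int[mu]_t (g t)%:E = (G b - G a)%:E)%E.
Proof.
move=> ab cg dG g0.
have cG : continuous G.
  by move=> t; apply: differentiable_continuous; apply/derivable1_diffP.
rewrite EFinB -(@continuous_FTC2 _ g) //; last 3 first.
- exact: continuous_subspaceT.
- split; first by [].
  + by apply: cvg_at_right_filter; exact: cG.
  + by apply: cvg_at_left_filter; exact: cG.
- by move=> t _; rewrite derive1E; apply: derive_val.
rewrite [RHS]integral_mkcond; apply: eq_integral => t _.
rewrite patchE; case: ifPn => // /negP tab; rewrite g0//; apply/negP => /andP[at_ tb].
by apply: tab; rewrite inE/= in_itv/= !ltW.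
Qed.

(** The primitive is the integral from minus infinity; it converges because [g] vanishes left of
    [a], so that only the segment from [a] to the endpoint contributes. *)
Lemma antiderivative g (a : R) : continuous g -> (forall t, t <= a -> g t = 0) ->
  exists G, (forall t : R, is_derive t 1 G (g t)) /\ forall t, t <= a -> G t = 0.
Proof.
move=> cg g0.
have ig u : mu.-integrable `]-oo, u] (EFin \o g).
  apply/integrable_mkcond => //.
  rewrite (_ : _ \_ _ = (EFin \o g) \_ `[a, u]); last first.
    apply/funext => t; rewrite !patchE !mem_setE !in_itv/=.
    by case: (ltP t a) => //= ta; case: ifP => // _; rewrite g0// ltW.
  apply: (@integrable_mkcond _ _ R mu `[a, u] (EFin \o g) _).1; first exact: measurable_itv.
  by apply: continuous_compact_integrable; [exact: segment_compact|
    exact: continuous_subspaceT].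
exists (fun x => \int[mu]_(t in `]-oo, x]) g t)%R; split => t; last first.
  move=> ta; rewrite /Rintegral (eq_integral (cst 0%E)) ?integral0// => s.
  by rewrite inE/= in_itv/= => st; rewrite g0// (le_trans st).
have tt1 : t < t + 1 by rewrite ltrDl.
case: (continuous_FTC1 tt1 (ig (t + 1))); [by rewrite ltNyr|exact: cg|move=> dG <-].
by rewrite derive1E; exact: derivableP.
Qed.

(** If [G] is a primitive of [g], then [G (t + h)] is one of [g (t + h)], and both integrals equal
    [G b - G a]. *)
Lemma integral_translate g (a b h : R) : a < b -> continuous g ->
  (forall t, ~~ (a < t < b) -> g t = 0) ->
  (\int[mu]_t (g (t + h))%:E = \int[mu]_t (g t)%:E)%E.
Proof.
move=> ab cg g0.
have [G dG] : exists G, forall t : R, is_derive t 1 G (g t).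
  have [|G [dG _]] := @antiderivative _ a cg; last by exists G.
  by move=> t ta; rewrite g0// ltNge ta.
rewrite (integral_support_FTC2 ab cg dG g0).
have dGh : forall t : R, is_derive t 1 (fun t => G (t + h)) (g (t + h)).
  move=> t; rewrite -[g _]mulr1.
  exact: (@is_derive1_comp _ G (shift h) t _ _ (dG _) (is_derive_shift t 1 h)).
have cgh : continuous (fun t => g (t + h)).
  move=> t; apply: continuous_comp; last exact: cg.
  by apply: cvgD; [exact: cvg_id|exact: cvg_cst].
have abh : a - h < b - h by rewrite ltrD2r.
rewrite (integral_support_FTC2 abh cgh dGh) ?subrK// => t tab.
by rewrite g0//; apply: contra tab => /andP[? ?]; apply/andP; lra.
Qed.


Definition box (c : 'rV[R]_3) (r : R) : set (R * R * R) :=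
  (ball (c 0 0) r `*` ball (c 0 1) r) `*` ball (c 0 2) r.

Lemma ord3P (P : 'I_3 -> Prop) : P 0 -> P 1 -> P 2 -> forall i, P i.
Proof.
move=> P0 P1 P2 [[|[|[|//]]] ?].
- by rewrite (_ : Ordinal _ = 0) //; apply/val_inj.
- by rewrite (_ : Ordinal _ = 1) //; apply/val_inj.
- by rewrite (_ : Ordinal _ = 2) //; apply/val_inj.
Qed.

Lemma boxE (c : 'rV[R]_3) (r : R) z :
  box c r z <-> forall i, `|vec3 z 0 i - c 0 i| < r.
Proof.
split=> [[[/= z0 z1] z2]|h].
  by apply: ord3P; rewrite distrC !mxE.
by split; [split|]; rewrite /ball /= distrC;
  [have := h 0|have := h 1|have := h 2]; rewrite !mxE.
Qed.

Lemma measurable_box (c : 'rV[R]_3) (r : R) : measurable (box c r).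
Proof.
by apply: measurableX; first apply: measurableX; exact: measurable_ball.
Qed.

Lemma leb3_box (c : 'rV[R]_3) (r : R) : 0 <= r -> leb3 (box c r) = ((2 * r) ^+ 3)%:E.
Proof.
pose b i : set R := ball (c 0 i) r; pose mu := @lebesgue_measure R.
have mb i : measurable (b i) by exact: measurable_ball.
move=> r0; have := measurableX (mb 0) (mb 1).
rewrite /box -/(b 0) -/(b 1) -/(b 2).
have muE i : mu (b i) = (r *+ 2)%:E by rewrite /mu lebesgue_measure_ball.
move: (b 0) (b 1) (b 2) (mb 0) (mb 1) (mb 2) (muE 0) (muE 1) (muE 2).
move=> B0 B1 B2 m0 m1 m2 E0 E1 E2 m01.
have -> : leb3 (B0 `*` B1 `*` B2) = (leb2 (B0 `*` B1) * mu B2)%E.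
  exact: product_measure1E.
have -> : leb2 (B0 `*` B1) = (mu B0 * mu B1)%E.
  exact: product_measure1E.
rewrite E0 E1 E2 -!EFinM; congr _%:E.
by rewrite -mulr_natl; ring.
Qed.

(** One large coordinate is enough for [F] to vanish, so [F] is zero outside the open sup-norm cube
    of half-side [r], its faces included. *)
Definition supported_in (n : nat) (c : 'rV[R]_n) (r : R) (F : 'rV[R]_n -> R) : Prop :=
  forall (x : 'rV[R]_n) i, r <= `|x 0 i - c 0 i| -> F x = 0.

Definition ccont F : Prop := continuous F /\ exists r, supported_in 0 r F.

Lemma ccont_supported F c r : continuous F -> supported_in c r F -> ccont F.
Proof.
move=> cF Fc; split=> //; exists (r + \sum_i `|c 0 i|) => x i; rewrite mxE subr0 => xi.
apply: (Fc x i); have : `|c 0 i| <= \sum_i `|c 0 i|.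
  by rewrite (bigD1 i)//= lerDl sumr_ge0.
have := lerB_dist (x 0 i) (c 0 i); lra.
Qed.

Lemma bounded_on_box F (c : 'rV[R]_3) (r : R) : continuous F ->
  exists B, forall x : 'rV[R]_3, (forall i, `|x 0 i - c 0 i| <= r) -> `|F x| <= B.
Proof.
move=> cF; pose A := [set x : 'rV[R]_3 | forall i, x 0 i \in `[c 0 i - r, c 0 i + r]].
have cA : compact A.
  apply: (@rV_compact _ _ (fun i => `[c 0 i - r, c 0 i + r]%classic)).
  by move=> i; exact: segment_compact.
have AE (x : 'rV[R]_3) : A x <-> forall i, `|x 0 i - c 0 i| <= r.
  by split=> h i; have := h i; rewrite /= in_itv/= ler_distl.
have [A0|/set0P/negP/negPn/eqP A0] := pselect (A !=set0); last first.
  by exists 0 => x /AE; rewrite A0.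
have [|y _ yB] := EVT_max_rV A0 cA (f := fun x => `|F x|).
  apply: continuous_subspaceT => x.
  by apply: (continuous_comp (cF x)); exact: norm_continuous.
by exists `|F y| => x /AE Ax; apply: yB; rewrite inE.
Qed.

Lemma ccont_bounded F : ccont F -> exists2 B, 0 <= B & forall x, `|F x| <= B.
Proof.
move=> [cF [r Fr]]; have [B FB] := @bounded_on_box F 0 r cF.
exists `|B| => // x; have [h|/existsNP[i /negP]] := pselect (forall i, `|x 0 i - (0 : 'rV[R]_3) 0 i| <= r).
  by rewrite (le_trans (FB x h))// ler_norm.
by rewrite -ltNge => /ltW/Fr ->; rewrite normr0.
Qed.

Lemma ccont_measurable F : ccont F -> measurable_fun setT (fun z => F (vec3 z)).
Proof.
move=> [cF _]; apply: continuous_measurable3 => z.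
by apply: continuous_comp; [exact: vec3_continuous|exact: cF].
Qed.

Lemma bounded_support_integrable d (T : measurableType d)
    (m : {measure set T -> \bar R}) (D : set T) (f : T -> R) (B : R) :
  measurable D -> (m D < +oo)%E -> measurable_fun setT f ->
  (forall x, `|f x| <= B) -> (forall x, ~ D x -> f x = 0) ->
  m.-integrable setT (EFin \o f).
Proof.
move=> mD mDoo mf fB f0.
rewrite (_ : EFin \o f = (EFin \o f) \_ D); last first.
  apply/funext => x; rewrite patchE; case: ifPn => // /negP.
  by rewrite inE /= => /f0 ->.
apply: (@integrable_mkcond _ _ R m D (EFin \o f) _).1 => //.
apply: measurable_bounded_integrable => //; first exact: measurable_funTS.
exists B; split=> [|r Br x _]; first exact: num_real.
exact: le_trans (fB x) (ltW Br).
Qed.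

Lemma ccont_integrable F : ccont F ->
  leb3.-integrable setT (fun z => (F (vec3 z))%:E).
Proof.
move=> ccF; have [B _ FB] := ccont_bounded ccF.
have [_ [r Fr]] := ccF.
have := @bounded_support_integrable _ _ leb3 (box 0 `|r|) (fun z => F (vec3 z)) B.
apply => //.
- exact: measurable_box.
- apply: (@le_lt_trans _ _ ((2 * `|r|) ^+ 3)%:E); last exact: ltry.
  by rewrite -(leb3_box 0 (normr_ge0 r)).
- exact: ccont_measurable.
- move=> z /boxE/existsNP[i /negP]; rewrite -leNgt => h.
  by apply: (Fr _ i); apply: le_trans h; exact: ler_norm.
Qed.

Lemma int3TE F : int3 setT F = (\int[leb3]_z F (vec3 z))%R.
Proof. by []. Qed.

Lemma int3D F1 F2 : ccont F1 -> ccont F2 ->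
  int3 setT (fun x => F1 x + F2 x) = int3 setT F1 + int3 setT F2.
Proof.
by move=> c1 c2; rewrite !int3TE; apply: RintegralD => //; exact: ccont_integrable.
Qed.

Lemma int3B F1 F2 : ccont F1 -> ccont F2 ->
  int3 setT (fun x => F1 x - F2 x) = int3 setT F1 - int3 setT F2.
Proof.
by move=> c1 c2; rewrite !int3TE; apply: RintegralB => //; exact: ccont_integrable.
Qed.

Lemma int3Z F (k : R) : ccont F -> int3 setT (fun x => k * F x) = k * int3 setT F.
Proof.
by move=> cF; rewrite !int3TE; apply: RintegralZl => //; exact: ccont_integrable.
Qed.

Lemma int3_norm_le F (c : 'rV[R]_3) (r B : R) : continuous F -> 0 <= r -> 0 <= B ->
  supported_in c r F -> (forall x, `|F x| <= B) ->
  `|int3 setT F| <= B * (2 * r) ^+ 3.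
Proof.
move=> cF r0 B0 Fc FB; have ccF := ccont_supported cF Fc.
have iF := ccont_integrable ccF.
apply: le_trans (le_normr_Rintegral measurableT iF) _.
rewrite -lee_fin /Rintegral fineK; last first.
  have /integrableP[mF Foo] := iF.
  by rewrite ge0_fin_numE// integral_ge0.
rewrite EFinM -(leb3_box c r0).
have -> : (\int[leb3]_z `|F (vec3 z)|%:E = \int[leb3]_(z in box c r) `|F (vec3 z)|%:E)%E.
  rewrite [RHS]integral_mkcond; apply: eq_integral => z _.
  rewrite patchE; case: ifPn => // /negP; rewrite inE => /boxE/existsNP[i /negP].
  by rewrite -leNgt => /Fc ->; rewrite normr0.
have mB := measurable_box c r.
apply: (@le_trans _ _ (\int[leb3]_(z in box c r) B%:E)%E); last by rewrite integral_cst.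
apply: ge0_le_integral => //; last by move=> z _; rewrite lee_fin.
apply: measurable_funTS; apply/measurable_EFinP; apply: measurableT_comp => //.
exact: ccont_measurable.
Qed.

Lemma int3_gt0 F (x0 : 'rV[R]_3) : ccont F -> (forall x, 0 <= F x) -> 0 < F x0 ->
  0 < int3 setT F.
Proof.
move=> ccF F0 Fx0; have iF := ccont_integrable ccF.
have [cF _] := ccF.
have : \forall x \near x0, F x0 / 2 < F x.
  by have /cvgr_gt := cF x0; apply; lra.
move=> /nbhs_ballP[r /= r0 xr].
rewrite -lte_fin /int3 /Rintegral fineK; last exact: (integrable_fin_num measurableT iF).
have mF := ccont_measurable ccF; have mB := measurable_box x0 r.
apply: (@lt_le_trans _ _ (\int[leb3]_(z in box x0 r) (F x0 / 2)%:E)%E).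
  rewrite integral_cst//.
  apply: (@lt_le_trans _ _ ((F x0 / 2)%:E * ((2 * r) ^+ 3)%:E)%E).
    by rewrite -EFinM lte_fin mulr_gt0 ?exprn_gt0 ?mulr_gt0 ?divr_gt0.
  apply: lee_wpmul2l; first by rewrite lee_fin divr_ge0// ltW.
  by rewrite -(leb3_box x0 (ltW r0)).
apply: (@le_trans _ _ (\int[leb3]_(z in box x0 r) (F (vec3 z))%:E)%E).
  apply: ge0_le_integral => //.
  - by move=> z _; rewrite lee_fin divr_ge0// ltW.
  - by apply: measurable_funTS; exact/measurable_EFinP.
  move=> z /boxE h; rewrite lee_fin ltW//; apply: xr.
  rewrite -ball_normE; apply: mx_norm_lt => // i.
  by rewrite 2!mxE distrC; exact: h.
apply: ge0_subset_integral => //; [exact: measurableT|exact/measurable_EFinP|].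
by move=> z _; rewrite lee_fin.
Qed.
End Integration.

(** * Fubini along coordinate lines, translation invariance, integrals of partial derivatives *)

Section Slices.
Context {R : realType}.
Implicit Types (F : 'rV[R]_3 -> R) (g G : R -> R).
Local Notation mu := (@lebesgue_measure R).


Lemma vec3_split (a b c : R) :
  [/\ vec3 (a, b, c) = vec3 (a, b, 0) + c *: delta_mx 0 2,
      vec3 (a, b, c) = vec3 (a, 0, c) + b *: delta_mx 0 1
    & vec3 (a, b, c) = vec3 (0, b, c) + a *: delta_mx 0 0].
Proof.
by split; apply/rowP; apply: ord3P; rewrite !mxE /= ?(mulr1, mulr0, addr0, add0r).
Qed.

Lemma ccont_section_integrable F (c : R) : ccont F ->
  leb2.-integrable setT (fun w => (F (vec3 (w, c)))%:E).
Proof.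
move=> ccF; have [B _ FB] := ccont_bounded ccF; have [_ [r Fr]] := ccF.
pose b : set R := ball (0 : R) `|r|.
have mb : measurable b by exact: measurable_ball.
have bN t : ~ b t -> r <= `|t|.
  move=> /negP; rewrite /b /ball/= sub0r normrN -leNgt; apply: le_trans.
  exact: ler_norm.
have := @bounded_support_integrable R _ _ leb2 (b `*` b) (fun w => F (vec3 (w, c))) B.
apply => //.
- exact: measurableX.
- have E : leb2 (b `*` b) = (mu b * mu b)%E by exact: product_measure1E.
  apply: (@le_lt_trans _ _ (`|r| *+ 2 * (`|r| *+ 2))%:E); last exact: ltry.
  by move: E; rewrite !lebesgue_measure_ball// -EFinM => <-.
- have mc : measurable_fun setT (fun w : R * R => (w, c)) by exact: measurable_fun_pair.
  exact: (measurableT_comp (ccont_measurable ccF) mc).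
- move=> [x y] /not_andP[]/= /bN h; [apply: (Fr _ 0)|apply: (Fr _ 1)];
    by rewrite !mxE/= subr0.
Qed.

(** A named copy of the planar measure that can carry a sigma-finite structure, as Fubini for the
    product of the plane and a line requires. *)
Definition leb2_sfin : set (measurableTypeR R * measurableTypeR R) -> \bar R :=
  (mu \x mu)%E.

HB.instance Definition _ := Measure.on leb2_sfin.

Lemma leb2_sigma_finite : sigma_finite setT leb2_sfin.
Proof.
have /sigma_finiteP[D [TD ndD Doo]] := sigma_finiteT mu.
exists (fun n => D n `*` D n).
  rewrite -setXTT TD predeqE => -[x y]; split.
    move=> [/= [n _ Dnx] [k _ Dky]]; exists (maxn n k) => //; split.
    - by move: x Dnx; exact/subsetPset/ndD/leq_maxl.
    - by move: y Dky; exact/subsetPset/ndD/leq_maxr.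
  by move=> [n _ []/= ? ?]; split; exists n.
move=> k; have [mD Dk] := Doo k; split; first exact: measurableX.
have -> : leb2_sfin (D k `*` D k) = (mu (D k) * mu (D k))%E by exact: product_measure1E.
by rewrite lte_mul_pinfty// ge0_fin_numE.
Qed.

HB.instance Definition _ :=
  Measure_isSigmaFinite.Build _ _ _ leb2_sfin leb2_sigma_finite.

Lemma Fubini3 F : ccont F ->
  (\int[leb3]_z (F (vec3 z))%:E =
     \int[leb2]_w \int[mu]_t (F (vec3 (w, t)))%:E)%E /\
  (\int[leb3]_z (F (vec3 z))%:E =
     \int[mu]_t \int[leb2]_w (F (vec3 (w, t)))%:E)%E.
Proof.
move=> /ccont_integrable iF; split; apply/esym.
  exact: (@integral12_prod_meas1 _ _ _ _ R leb2_sfin mu _ iF).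
exact: (@integral21_prod_meas1 _ _ _ _ R leb2_sfin mu _ iF).
Qed.

Lemma Fubini2 F (t : R) : ccont F ->
  (\int[leb2]_w (F (vec3 (w, t)))%:E =
     \int[mu]_a \int[mu]_b (F (vec3 (a, b, t)))%:E)%E /\
  (\int[leb2]_w (F (vec3 (w, t)))%:E =
     \int[mu]_b \int[mu]_a (F (vec3 (a, b, t)))%:E)%E.
Proof.
move=> /(ccont_section_integrable t) iF; split; apply/esym.
  exact: (@integral12_prod_meas1 _ _ _ _ R mu mu _ iF).
exact: (@integral21_prod_meas1 _ _ _ _ R mu mu _ iF).
Qed.

(** Fubini, in the order that makes the [i]-th variable innermost. It turns identities between space
    integrals into identities on lines, where the fundamental theorem of calculus applies. *)
Lemma int3_eq_lines (i : 'I_3) F1 F2 : ccont F1 -> ccont F2 ->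
  (forall x, \int[mu]_t (F1 (x + t *: delta_mx 0 i))%:E =
             \int[mu]_t (F2 (x + t *: delta_mx 0 i))%:E)%E ->
  int3 setT F1 = int3 setT F2.
Proof.
move=> c1 c2 h; rewrite /int3 /Rintegral; congr fine.
have [E12 E21] := Fubini3 c1; have [E12' E21'] := Fubini3 c2.
have S1 t := Fubini2 t c1; have S2 t := Fubini2 t c2.
have V := vec3_split.
move: i h; apply: ord3P => h.
- rewrite [LHS]E21 [RHS]E21'; apply: eq_integral => t _.
  rewrite (S1 t).2 (S2 t).2; apply: eq_integral => b _.
  have := h (vec3 (0, b, t)); have Ve a := let: And3 _ _ e := V a b t in esym e.
  by under eq_integral do rewrite Ve; under [in RHS]eq_integral do rewrite Ve.
- rewrite [LHS]E21 [RHS]E21'; apply: eq_integral => t _.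
  rewrite (S1 t).1 (S2 t).1; apply: eq_integral => a _.
  have := h (vec3 (a, 0, t)); have Ve b := let: And3 _ e _ := V a b t in esym e.
  by under eq_integral do rewrite Ve; under [in RHS]eq_integral do rewrite Ve.
- rewrite [LHS]E12 [RHS]E12'; apply: eq_integral => -[a b] _.
  have := h (vec3 (a, b, 0)); have Ve t := let: And3 e _ _ := V a b t in esym e.
  by under eq_integral do rewrite Ve; under [in RHS]eq_integral do rewrite Ve.
Qed.

Lemma supported_line F (r : R) (i : 'I_3) (x : 'rV[R]_3) (t : R) :
  supported_in 0 r F -> ~~ (- (`|r| + `|x 0 i|) - 1 < t < `|r| + `|x 0 i| + 1) ->
  F (x + t *: delta_mx 0 i) = 0.
Proof.
move=> Fr tb; apply: (Fr _ i); rewrite !mxE !eqxx mulr1 subr0.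
have {}tb : `|r| + `|x 0 i| <= `|t|.
  rewrite leNgt; apply: contra tb; rewrite ltr_norml => /andP[? ?]; apply/andP; split; lra.
have := lerB_normD t (x 0 i); have := ler_norm r; rewrite [x 0 i + t]addrC; lra.
Qed.

Lemma is_derive_line (n : nat) (F : 'rV[R]_n -> R) (x v : 'rV[R]_n) (t : R) :
  derivable F (x + t *: v) v ->
  is_derive t 1 (fun s : R => F (x + s *: v)) ('D_v F (x + t *: v)).
Proof.
move=> dF.
have E : (fun h : R => h^-1 *: (((fun s : R => F (x + s *: v)) \o shift t) (h *: 1)
      - F (x + t *: v)))
    = (fun h : R => h^-1 *: ((F \o shift (x + t *: v)) (h *: v) - F (x + t *: v))).
  apply/funext => h /=; congr (_ *: (F _ - _)).
  by rewrite scalerDl addrCA /GRing.scale/= mulr1.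
by split; rewrite /derivable /derive E.
Qed.

Lemma line_continuous F (i : 'I_3) (x : 'rV[R]_3) : continuous F ->
  continuous (fun t : R => F (x + t *: delta_mx 0 i)).
Proof.
move=> cF t; apply: continuous_comp; last exact: cF.
by apply: cvgD; [exact: cvg_cst|apply: cvgZr_tmp; exact: cvg_id].
Qed.

Lemma shift_continuous (n : nat) (h : 'rV[R]_n) : continuous (fun x : 'rV[R]_n => x + h).
Proof.
by move=> x; apply: (@continuousD R _ _ id (cst h)); [exact: cvg_id|exact: cst_continuous].
Qed.

Lemma ccont_translate F (h : 'rV[R]_3) : ccont F -> ccont (fun x => F (x + h)).
Proof.
move=> [cF [r Fr]]; apply: (@ccont_supported _ _ (- h) r).
  by move=> x; apply: continuous_comp; [exact: shift_continuous|exact: cF].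
by move=> x i; rewrite mxE => xi; apply: (Fr _ i); rewrite !mxE subr0 -[h 0 i]opprK.
Qed.

Lemma int3_translate F (h : 'rV[R]_3) : ccont F ->
  int3 setT (fun x => F (x + h)) = int3 setT F.
Proof.
have step (i : 'I_3) (c : R) (G : 'rV[R]_3 -> R) : ccont G ->
    int3 setT (fun x => G (x + c *: delta_mx 0 i)) = int3 setT G.
  move=> cG; apply: (@int3_eq_lines i _ _ (ccont_translate _ cG) cG) => x.
  have [cG0 [r Gr]] := cG.
  under eq_integral do rewrite -addrA -scalerDl.
  have ab : - (`|r| + `|x 0 i|) - 1 < `|r| + `|x 0 i| + 1.
    by have := normr_ge0 r; have := normr_ge0 (x 0 i); lra.
  apply: (integral_translate c ab (@line_continuous G i x cG0)) => t.
  exact: supported_line Gr.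
move=> cF.
have -> : (fun x => F (x + h)) =
    (fun x => F (x + h 0 0 *: delta_mx 0 0 + h 0 1 *: delta_mx 0 1
                   + h 0 2 *: delta_mx 0 2)).
  apply/funext => x; congr F; rewrite -!addrA; congr (x + _).
  by apply/rowP; apply: ord3P; rewrite !mxE /= ?(mulr1, mulr0, addr0, add0r).
rewrite (step 0 (h 0 0) (fun x => F (x + h 0 1 *: delta_mx 0 1 + h 0 2 *: delta_mx 0 2))).
  rewrite (step 1 (h 0 1) (fun x => F (x + h 0 2 *: delta_mx 0 2))).
    exact: step.
  exact: ccont_translate.
by under eq_fun do rewrite -addrA; exact: ccont_translate.
Qed.

(** On every line of direction [i] the integral is a difference of two values of [F] taken outside
    its support. *)
Lemma int3_partial F (i : 'I_3) : ccont F -> ccont (partial i F) ->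
  (forall x, derivable F x (delta_mx 0 i)) -> int3 setT (partial i F) = 0.
Proof.
move=> cF cdF dF.
transitivity (int3 setT (fun _ : 'rV[R]_3 => 0 : R)); last first.
  by rewrite int3TE /Rintegral integral0.
apply: (@int3_eq_lines i) => //.
  by apply: (@ccont_supported _ _ 0 0) => //; exact: cst_continuous.
move=> x; rewrite integral0.
have [cF0 [r Fr]] := cF; have [cdF0 [r' dFr]] := cdF.
pose s := Num.max `|r| `|r'| .
have Fs : supported_in 0 s F.
  move=> y j sy; apply: (Fr _ j); apply: le_trans sy.
  by rewrite le_max ler_norm.
have dFs : supported_in 0 s (partial i F).
  move=> y j sy; apply: (dFr _ j); apply: le_trans sy.
  by rewrite le_max ler_norm orbT.
pose b := `|s| + `|x 0 i| + 1.
have ab : - (`|s| + `|x 0 i|) - 1 < b.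
  by rewrite /b; have := normr_ge0 s; have := normr_ge0 (x 0 i); lra.
have dG (t : R) : is_derive t 1 (fun t : R => F (x + t *: delta_mx 0 i))
    (partial i F (x + t *: delta_mx 0 i)).
  exact: is_derive_line.
rewrite (integral_support_FTC2 ab (@line_continuous _ i x cdF0) dG).
  rewrite !(supported_line Fs) ?subrr// -/b ?ltxx ?andbF//.
by move=> t; exact: supported_line dFs.
Qed.
End Slices.

(** * Chain rules for directional derivatives, through restriction to lines *)

Section DirectionalDerivatives.
Context {R : realType}.

Lemma is_derive_mull (c t : R) : is_derive t 1 (fun t : R => c * t) c.
Proof.
have -> : (fun t : R => c * t) = c *: (id : R -> R) by [].
by apply: is_derive_eq; rewrite /GRing.scale/= mulr1.
Qed.

Lemma derive_ofline (n : nat) (f : 'rV[R]_n -> R) (x v : 'rV[R]_n) (d : R) :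
  is_derive (0 : R) 1 (fun h : R => f (x + h *: v)) d -> is_derive x v f d.
Proof.
have E : (fun h : R => h^-1 *: (((fun s : R => f (x + s *: v)) \o shift 0) (h *: 1)
      - f (x + 0 *: v)))
    = (fun h : R => h^-1 *: ((f \o shift x) (h *: v) - f x)).
  apply/funext => h /=; rewrite scale0r !addr0; congr (_ *: (f _ - _)).
  by rewrite addrC /GRing.scale/= mulr1.
by move=> [df Df]; split; move: df Df; rewrite /derivable /derive E.
Qed.

Lemma is_derive_real_comp (n : nat) (G : R -> R) (q : 'rV[R]_n -> R)
    (x v : 'rV[R]_n) (dG dq : R) :
  is_derive x v q dq -> is_derive (q x) 1 G dG ->
  is_derive x v (fun y => G (q y)) (dG * dq).
Proof.
move=> dqx dGx; apply: derive_ofline.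
have [] := dqx; rewrite -{1}[x]addr0 -{1}(scale0r v) => /is_derive_line lq qE.
rewrite scale0r addr0 qE in lq.
have h : is_derive (q (x + (0 : R) *: v)) 1 G dG by rewrite scale0r addr0.
exact: (@is_derive1_comp _ G (fun h : R => q (x + h *: v)) 0 _ _ h lq).
Qed.

Lemma is_derive_affine (n : nat) (f : 'rV[R]_n -> R) (x v h : 'rV[R]_n) (a : R) :
  derivable f (a *: (x + h)) v ->
  is_derive x v (fun y => f (a *: (y + h))) (a * 'D_v f (a *: (x + h))).
Proof.
move=> df; apply: derive_ofline.
rewrite (_ : (fun _ => _) =
    (fun s : R => f (a *: (x + h) + s *: v)) \o (fun t : R => a * t)); last first.
  by apply/funext => t /=; rewrite addrAC scalerDr scalerA.
rewrite mulrC; apply: is_derive1_comp.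
  have := @is_derive_line R n f (a *: (x + h)) v (a * 0).
  by rewrite mulr0 scale0r addr0; apply.
exact: is_derive_mull.
Qed.

End DirectionalDerivatives.

(** * Mean value theorem from partial derivatives alone *)

Section MeanValue.
Context {R : realType} (n : nat).
Implicit Types (F : 'rV[R]_n.+1 -> R) (x y : 'rV[R]_n.+1).

Lemma mean_value_coord F x (i : 'I_n.+1) (c : R) :
  (forall z, derivable F z (basis_vec i)) ->
  exists2 s : R, 0 <= s <= 1 &
    F (x + c *: basis_vec i) - F x = c * partial i F (x + (s * c) *: basis_vec i).
Proof.
move=> dF; pose g (t : R) := F (x + (c * t) *: basis_vec i).
have dg (t : R) : is_derive t 1 g (partial i F (x + (c * t) *: basis_vec i) * c).
  apply: (@is_derive1_comp _ (fun s : R => F (x + s *: basis_vec i)) (fun t : R => c * t)).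
    exact: is_derive_line.
  exact: is_derive_mull.
have [|s s01 gE] := @MVT_segment R g _ 0 1 ler01 (fun t _ => dg t).
  apply: derivable_within_continuous => t _; by have [] := dg t.
exists s; first by move: s01; rewrite in_itv.
by move: gE; rewrite /g mulr1 mulr0 scale0r addr0 subr0 mulr1 mulrC (mulrC s).
Qed.

(** Walking from [x] to [y] one coordinate at a time uses the one-variable theorem on each edge, so
    no total differentiability is required; the intermediate points stay in the box spanned by [x]
    and [y]. *)
Lemma mean_value F x y : (forall i z, derivable F z (basis_vec i)) ->
  exists xi : 'I_n.+1 -> 'rV[R]_n.+1,
    (forall k i, `|xi k 0 i - x 0 i| <= `|y 0 i - x 0 i|) /\
    F y - F x = \sum_k (y 0 k - x 0 k) * partial k F (xi k).
Proof.
move=> dF.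
(* Corner number [j] of the walk: the first [j] coordinates come from [y], the others from [x]. *)
pose z (j : nat) : 'rV[R]_n.+1 := \row_i (if (i < j)%N then y 0 i else x 0 i).
have zS (k : 'I_n.+1) : z k.+1 = z k + (y 0 k - x 0 k) *: basis_vec k.
  apply/rowP => i; rewrite !mxE /= ltnS leq_eqVlt.
  have [->|ik] := eqVneq i k; first by rewrite eqxx/= ltnn mulr1 addrC subrK.
  by rewrite -val_eqE/= in ik; rewrite (negbTE ik)/= mulr0 addr0.
have /choice[s sP] : forall k : 'I_n.+1, exists s : R, 0 <= s <= 1 /\
    F (z k.+1) - F (z k) =
    (y 0 k - x 0 k) * partial k F (z k + (s * (y 0 k - x 0 k)) *: basis_vec k).
  move=> k; have [s s01 sE] := mean_value_coord (z k) (y 0 k - x 0 k) (dF k).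
  by exists s; rewrite zS.
exists (fun k : 'I_n.+1 => z k + (s k * (y 0 k - x 0 k)) *: basis_vec k); split.
  move=> k i; have [/andP[s0 s1] _] := sP k; rewrite !mxE /=.
  have [->|ik] := eqVneq i k.
    rewrite ltnn mulr1 (addrC (x 0 k)) addrK normrM ger0_norm//.
    by rewrite ler_piMl.
  rewrite mulr0 addr0; case: ifP => // _.
  by rewrite subrr normr0.
transitivity (\sum_(k < n.+1) (F (z k.+1) - F (z k))); last first.
  by apply: eq_bigr => k _; have [_ ->] := sP k.
rewrite -(big_mkord xpredT (fun k => F (z k.+1) - F (z k))) telescope_sumr//.
by congr (F _ - F _); apply/rowP => i; rewrite mxE // ltn_ord.
Qed.

Lemma lipschitz_partial F (S : R) x y :
  (forall i z, derivable F z (basis_vec i)) ->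
  (forall i z, `|partial i F z| <= S) ->
  `|F y - F x| <= S * \sum_k `|y 0 k - x 0 k|.
Proof.
move=> dF FS; have [xi [_ ->]] := mean_value x y dF.
rewrite mulr_sumr; apply: le_trans (ler_norm_sum _ _ _) _.
by apply: ler_sum => k _; rewrite normrM mulrC ler_wpM2r.
Qed.

End MeanValue.

(** * Smooth functions of one variable and the flat function *)

Section SmoothReal.
Context {R : realType}.
Implicit Types (g : R -> R).

Fixpoint real_classC (k : nat) g : Prop :=
  continuous g /\
  if k is k'.+1 then
    exists2 dg : R -> R, (forall t : R, is_derive t 1 g (dg t)) & real_classC k' dg
  else True.

Lemma real_classC_continuous k g : real_classC k g -> continuous g.
Proof. by case: k => [|k] []. Qed.

Lemma is_derive_continuous g (dg : R -> R) :
  (forall t : R, is_derive t 1 g (dg t)) -> continuous g.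
Proof. by move=> d t; apply: differentiable_continuous; apply/derivable1_diffP. Qed.

Lemma real_classCS k g (dg : R -> R) : (forall t : R, is_derive t 1 g (dg t)) ->
  real_classC k dg -> real_classC k.+1 g.
Proof. by move=> d c; split; [exact: is_derive_continuous d|exists dg]. Qed.

Lemma real_classC_le k g : real_classC k.+1 g -> real_classC k g.
Proof.
elim: k g => [|k IH] g [cg [dg d c]]; split=> //.
by exists dg => //; exact: IH.
Qed.

Lemma real_classC_cst k (c : R) : real_classC k (cst c).
Proof.
elim: k c => [|k IH] c; first by split => //; exact: cst_continuous.
by apply: (real_classCS (fun t => is_derive_cst c t 1)); exact: IH.
Qed.

Lemma real_classCD k g1 g2 : real_classC k g1 -> real_classC k g2 ->
  real_classC k (g1 + g2).
Proof.
elim: k g1 g2 => [|k IH] g1 g2 [c1 H1] [c2 H2].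
  by split => // t; apply: continuousD; [exact: c1|exact: c2].
have [d1 D1 C1] := H1; have [d2 D2 C2] := H2.
by apply: (@real_classCS _ _ (d1 + d2)); exact: IH.
Qed.

Lemma real_classCM k g1 g2 : real_classC k g1 -> real_classC k g2 ->
  real_classC k (g1 * g2).
Proof.
elim: k g1 g2 => [|k IH] g1 g2 h1 h2.
  split=> // t.
  by apply: continuousM; [exact: (real_classC_continuous h1)|
    exact: (real_classC_continuous h2)].
have [_ [d1 D1 C1]] := h1; have [_ [d2 D2 C2]] := h2.
apply: (@real_classCS _ _ (g1 * d2 + g2 * d1)).
by apply: real_classCD; apply: IH => //; exact: real_classC_le.
Qed.

Lemma real_classCZ k (c : R) g : real_classC k g -> real_classC k (cst c * g).
Proof. by move=> h; apply: real_classCM => //; exact: real_classC_cst. Qed.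

Lemma real_classC_affine k (a b : R) g : real_classC k g ->
  real_classC k (fun t => g (a * t + b)).
Proof.
have dab (t : R) : is_derive t 1 (fun t : R => a * t + b) a.
  have h := @is_deriveD R _ _ (fun t : R => a * t) (cst b) t 1 a 0
    (is_derive_mull a t) (is_derive_cst b t 1).
  by move: h; rewrite addr0.
elim: k g => [|k IH] g [cg H].
  split=> // t; apply: continuous_comp; last exact: cg.
  exact: (is_derive_continuous dab).
have [dg D C] := H.
apply: (@real_classCS _ _ (cst a * (fun t => dg (a * t + b)))); last first.
  exact/real_classCZ/IH.
move=> t; rewrite [X in is_derive _ _ _ X]/GRing.mul/= mulrC.
by apply: (@is_derive1_comp R g (fun t => a * t + b)).
Qed.

(* The derivatives of [exp (-1/t)] are combinations of these functions, which
   are flat at [0]. *)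
Definition flat (j : nat) (t : R) : R :=
  if t <= 0 then 0 else t^-1 ^+ j * expR (- t^-1).

Lemma flat_ge0 j t : 0 <= flat j t.
Proof.
rewrite /flat; case: (leP t 0) => //= t0.
by rewrite mulr_ge0 ?expR_ge0// exprn_ge0// invr_ge0 ltW.
Qed.

(** With [s = 1 / t], the exponential series gives [exp s >= s^(j+2) / (j+2)!]. A quadratic bound is
    what makes the derivative at [0] exist and vanish. *)
Lemma flat_le j t : flat j t <= j.+2`!%:R * t ^+ 2.
Proof.
rewrite /flat; case: (leP t 0) => /= t0; first by rewrite mulr_ge0 ?sqr_ge0.
have s0 : 0 < t^-1 by rewrite invr_gt0.
have e0 : 0 < expR (t^-1) :> R by exact: expR_gt0.
have -> : t ^+ 2 = (t^-1 ^+ 2)^-1 by rewrite exprVn invrK.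
rewrite expRN ler_pdivrMr// mulrAC ler_pdivlMr ?exprn_gt0//.
rewrite -exprD addn2 mulrC -ler_pdivrMr ?ltr0n ?fact_gt0//.
have := @expR_ge1Dxn R t^-1 j.+1 (ltW s0); apply: le_trans.
by rewrite lerDr.
Qed.

Lemma is_derive0_quadratic g (C : R) : g 0 = 0 ->
  (forall s, `|g s| <= C * s ^+ 2) -> is_derive (0 : R) 1 g 0.
Proof.
move=> g0 gC.
have h : (fun h : R => h^-1 *: ((g \o shift 0) (h *: 1) - g 0)) @ 0^' --> (0 : R).
  apply/cvgr0Pnorm_lt => e e0; near=> s.
  have s0 : s != 0 by near: s; exact: nbhs_dnbhs_neq.
  rewrite /= g0 subr0 addr0 /GRing.scale/= mulr1 normrM normfV.
  rewrite mulrC ltr_pdivrMr ?normr_gt0//.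
  apply: (le_lt_trans (gC s)); rewrite -(real_normK (num_real s)).
  have sK : `|s| * (`|C| + 1) < e.
    rewrite -ltr_pdivlMr ?ltr_wpDl//; near: s.
    by apply: dnbhs0_lt; rewrite divr_gt0 ?ltr_wpDl.
  have sp : 0 < `|s| by rewrite normr_gt0.
  have CC := ler_norm C.
  by apply: (@le_lt_trans _ _ (`|s| * (`|C| + 1) * `|s|)); [nra|rewrite ltr_pM2r].
split; first by apply/cvg_ex; exists 0.
exact/cvg_lim.
Unshelve. all: by end_near.
Qed.

Lemma is_derive_flat j (t : R) :
  is_derive t 1 (flat j) (flat j.+2 t - j%:R * flat j.+1 t).
Proof.
have [t0|t0|->] := ltgtP t 0.
- have flat0 (i : nat) (s : R) : s <= 0 -> flat i s = 0 by move=> s0; rewrite /flat s0.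
  rewrite !flat0 ?ltW// mulr0 subr0.
  apply: (@near_eq_is_derive _ _ _ (cst 0)).
  near=> s; rewrite flat0//; near: s.
  by have := lt_nbhsl t0; apply: filterS => s; exact: ltW.
- pose f (s : R) := s^-1 ^+ j * expR (- s^-1).
  apply: (@near_eq_is_derive _ _ _ f).
    near=> s; rewrite /flat leNgt; rewrite ifF//; apply/negbTE; rewrite negbK.
    by near: s; exact: lt_nbhsr.
  have tn0 : t != 0 by rewrite gt_eqF.
  have dV : is_derive t 1 (fun s : R => s^-1) (- t ^- 2).
    by have := is_deriveV tn0 (is_derive_id t 1); rewrite /GRing.scale/= mulr1.
  have dE : is_derive t 1 (fun s : R => expR (- s^-1)) (expR (- t^-1) * t ^- 2).
    apply: is_derive1_comp.
    by have := is_deriveN dV; rewrite opprK.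
  have dX := is_deriveX j dV.
  have -> : f = (fun s : R => s^-1) ^+ j * (fun s : R => expR (- s^-1)).
    by apply/funext => s; rewrite !fctE.
  apply: (is_derive_eq (is_deriveM dX dE)).
  rewrite /flat leNgt t0/= /GRing.scale/=.
  rewrite exprfctE -!exprVn; move: t^-1 (expR _) => s w.
  case: j {f dX} => [|j] /=; first by rewrite expr0; ring.
  by rewrite !exprS -natr1; ring.
- have flat0 (i : nat) : flat i 0 = 0 by rewrite /flat lexx.
  rewrite !flat0 mulr0 subr0; apply: (@is_derive0_quadratic _ j.+2`!%:R) => // s.
  by rewrite ger0_norm ?flat_ge0// flat_le.
Unshelve. all: by end_near.
Qed.

Lemma real_classC_flat k j : real_classC k (flat j).
Proof.
elim: k j => [|k IH] j; first by split=> //; exact: (is_derive_continuous (is_derive_flat j)).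
apply: (real_classCS (is_derive_flat j)).
rewrite (_ : (fun _ => _) = flat j.+2 + cst (- j%:R) * flat j.+1); last first.
  by apply/funext => t; rewrite -[RHS]/(flat j.+2 t + - j%:R * flat j.+1 t) mulNr.
by apply: real_classCD; [|apply: real_classCZ]; exact: IH.
Qed.

End SmoothReal.

(** * The radial profile, harmonic beyond radius one *)

Section RadialProfile.
Context {R : realType}.
Implicit Types (w dw : R -> R).

Lemma zero_near_left w (a t : R) : (forall s, s < a -> w s = 0) -> t < a ->
  \near t, w t = 0.
Proof. by move=> w0 ta; near=> s; apply: w0; near: s; exact: lt_nbhsl.
Unshelve. all: by end_near. Qed.

Lemma derive_zero_left w dw (a : R) : (forall t : R, is_derive t 1 w (dw t)) ->
  (forall t, t < a -> w t = 0) -> forall t, t < a -> dw t = 0.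
Proof.
move=> d w0 t ta; have [_ <-] := d t.
rewrite (near_eq_derive (g := cst 0)) ?derive_cst//.
exact: zero_near_left ta.
Qed.

(** Only used for [w] vanishing to the left of some [a > 0], so the singularity of the power at [0]
    is never seen. *)
Definition times_powR w (e : R) (t : R) : R := w t * t `^ e.

Lemma is_derive_times_powR w dw (e a t : R) : 0 < a ->
  (forall t : R, is_derive t 1 w (dw t)) -> (forall t, t < a -> w t = 0) ->
  is_derive t 1 (times_powR w e) (times_powR dw e t + e * times_powR w (e - 1) t).
Proof.
move=> a0 d w0; have dw0 := derive_zero_left d w0.
have [t0|t0] := ltP 0 t.
  have dt := d t; have dp := is_derive1_powR e t0.
  apply: (is_derive_eq (is_deriveM dt dp)).
  by rewrite /times_powR /GRing.scale/=; ring.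
have ta : t < a by apply: le_lt_trans a0.
rewrite /times_powR dw0// w0// !mul0r mulr0 addr0.
apply: (@near_eq_is_derive _ _ _ (cst 0)).
by apply: filterS (zero_near_left w0 ta) => s ->; rewrite mul0r.
Qed.

Lemma real_classC_times_powR k w (e a : R) : 0 < a -> real_classC k w ->
  (forall t, t < a -> w t = 0) -> real_classC k (times_powR w e).
Proof.
move=> a0; elim: k w e => [|k IH] w e cw w0.
  split=> // t; have [t0|t0] := ltP 0 t.
    apply: (@continuousM _ _ w (fun s => s `^ e)); first exact: (real_classC_continuous cw).
    have [dp _] := is_derive1_powR e t0.
    by apply: differentiable_continuous; apply/derivable1_diffP.
  have ta : t < a by apply: le_lt_trans a0.
  rewrite /continuous_at [X in _ --> X]/times_powR w0// mul0r.
  apply: cvg_near_cst.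
  by apply: filterS (zero_near_left w0 ta) => s; rewrite /times_powR => ->; rewrite mul0r.
have [_ [dw d C]] := cw.
apply: (real_classCS (fun t => is_derive_times_powR e t a0 d w0)).
apply: real_classCD; first by apply: IH => //; exact: derive_zero_left w0.
by apply: real_classCZ; apply: IH => //; exact: real_classC_le.
Qed.

Lemma is_derive0_const_right w (a : R) : (forall t : R, is_derive t 1 w 0 \/ t < a) ->
  continuous w -> forall t, a <= t -> w t = w a.
Proof.
move=> d cw t at_; apply/eqP; rewrite -subr_eq0; apply/eqP.
have [|s _ ->] := @MVT_segment R w (cst 0) a t at_ _ (continuous_subspaceT cw).
  by move=> s; rewrite in_itv/= => /andP[as_ _]; have [//|/(lt_trans as_)] := d s; rewrite ltxx.
by rewrite mul0r.
Qed.

(* [t ^ (-3/2) * W t], with [W] a smooth step, is the derivative of a radial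
   profile that is harmonic in dimension three where [W] is constant. *)
Lemma radial_profile : exists G G1 G2 : R -> R,
  [/\ forall k, real_classC k G,
      forall t : R, is_derive t 1 G (G1 t),
      forall t : R, is_derive t 1 G1 (G2 t),
      forall t, 1 <= t -> 2 * G (4 * t) = G t
    & [/\ forall t, 0 <= 4 * t * G2 t + 6 * G1 t,
          forall t, 1 <= t -> 4 * t * G2 t + 6 * G1 t = 0
        & 0 < 4 * 2^-1 * G2 2^-1 + 6 * G1 2^-1]].
Proof.
(* A smooth bump, positive exactly between [1/4] and [1]; its primitive [W] is the smooth step. *)
pose b (t : R) := flat 0 (1 * t + - 4^-1) * flat 0 (-1 * t + 1).
have a0 : (0 : R) < 4^-1 by rewrite invr_gt0.
have cb k : real_classC k b.
  by apply: real_classCM; apply: real_classC_affine; exact: real_classC_flat.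
have b_ge0 t : 0 <= b t by rewrite mulr_ge0// flat_ge0.
have b_left t : t <= 4^-1 -> b t = 0.
  move=> ta; rewrite /b {1}/flat ifT ?mul0r//; lra.
have b_right t : 1 <= t -> b t = 0.
  move=> ta; rewrite /b {2}/flat ifT ?mulr0//; lra.
have b_half : 0 < b 2^-1.
  rewrite /b /flat !ifF.
  - by rewrite mulr_gt0// mulr_gt0// ?expR_gt0// expr0.
  - by apply/negbTE; rewrite -ltNge; lra.
  - by apply/negbTE; rewrite -ltNge; lra.
have [W [dW W0]] := antiderivative (real_classC_continuous (cb 0%N)) b_left.
have W0' t : t < 4^-1 -> W t = 0 by move=> /ltW /W0.
have cW k : real_classC k W.
  by case: k => [|k]; [exact: real_classC_le (real_classCS dW (cb 0%N))|
    exact: real_classCS dW (cb k)].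
have W1 t : 1 <= t -> W t = W 1.
  apply: is_derive0_const_right; last exact: real_classC_continuous (cW 0%N).
  move=> s; have [s1|] := leP 1 s; last by right.
  by left; rewrite -(b_right s s1).
(* In the variable [t = |x|^2] the function [1 / |x|] is [t^(-1/2)], whose derivative is a multiple
   of [t^(-3/2)]. *)
pose e : R := - (3 / 2).
pose G1 := times_powR W e.
pose G2 t := times_powR b e t + e * times_powR W (e - 1) t.
have dG1 (t : R) : is_derive t 1 G1 (G2 t).
  exact: (is_derive_times_powR e t a0 dW W0').
have cG1 k : real_classC k G1 by exact: real_classC_times_powR W0'.
have G1_left t : t <= 0 -> G1 t = 0.
  by move=> t0; rewrite /G1 /times_powR W0 ?mul0r// (le_trans t0)// ltW.
have [G0 [dG0 _]] := antiderivative (real_classC_continuous (cG1 0%N)) G1_left.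
pose s (t : R) := t `^ (- 2^-1).
have ds (t : R) : 0 < t -> is_derive t 1 s (- 2^-1 * t `^ e).
  move=> t0; have := is_derive1_powR (- 2^-1) t0.
  by rewrite (_ : - 2^-1 - 1 = e) // /e; field.
(* The constant of integration is chosen so that [G 1 = - 2 W 1]; then [G] is exactly a multiple of
   [t^(-1/2)] for [t >= 1], and this homogeneity gives [2 G (4 t) = G t]. *)
pose K := G0 1 + 2 * W 1.
pose G t := G0 t - K.
have dG (t : R) : is_derive t 1 G (G1 t).
  have := is_deriveD (dG0 t) (is_derive_cst (- K) t 1).
  by rewrite addr0.
have G_right t : 1 <= t -> G t = - (2 * W 1) * s t.
  move=> t1; pose h t := G t + 2 * W 1 * s t.
  have dh (r : R) : 1 <= r -> is_derive r 1 h 0.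
    move=> r1; have r0 : 0 < r by apply: lt_le_trans r1.
    have dsr := ds r r0; have dGr := dG r.
    have dcs := @is_deriveZ R _ _ s (2 * W 1) r 1 _ dsr.
    apply: (is_derive_eq (is_deriveD dGr dcs)).
    by rewrite /G1 /times_powR W1// /GRing.scale/=; field.
  have [| |r rt hE] := @MVT_segment R h (cst 0) 1 t t1.
  - by move=> r; rewrite in_itv/= => /andP[/ltW r1 _]; exact: dh.
  - apply: derivable_within_continuous => r; rewrite in_itv/= => /andP[r1 _].
    by have [] := dh r r1.
  have s1 : s 1 = 1 by rewrite /s powR1.
  by move: hE; rewrite mul0r /h /G /K s1; lra.
exists G, G1, G2; split => //.
- by case=> [|k]; [exact: real_classC_le (real_classCS dG (cG1 0%N))|
    exact: real_classCS dG (cG1 k)].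
- move=> t t1; rewrite !G_right//; last by lra.
  have -> : s (4 * t) = 2^-1 * s t.
    have t0 : 0 <= t by exact: le_trans t1.
    rewrite /s (powRM _ (ler0n _ 4) t0); congr (_ * _).
    rewrite (_ : 4 = 2 ^+ 2); last by ring.
    rewrite -powR_mulrn// -powRrM (_ : 2%:R * - 2^-1 = -1) ?powR_inv1//.
    by field.
  by field.
(* The left side is the Laplacian of [G (|x|^2)] in dimension three. Since [4 e + 6 = 0] the terms
   in [W] cancel and only the bump survives, which gives the sign, the support and the positivity at
   [1/2] at once. *)
have rE t : 4 * t * G2 t + 6 * G1 t = 4 * (b t * s t).
  have [t0|t0] := ltP 0 t; last first.
    have ta : t <= 4^-1 by rewrite (le_trans t0)// ltW.
    by rewrite /G2 /G1 /times_powR b_left// W0//; ring.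
  rewrite /G2 /G1 /times_powR /s.
  have tD x : t `^ (1 + x) = t * t `^ x.
    by rewrite powRD ?powRr1 ?ltW// (gt_eqF t0) implybT.
  have e1 : t `^ e = t * t `^ (e - 1) by rewrite -tD addrC subrK.
  have e2 : t `^ (- 2^-1) = t * t `^ e by rewrite -tD; congr (_ `^ _); rewrite /e; field.
  by rewrite e2 e1 /e; field.
split.
- by move=> t; rewrite rE mulr_ge0// mulr_ge0// powR_ge0.
- by move=> t t1; rewrite rE b_right// mul0r mulr0.
- by rewrite rE mulr_gt0// mulr_gt0// powR_gt0.
Qed.

End RadialProfile.

(** * Closure properties of [classC] and behaviour of partial derivatives under affine maps *)

Section SmoothVector.
Context {R : realType} {n : nat}.
Implicit Types (f g : 'rV[R]_n.+1 -> R).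

Lemma classC_continuous k f : classC k f -> continuous f.
Proof. by case: k => [|k] []. Qed.

Lemma classC_le k f : classC k.+1 f -> classC k f.
Proof.
elim: k f => [|k IH] f [cf df]; split=> // i; have [d c] := df i.
by split=> //; exact: IH.
Qed.

Lemma classCS k f (df : 'I_n.+1 -> 'rV[R]_n.+1 -> R) : continuous f ->
  (forall i x, is_derive x (basis_vec i) f (df i x)) ->
  (forall i, classC k (df i)) -> classC k.+1 f.
Proof.
move=> cf d c; split=> // i; split=> [x|]; first by have [] := d i x.
rewrite (_ : partial i f = df i)//; apply/funext => x.
by rewrite /partial; have [_ ->] := d i x.
Qed.

Lemma classC_is_derive k f i x : classC k.+1 f ->
  is_derive x (basis_vec i) f (partial i f x).
Proof. by move=> [_ /(_ i)[d _]]; exact: derivableP. Qed.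

Lemma classC_partial k f i : classC k.+1 f -> classC k (partial i f).
Proof. by move=> [_ /(_ i)[]]. Qed.

Lemma classC_cst k (c : R) : classC k (fun _ : 'rV[R]_n.+1 => c).
Proof.
elim: k c => [|k IH] c; first by split=> //; exact: cst_continuous.
apply: (@classCS _ _ (fun _ _ => 0)) => //; first exact: cst_continuous.
Qed.

Lemma classCD k f g : classC k f -> classC k g -> classC k (fun x => f x + g x).
Proof.
elim: k f g => [|k IH] f g cf cg.
  by split=> // x; apply: continuousD; [exact: (classC_continuous cf)|
    exact: (classC_continuous cg)].
apply: (@classCS _ _ (fun i x => partial i f x + partial i g x)).
- by move=> x; apply: continuousD; [exact: (classC_continuous cf)|
    exact: (classC_continuous cg)].
- by move=> i x; exact: (is_deriveD (classC_is_derive i x cf) (classC_is_derive i x cg)).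
- by move=> i; apply: IH; exact: classC_partial.
Qed.

Lemma classCM k f g : classC k f -> classC k g -> classC k (fun x => f x * g x).
Proof.
elim: k f g => [|k IH] f g cf cg.
  by split=> // x; apply: continuousM; [exact: (classC_continuous cf)|
    exact: (classC_continuous cg)].
apply: (@classCS _ _ (fun i x => f x * partial i g x + g x * partial i f x)).
- by move=> x; apply: continuousM; [exact: (classC_continuous cf)|
    exact: (classC_continuous cg)].
- by move=> i x; exact: (is_deriveM (classC_is_derive i x cf) (classC_is_derive i x cg)).
- by move=> i; apply: classCD; apply: IH; (exact: classC_le || exact: classC_partial).
Qed.

Lemma classCZ k f (c : R) : classC k f -> classC k (fun x => c * f x).
Proof. by move=> cf; apply: classCM => //; exact: classC_cst. Qed.

Lemma is_derive_coord (i j : 'I_n.+1) (x : 'rV[R]_n.+1) :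
  is_derive x (basis_vec i) (fun y : 'rV[R]_n.+1 => y 0 j) (i == j)%:R.
Proof.
apply: derive_ofline.
have -> : (fun h : R => (x + h *: basis_vec i) 0 j) =
    (fun h : R => (i == j)%:R * h) + cst (x 0 j).
  apply/funext => h; rewrite -[RHS]/((i == j)%:R * h + x 0 j) !mxE eq_sym /=.
  by rewrite addrC mulrC.
have := is_deriveD (is_derive_mull (i == j)%:R 0) (is_derive_cst (x 0 j) (0 : R) (1 : R)).
by rewrite addr0.
Qed.

Lemma classC_coord k (j : 'I_n.+1) : classC k (fun x : 'rV[R]_n.+1 => x 0 j).
Proof.
have cc : continuous (fun x : 'rV[R]_n.+1 => x 0 j) by exact: coord_continuous.
case: k => [|k]; first by split.
apply: (@classCS _ _ (fun i _ => (i == j)%:R)) => //.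
  by move=> i x; exact: is_derive_coord.
by move=> i; exact: classC_cst.
Qed.

Lemma classC_sum k (m : nat) (F : 'I_m -> 'rV[R]_n.+1 -> R) :
  (forall i, classC k (F i)) -> classC k (fun x => \sum_i F i x).
Proof.
elim: m F => [|m IH] F cF.
  by under eq_fun do rewrite big_ord0; exact: classC_cst.
under eq_fun do rewrite big_ord_recl.
by apply: classCD => //; apply: IH.
Qed.

Lemma affine_continuous (a : R) (h : 'rV[R]_n.+1) :
  continuous (fun x : 'rV[R]_n.+1 => a *: (x + h)).
Proof.
move=> x; apply: continuous_comp; first exact: shift_continuous.
exact: scaler_continuous.
Qed.

Lemma classC_affine k f (a : R) (h : 'rV[R]_n.+1) : classC k f ->
  classC k (fun x : 'rV[R]_n.+1 => f (a *: (x + h))).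
Proof.
have cc g : continuous g -> continuous (fun x : 'rV[R]_n.+1 => g (a *: (x + h))).
  by move=> cg x; apply: continuous_comp; [exact: affine_continuous|exact: cg].
elim: k f => [|k IH] f cf; first by split=> //; apply: cc; exact: classC_continuous cf.
apply: (@classCS _ _ (fun i x => a * partial i f (a *: (x + h)))).
- by apply: cc; exact: classC_continuous cf.
- by move=> i x; apply: is_derive_affine; have [_ /(_ i)[]] := cf.
- by move=> i; apply: classCZ; apply: IH; exact: classC_partial.
Qed.

Lemma partial_affine f (a : R) (h : 'rV[R]_n.+1) i : classC 1 f ->
  partial i (fun x : 'rV[R]_n.+1 => f (a *: (x + h))) = (fun x => a * partial i f (a *: (x + h))).
Proof.
move=> [_ /(_ i)[df _]]; apply/funext => x; rewrite /partial.
by have [_ ->] := @is_derive_affine R n.+1 f x (basis_vec i) h a (df _).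
Qed.

Lemma partialZ f (c : R) i : classC 1 f ->
  partial i (fun x => c * f x) = (fun x => c * partial i f x).
Proof.
move=> [_ /(_ i)[df _]]; apply/funext => x; rewrite /partial.
by have [_ ->] := @is_deriveZ R _ _ f c x _ _ (derivableP (df x)).
Qed.

Lemma partialB f g i : classC 1 f -> classC 1 g ->
  partial i (fun x => f x - g x) = (fun x => partial i f x - partial i g x).
Proof.
move=> [_ /(_ i)[df _]] [_ /(_ i)[dg _]]; apply/funext => x; rewrite /partial.
by have [_ ->] := is_deriveB (derivableP (df x)) (derivableP (dg x)).
Qed.

Lemma classC_real_comp k (G : R -> R) (q : 'rV[R]_n.+1 -> R) : smooth q ->
  real_classC k G -> classC k (fun x => G (q x)).
Proof.
move=> sq.
have cc (g : R -> R) : continuous g -> continuous (fun x => g (q x)).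
  move=> cg x; apply: continuous_comp; last exact: cg.
  exact: (classC_continuous (sq 0%N)).
elim: k G => [|k IH] G cG; first by split=> //; apply: cc; exact: real_classC_continuous cG.
have [_ [dG d C]] := cG.
apply: (@classCS _ _ (fun i x => dG (q x) * partial i q x)).
- by apply: cc; exact: real_classC_continuous cG.
- by move=> i x; exact: (is_derive_real_comp (classC_is_derive i x (sq 1%N)) (d (q x))).
- by move=> i; apply: classCM; [exact: IH|exact: classC_partial (sq k.+1)].
Qed.

End SmoothVector.

(** * The mollifier [rho] and the kernel [Psi] *)

Section Kernel.
Context {R : realType}.

Definition sqlen (x : 'rV[R]_3) : R := \sum_i x 0 i * x 0 i.

Lemma smooth_sqlen : smooth sqlen.
Proof.
by move=> k; apply: classC_sum => i; apply: classCM; exact: classC_coord.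
Qed.

Lemma is_derive_sqlen (i : 'I_3) x : is_derive x (basis_vec i) sqlen (2 * x 0 i).
Proof.
have d (j : 'I_3) := is_deriveM (is_derive_coord i j x) (is_derive_coord i j x).
have := is_derive_sum d.
rewrite (_ : \sum_j _ = sqlen); last by apply/funext => y; rewrite /sqlen fct_sumE.
move=> h; apply: (is_derive_eq h).
rewrite (bigD1 i)//= eqxx big1 ?addr0; last first.
  by move=> j ji; rewrite eq_sym (negbTE ji) /GRing.scale/= mulr0 addr0.
by rewrite /GRing.scale/=; ring.
Qed.

Lemma partial_radial (G G1 : R -> R) : (forall t : R, is_derive t 1 G (G1 t)) ->
  forall i, partial i (fun x => G (sqlen x)) = (fun x => G1 (sqlen x) * (2 * x 0 i)).
Proof.
move=> d i; apply/funext => x; rewrite /partial.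
by have [_ ->] := is_derive_real_comp (is_derive_sqlen i x) (d (sqlen x)).
Qed.

(** The explicit formula is symmetric in [i] and [j], so second derivatives of radial functions
    commute by inspection. *)
Lemma partial2_radial (G G1 G2 : R -> R) : (forall t : R, is_derive t 1 G (G1 t)) ->
  (forall t : R, is_derive t 1 G1 (G2 t)) -> forall i j x,
  partial i (partial j (fun x => G (sqlen x))) x =
  4 * x 0 i * x 0 j * G2 (sqlen x) + 2 * (i == j)%:R * G1 (sqlen x).
Proof.
move=> d d1 i j x; rewrite (partial_radial d) /partial.
have h1 := is_derive_real_comp (is_derive_sqlen i x) (d1 (sqlen x)).
have h2 := @is_deriveZ R _ _ _ 2 _ _ _ (is_derive_coord i j x).
have [_ ->] := is_deriveM h1 h2.
rewrite ?fctE /GRing.scale/= (_ : 2 *: x 0 j = 2 * x 0 j)//; ring.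
Qed.

Lemma laplacian_radial (G G1 G2 : R -> R) : (forall t : R, is_derive t 1 G (G1 t)) ->
  (forall t : R, is_derive t 1 G1 (G2 t)) -> forall x : 'rV[R]_3,
  laplacian (fun x => G (sqlen x)) x =
  4 * sqlen x * G2 (sqlen x) + 6 * G1 (sqlen x).
Proof.
move=> d d1 x; rewrite /laplacian.
under eq_bigr do rewrite (partial2_radial d d1) eqxx mulr1.
rewrite big_split/= sumr_const card_ord; congr (_ + _).
  move: (G2 _) => g; rewrite /sqlen mulr_sumr mulr_suml.
  by apply: eq_bigr => i _; rewrite mulrA.
by rewrite -mulr_natl; ring.
Qed.

Lemma smooth_laplacian (n : nat) (f : 'rV[R]_n.+1 -> R) : smooth f -> smooth (laplacian f).
Proof.
move=> sf k; apply: classC_sum => i; apply: classC_partial; exact: classC_partial (sf k.+2).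
Qed.

Lemma partial2_affine (n : nat) (f : 'rV[R]_n.+1 -> R) (c a : R) (h : 'rV[R]_n.+1) i j :
  smooth f ->
  partial i (partial j (fun x => c * f (a *: (x + h)))) =
  (fun x => c * a ^+ 2 * partial i (partial j f) (a *: (x + h))).
Proof.
move=> sf; rewrite partialZ; last exact: classC_affine (sf 1%N).
rewrite partial_affine; last exact: sf 1%N.
have c1 : classC 1 (partial j f) by exact: classC_partial (sf 2%N).
rewrite (partialZ (f := fun x => a * partial j f (a *: (x + h)))); last first.
  exact/classCZ/classC_affine.
rewrite partialZ; last exact: classC_affine.
by rewrite partial_affine//; apply/funext => x; ring.
Qed.

Lemma laplacian_affine (n : nat) (f : 'rV[R]_n.+1 -> R) (c a : R) (h x : 'rV[R]_n.+1) :
  smooth f ->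
  laplacian (fun x => c * f (a *: (x + h))) x = c * a ^+ 2 * laplacian f (a *: (x + h)).
Proof.
move=> sf; rewrite /laplacian mulr_sumr; apply: eq_bigr => i _.
by rewrite partial2_affine.
Qed.

Lemma laplacianB (n : nat) (f g : 'rV[R]_n.+1 -> R) (x : 'rV[R]_n.+1) :
  smooth f -> smooth g ->
  laplacian (fun x => f x - g x) x = laplacian f x - laplacian g x.
Proof.
move=> sf sg; rewrite /laplacian -sumrB; apply: eq_bigr => i _.
rewrite partialB; [|exact: sf 1%N|exact: sg 1%N].
by rewrite partialB//; [exact: classC_partial (sf 2%N)|exact: classC_partial (sg 2%N)].
Qed.

Lemma smoothB (n : nat) (f g : 'rV[R]_n.+1 -> R) : smooth f -> smooth g ->
  smooth (fun x => f x - g x).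
Proof.
move=> sf sg k; rewrite (_ : (fun _ => _) = (fun x => f x + -1 * g x)).
  by apply: classCD; [exact: sf|exact/classCZ/sg].
by apply/funext => x; rewrite mulN1r.
Qed.

Lemma smooth_affine (n : nat) (f : 'rV[R]_n.+1 -> R) (c a : R) (h : 'rV[R]_n.+1) :
  smooth f -> smooth (fun x => c * f (a *: (x + h))).
Proof. by move=> sf k; apply/classCZ/classC_affine/sf. Qed.

(* [Psi x = 2 Gamma (2 x) - Gamma x] with [Gamma] smooth, radial and equal to a
   multiple of [1 / |x|] outside the unit ball, where the two terms cancel. *)
Lemma scaling_kernel : exists rho Psi : 'rV[R]_3 -> R,
  [/\ smooth rho /\ smooth Psi,
      forall (x : 'rV[R]_3) i, 1 < `|x 0 i| -> rho x = 0 /\ Psi x = 0,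
      (forall x, 0 <= rho x) /\ exists x, 0 < rho x,
      forall x, laplacian Psi x = 8 * rho (2 *: x) - rho x
    & forall i j x, partial i (partial j Psi) x = partial j (partial i Psi) x].
Proof.
have [G [G1 [G2 [cG d d1 Gscale [r_ge0 r_right r_half]]]]] := @radial_profile R.
pose Gam (x : 'rV[R]_3) := G (sqlen x).
have sGam : smooth Gam by move=> k; apply: classC_real_comp; [exact: smooth_sqlen|exact: cG].
have sq1 (x : 'rV[R]_3) i : 1 < `|x 0 i| -> 1 <= sqlen x.
  move=> xi; rewrite /sqlen (bigD1 i)//= -expr2 -(real_normK (num_real _)).
  have : 0 <= \sum_(j < 3 | j != i) x 0 j * x 0 j by apply: sumr_ge0 => j _; rewrite -expr2 sqr_ge0.
  nra.
have sqZ (x : 'rV[R]_3) : sqlen (2 *: x) = 4 * sqlen x.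
  by rewrite /sqlen mulr_sumr; apply: eq_bigr => i _; rewrite !mxE; ring.
(* Puts the dilation in the affine form [a *: (x + h)] for which the differentiation rules are
   stated. *)
have add0 (x : 'rV[R]_3) : 2 *: x = 2 *: (x + 0) by rewrite addr0.
pose Psi (x : 'rV[R]_3) := 2 * Gam (2 *: (x + 0)) - Gam x.
have sA : smooth (fun x : 'rV[R]_3 => 2 * Gam (2 *: (x + 0))) by exact: smooth_affine.
exists (laplacian Gam), Psi; split.
- by split; [exact: smooth_laplacian|exact: smoothB].
- move=> x i /sq1 q1; split; first by rewrite (laplacian_radial d d1) r_right.
  by rewrite /Psi -add0 /Gam sqZ Gscale// subrr.
- split=> [x|]; first by rewrite (laplacian_radial d d1).
  (* A point with [|x|^2 = 1/2], where the profile is known to have positive Laplacian. *)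
  exists (\row_i (if i == 0 then Num.sqrt 2^-1 else 0)).
  rewrite (laplacian_radial d d1) (_ : sqlen _ = 2^-1)// /sqlen.
  rewrite (bigD1 0)//= big1 ?addr0; last by move=> i /negbTE i0; rewrite mxE i0 mul0r.
  by rewrite mxE eqxx -expr2 sqr_sqrtr.
- move=> x; apply: (etrans (laplacianB x sA sGam)).
  rewrite (laplacian_affine 2 2 0 x sGam) -(add0 x); congr (_ * _ - _); ring.
move=> i j x; have c1 k : classC 1 (partial k Gam) by exact: classC_partial (sGam 2%N).
have cA k : classC 1 (partial k (fun x : 'rV[R]_3 => 2 * Gam (2 *: (x + 0)))).
  exact: classC_partial (sA 2%N).
have P k : partial k Psi = _ := partialB k (sA 1%N) (sGam 1%N).
have E k l y : partial k (partial l Psi) y =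
    2 * 2 ^+ 2 * partial k (partial l Gam) (2 *: (y + 0)) - partial k (partial l Gam) y.
  rewrite P (partialB k (cA l) (c1 l)).
  by rewrite (partial2_affine 2 2 0 k l sGam).
have C k l y : partial k (partial l Gam) y = partial l (partial k Gam) y.
  rewrite !(partial2_radial d d1) (eq_sym l k); ring.
by rewrite (E i j x) (E j i x) (C i j (2 *: (x + 0))) (C i j x).
Qed.

End Kernel.

(** * Euclidean inner product and norm *)

Section EuclideanNorm.
Context {R : realType} {n : nat}.
Implicit Types (v w : 'rV[R]_n).

Lemma dotC v w : dot v w = dot w v.
Proof. by apply: eq_bigr => i _; rewrite mulrC. Qed.

Lemma dotDl v w z : dot (v + w) z = dot v z + dot w z.
Proof. by rewrite -big_split/=; apply: eq_bigr => i _; rewrite mxE mulrDl. Qed.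

Lemma dotZl (a : R) v w : dot (a *: v) w = a * dot v w.
Proof. by rewrite mulr_sumr; apply: eq_bigr => i _; rewrite mxE mulrA. Qed.

Lemma dotNl v w : dot (- v) w = - dot v w.
Proof. by rewrite -scaleN1r dotZl mulN1r. Qed.

Lemma dotDr v w z : dot z (v + w) = dot z v + dot z w.
Proof. by rewrite dotC dotDl !(dotC z). Qed.

Lemma dotZr (a : R) v w : dot w (a *: v) = a * dot w v.
Proof. by rewrite dotC dotZl (dotC w). Qed.

Lemma dotNr v w : dot w (- v) = - dot w v.
Proof. by rewrite dotC dotNl (dotC w). Qed.

Lemma dot_ge0 v : 0 <= dot v v.
Proof. by apply: sumr_ge0 => i _; rewrite -expr2 sqr_ge0. Qed.

Lemma fnormE v : fnorm v = Num.sqrt (dot v v).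
Proof. by rewrite /fnorm big_ord1; congr Num.sqrt; apply: eq_bigr => i _; rewrite expr2. Qed.

Lemma sqr_fnorm v : fnorm v ^+ 2 = dot v v.
Proof. by rewrite fnormE sqr_sqrtr// dot_ge0. Qed.

Lemma fnorm_ge0 v : 0 <= fnorm v.
Proof. exact: sqrtr_ge0. Qed.

Lemma coord_le_fnorm v i : `|v 0 i| <= fnorm v.
Proof.
rewrite fnormE -sqrtr_sqr; apply: ler_wsqrtr.
rewrite /dot (bigD1 i)//= -expr2 lerDl.
by apply: sumr_ge0 => j _; rewrite -expr2 sqr_ge0.
Qed.

Lemma fnorm_eq0 v : fnorm v = 0 -> v = 0.
Proof.
move=> v0; apply/rowP => i; rewrite mxE; apply/eqP; rewrite -normr_le0 -v0.
exact: coord_le_fnorm.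
Qed.

(** Nonnegativity of the squared length of [(w.w) v - (v.w) w], divided by [w.w]. *)
Lemma cauchy_schwarz v w : `|dot v w| <= fnorm v * fnorm w.
Proof.
have [w0|w0] := eqVneq (dot w w) 0.
  have -> : w = 0 by apply: fnorm_eq0; rewrite fnormE w0 sqrtr0.
  by rewrite /dot big1 ?normr0 ?mulr_ge0 ?fnorm_ge0// => i _; rewrite mxE mulr0.
have wp : 0 < dot w w by rewrite lt_neqAle eq_sym w0 dot_ge0.
have := dot_ge0 (dot w w *: v - dot v w *: w).
rewrite dotDl !dotDr !dotNl !dotNr !dotZl !dotZr (dotC w v).
move=> h; have {}h : 0 <= dot w w * (dot v v * dot w w - dot v w ^+ 2) by nra.
rewrite -(@ler_pXn2r _ 2) ?nnegrE ?mulr_ge0 ?fnorm_ge0//.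
rewrite real_normK ?num_real// exprMn !sqr_fnorm -subr_ge0.
by rewrite -(pmulr_rge0 _ wp).
Qed.

Lemma fnormD v w : fnorm (v + w) <= fnorm v + fnorm w.
Proof.
rewrite -(@ler_pXn2r _ 2) ?nnegrE ?addr_ge0 ?fnorm_ge0// sqrrD !sqr_fnorm.
rewrite dotDl !dotDr (dotC w v).
by have := cauchy_schwarz v w; have := ler_norm (dot v w); rewrite -mulr_natl; lra.
Qed.

Lemma fnormN v : fnorm (- v) = fnorm v.
Proof. by rewrite !fnormE dotNl dotNr opprK. Qed.

Lemma fnormZ (a : R) v : fnorm (a *: v) = `|a| * fnorm v.
Proof.
rewrite !fnormE dotZl dotZr mulrA -expr2 sqrtrM ?sqr_ge0//.
by rewrite sqrtr_sqr.
Qed.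

Lemma fnorm_dist_le v w z : fnorm (v - z) <= fnorm (v - w) + fnorm (w - z).
Proof. by rewrite -{1}(subrK w v) -addrA; exact: fnormD. Qed.

Lemma fnorm_distC v w : fnorm (v - w) = fnorm (w - v).
Proof. by rewrite -opprB fnormN. Qed.

Lemma fnorm_le_sum v : fnorm v <= \sum_i `|v 0 i|.
Proof.
have S0 (F : 'I_n -> R) : (forall i, 0 <= F i) -> 0 <= \sum_i F i.
  by move=> F0; apply: sumr_ge0.
rewrite -(@ler_pXn2r _ 2) ?nnegrE ?fnorm_ge0 ?S0// sqr_fnorm expr2 mulr_suml.
apply: ler_sum => i _; rewrite -expr2 -(real_normK (num_real _)) expr2.
by rewrite ler_wpM2l// (bigD1 i)//= lerDl sumr_ge0.
Qed.

Lemma fnorm_le_coord v (r : R) : (forall i, `|v 0 i| <= r) -> fnorm v <= n%:R * r.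
Proof.
move=> vr; apply: le_trans (fnorm_le_sum v) _.
rewrite -[n in n%:R]card_ord mulr_natl -sumr_const.
by apply: ler_sum => i _.
Qed.

End EuclideanNorm.

(** * Euclidean balls and the distance to a set *)

Section Distance.
Context {R : realType} {n : nat}.
Local Notation E := 'rV[R]_n.+1.
Implicit Types (x y : E) (S : set E).

Lemma fnorm_continuous : continuous (fun x : E => fnorm x).
Proof.
under eq_fun do rewrite fnormE.
move=> x; apply: continuous_comp; last exact: sqrt_continuous.
have : classC 0 (fun x : E => \sum_i x 0 i * x 0 i).
  by apply: classC_sum => i; apply: classCM; exact: classC_coord.
by move=> /classC_continuous; exact.
Qed.

Lemma fnorm_sub_continuous x : continuous (fun y : E => fnorm (y - x)).
Proof.
by move=> y; apply: continuous_comp; [exact: shift_continuous|exact: fnorm_continuous].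
Qed.

Lemma near_fnorm x (e : R) : 0 < e -> \forall y \near x, fnorm (y - x) < e.
Proof.
move=> e0; have := @fnorm_sub_continuous x x; rewrite /continuous_at => /cvgr_lt.
apply; rewrite subrr fnormE /dot big1 ?sqrtr0// => i _; by rewrite mxE mul0r.
Qed.

Lemma eball_open x (r : R) : open (eball x r).
Proof.
rewrite openE => y yr; have := @fnorm_sub_continuous x y => /cvgr_lt; exact.
Qed.

Lemma nbhs_eball x (A : set E) : nbhs x A -> exists2 r : R, 0 < r & eball x r `<=` A.
Proof.
move=> /nbhs_ballP[r /= r0 rA]; exists r => // y yr; apply: rA.
rewrite -ball_normE; apply: mx_norm_lt => // i.
by apply: le_lt_trans (coord_le_fnorm _ i) _; rewrite fnorm_distC.
Qed.

Lemma dist_le x y S : S y -> dist x S <= fnorm (x - y).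
Proof.
move=> Sy; apply: ge_inf; last by exists y.
by exists 0 => _ [z _ <-]; exact: fnorm_ge0.
Qed.

Lemma dist_ge0 x S : 0 <= dist x S.
Proof.
have [->|/set0P S0] := eqVneq S set0; first by rewrite /dist image_set0 inf0.
apply: lb_le_inf; first by have [y Sy] := S0; exists (fnorm (x - y)), y.
by move=> _ [z _ <-]; exact: fnorm_ge0.
Qed.

Lemma dist_lipschitz x y S : dist x S <= dist y S + fnorm (x - y).
Proof.
(* The infimum of the empty set is [0] by convention, so the bound persists there. *)
have [->|/set0P[z0 Sz0]] := eqVneq S set0.
  by rewrite /dist !image_set0 inf0 add0r fnorm_ge0.
rewrite -lerBlDr; apply: lb_le_inf; first by exists (fnorm (y - z0)), z0.
move=> _ [z Sz <-]; rewrite lerBlDr; apply: le_trans (dist_le _ Sz) _.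
by rewrite [leRHS]addrC; exact: fnorm_dist_le.
Qed.

Lemma dist_continuous S : continuous (fun x : E => dist x S).
Proof.
move=> x; apply/(@cvgrPdist_lt _ _ _ (nbhs x)) => e e0; move: (near_fnorm x e0); apply: filterS => y xy.
rewrite ltr_distl; have := dist_lipschitz x y S; have := dist_lipschitz y x S.
by rewrite (fnorm_distC x y) => ? ?; apply/andP; split; lra.
Qed.

End Distance.

(** * Continuity of the nearest-point map *)

Section NearestPoint.
Context {R : realType}.
Implicit Types (x y : 'rV[R]_3) (D : set 'rV[R]_3).

Lemma compact_bd D : bounded_set D -> compact (bd D).
Proof.
move=> [M [_ DM]]; apply: bounded_closed_compact; last first.
  apply: closedI; first exact: closed_closure.
  by apply: open_closedC; exact: open_interior.
exists (M + 1); split => [|r Mr x [Dx _]]; first exact: num_real.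
have cl : closed [set y : 'rV[R]_3 | `|y| <= M + 1].
  apply: (@closed_comp _ _ (fun y : 'rV[R]_3 => `|y|) [set t : R | t <= M + 1]).
    by move=> y _; exact: norm_continuous.
  exact: closed_le.
apply: le_trans (ltW Mr); apply: cl; apply: closure_subset Dx => y Dy /=.
by apply: DM => //; rewrite ltrDl.
Qed.

(** The boundary points outside the interior of [V] form a compact set; by uniqueness of the nearest
    point, their minimal distance to [x] strictly exceeds the distance from [x] to the boundary. A
    small displacement of [x] cannot close this gap. *)
Lemma near_nearest D (delta : R) x (V : set 'rV[R]_3) : bounded_set D ->
  unique_nearest D delta -> dist x (bd D) < 2 * delta -> nbhs (nearest D x) V ->
  \forall z \near x, bd D (nearest D z) /\ V (nearest D z).
Proof.
move=> bD uD xd nV.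
have nearP z : dist z (bd D) <= 2 * delta -> is_nearest D z (nearest D z).
  by move=> /uD[y [ny _]]; exact: (xgetPex 0 (ex_intro _ y ny)).
have near_d : \forall z \near x, dist z (bd D) <= 2 * delta.
  by have /cvgr_lt := @dist_continuous R 2 (bd D) x; move=> /(_ _ xd); apply: filterS => z /ltW.
pose K := bd D `&` ~` (interior V).
have cK : compact K.
  apply: (@subclosed_compact _ _ (bd D)); [|exact: compact_bd|exact: subIsetl].
  apply: closedI.
    by apply: compact_closed; [exact: norm_hausdorff|exact: compact_bd].
  by apply: open_closedC; exact: open_interior.
have [K0|/set0P/negP/negPn/eqP K0] := pselect (K !=set0); last first.
  move: near_d; apply: filterS => z /nearP[bz _]; split=> //.
  apply: interior_subset; apply: contrapT => h.
  by have : K (nearest D z) by []; rewrite K0.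
have [|z0 z0K z0min] := EVT_min_rV K0 cK (f := fun y => fnorm (y - x)).
  by apply: continuous_subspaceT; exact: fnorm_sub_continuous.
have m_gt : dist x (bd D) < fnorm (z0 - x).
  move: z0K; rewrite inE => -[bz0 Vz0]; rewrite lt_neqAle fnorm_distC dist_le// andbT.
  apply/negP => /eqP xz0; apply: Vz0.
  have [y [ny yu]] := uD x (ltW xd).
  by rewrite -(yu z0 (conj bz0 (esym xz0))) (yu _ (nearP x (ltW xd))).
(* Half the gap, because the displacement from [x] to [z] is paid twice: in the distance to the
   boundary and in the distance from [x] to the nearest point of [z]. *)
have h0 : 0 < (fnorm (z0 - x) - dist x (bd D)) / 2 by rewrite divr_gt0// subr_gt0.
move: (near_fnorm x h0) near_d; apply: filterS2 => z zx /nearP[bz ez].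
split=> //; apply: interior_subset; apply: contrapT => h.
have : fnorm (z0 - x) <= fnorm (nearest D z - x) by apply: z0min; rewrite inE.
have := fnorm_dist_le (nearest D z) z x; rewrite (fnorm_distC (nearest D z) z) ez.
have := dist_lipschitz z x (bd D); lra.
Qed.

End NearestPoint.

(** * Graph charts: coordinates, first-order expansion, unit normal *)

Section Charts.
Context {R : realType}.

Lemma rV_continuous_at (T : topologicalType) (m : nat) (f : T -> 'rV[R]_m) (x : T) :
  (forall j, {for x, continuous (fun y => f y 0 j)}) -> {for x, continuous f}.
Proof.
move=> cf; apply/(@cvgrPdist_lt _ _ _ (nbhs x)) => e e0.
have /filter_forall : forall j, \forall y \near x, `|f x 0 j - f y 0 j| < e.
  by move=> j; have /cvgrPdist_lt := cf j; apply.
apply: filterS => y xy; apply: mx_norm_lt => // j.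
by rewrite !mxE; exact: xy.
Qed.

(** The mean value theorem evaluates the partial derivatives at points within [t |w|] of [a], where
    by continuity they differ little from those at [a]. The weight [W] dominates all coordinates of
    [w] and their sum, so it serves both for the radius and for the error. *)
Lemma directional_derivative (n : nat) (h : 'rV[R]_n.+1 -> R) (a w : 'rV[R]_n.+1) (e : R) :
  classC 1 h -> 0 < e -> exists2 r : R, 0 < r & forall t, 0 < t < r ->
    `|h (a + t *: w) - h a - t * \sum_k w 0 k * partial k h a| <= t * e.
Proof.
move=> [_ dh] e0; pose W := 1 + \sum_k `|w 0 k|.
have W1 : 1 <= W by rewrite lerDl sumr_ge0.
have W0 : 0 < W by exact: lt_le_trans W1.
have Wk k : `|w 0 k| <= W.
  by rewrite /W (bigD1 k)//= addrCA lerDl addr_ge0// sumr_ge0.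
have /filter_forall : forall k, \forall z \near a, `|partial k h a - partial k h z| < e / W.
  move=> k; have /cvgrPdist_lt := (dh k).2.1 a.
  by apply; rewrite divr_gt0.
move=> /nbhs_ballP[r /= r0 near_a]; exists (r / W); first by rewrite divr_gt0.
move=> t /andP[t0 tr]; rewrite ltr_pdivlMr// in tr.
have [xi [xi_le ->]] := mean_value a (a + t *: w) (fun i z => (dh i).1 z).
rewrite mulr_sumr -sumrB.
have tE k : (a + t *: w) 0 k - a 0 k = t * w 0 k by rewrite !mxE addrC addKr.
apply: (@le_trans _ _ (\sum_k t * (`|w 0 k| * (e / W)))).
  apply: le_trans (ler_norm_sum _ _ _) _; apply: ler_sum => k _.
  rewrite tE -mulrA -mulrBr -mulrBr !normrM (ger0_norm (ltW t0)).
  apply: ler_wpM2l; first exact: ltW.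
  apply: ler_wpM2l => //; rewrite distrC; apply/ltW/near_a.
  rewrite -ball_normE; apply: mx_norm_lt => // i.
  rewrite !mxE distrC; apply: le_lt_trans (xi_le k i) _.
  rewrite tE normrM (ger0_norm (ltW t0)); apply: le_lt_trans tr.
  by apply: ler_wpM2l => //; exact: ltW.
rewrite -mulr_sumr -mulr_suml; apply: ler_wpM2l; first exact: ltW.
rewrite mulrCA.
by rewrite ger_pMr// ler_pdivrMr// mul1r /W lerDr.
Qed.

Implicit Types (c : @graph_chart R) (D : set 'rV[R]_3) (v x y : 'rV[R]_3).

Lemma gc_localD c x v (t : R) :
  gc_local c (x + t *: v) = gc_local c x + t *: (v *m gc_frame c).
Proof. by rewrite /gc_local addrAC mulmxDl scalemxAl. Qed.

Lemma gc_flatD c x v (t : R) :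
  gc_flat c (x + t *: v) = gc_flat c x + t *: lsubmx (v *m gc_frame c : 'rV_(2 + 1)).
Proof. by rewrite /gc_flat gc_localD linearD linearZ. Qed.

Lemma gc_vertD c x v (t : R) :
  gc_vert c (x + t *: v) =
  gc_vert c x + t * rsubmx (v *m gc_frame c : 'rV_(2 + 1)) 0 0.
Proof. by rewrite /gc_vert gc_localD !mxE. Qed.

Lemma gc_local_coord_continuous c (j : 'I_(2 + 1)) :
  continuous (fun x => gc_local c x 0 j).
Proof.
have : classC 0 (fun x : 'rV[R]_3 => \sum_k (x 0 k + - gc_center c 0 k) * gc_frame c k j).
  apply: classC_sum => k; apply: classCM; last exact: classC_cst.
  by apply: classCD; [exact: classC_coord|exact: classC_cst].
move=> /classC_continuous; set g := (X in continuous X -> _) => cg.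
suff -> : (fun x => gc_local c x 0 j) = g by exact: cg.
by apply/funext => y; rewrite /gc_local mxE; apply: eq_bigr => k _; rewrite !mxE.
Qed.

Lemma gc_flat_continuous c : continuous (gc_flat c).
Proof.
move=> x; apply: rV_continuous_at => j.
rewrite (_ : (fun _ => _) = (fun x => gc_local c x 0 (lshift 1 j))).
  exact: gc_local_coord_continuous.
by apply/funext => y; rewrite mxE.
Qed.

Lemma gc_vert_continuous c : continuous (gc_vert c).
Proof.
rewrite (_ : gc_vert c = (fun x => gc_local c x 0 (rshift 2 0))).
  exact: gc_local_coord_continuous.
by apply/funext => y; rewrite /gc_vert mxE.
Qed.

Lemma dotE (n : nat) (v w : 'rV[R]_n) : dot v w = (v *m w^T) 0 0.
Proof. by rewrite mxE; apply: eq_bigr => i _; rewrite mxE. Qed.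

Lemma dot_mulmx_tr (n m : nat) (v : 'rV[R]_n) (w : 'rV[R]_m) (F : 'M[R]_(n, m)) :
  dot v (w *m F^T) = dot (v *m F) w.
Proof. by rewrite !dotE trmx_mul trmxK mulmxA. Qed.

Lemma gc_jac_ge1 c (y : 'rV[R]_2) : 1 <= gc_jac c y.
Proof. by rewrite -[leLHS]sqrtr1; apply: ler_wsqrtr; rewrite lerDl sqr_ge0. Qed.

Lemma dot_gc_normal c v (y : 'rV[R]_2) :
  dot v (gc_normal c y) = (gc_jac c y)^-1 *
    (rsubmx (v *m gc_frame c : 'rV_(2 + 1)) 0 0 -
     \sum_k lsubmx (v *m gc_frame c : 'rV_(2 + 1)) 0 k * partial k (gc_height c) y).
Proof.
rewrite /gc_normal dotZr dot_mulmx_tr; congr (_ * _).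
move: (v *m gc_frame c) => M; rewrite /dot (@big_split_ord _ _ _ 2 1)/= big_ord1 addrC; congr (_ + _).
  by rewrite row_mxEr !mxE mulr1.
rewrite -sumrN; by apply: eq_bigr => k _; rewrite row_mxEl !mxE mulrN.
Qed.

Lemma gc_normal_unit c (y : 'rV[R]_2) : gc_frame c *m (gc_frame c)^T = 1%:M ->
  dot (gc_normal c y) (gc_normal c y) = 1.
Proof.
move=> FF; have j1 := gc_jac_ge1 c y; have j0 : 0 < gc_jac c y by exact: lt_le_trans j1.
rewrite /gc_normal dotZl dotZr dot_mulmx_tr -mulmxA (mulmx1C FF) mulmx1.
rewrite (_ : dot _ _ = gc_jac c y ^+ 2); first by field; rewrite gt_eqF.
rewrite /gc_jac sqr_sqrtr ?addr_ge0 ?sqr_ge0// sqr_fnorm.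
rewrite /dot (@big_split_ord _ _ _ 2 1)/= big_ord1 addrC; congr (_ + _).
  by rewrite row_mxEr !mxE mulr1.
by apply: eq_bigr => k _; rewrite row_mxEl !mxE mulrNN.
Qed.

End Charts.

Lemma continuous_at_sum (R : realType) (T : topologicalType) (x : T) (m : nat)
    (F : 'I_m -> T -> R) : (forall i, {for x, continuous (F i)}) ->
  {for x, continuous (fun z => \sum_i F i z)}.
Proof.
elim: m F => [|m IH] F cF.
  rewrite (_ : (fun _ => _) = cst 0); first exact: cst_continuous.
  by apply/funext => z; rewrite big_ord0.
rewrite (_ : (fun _ => _) = F ord0 + (fun z => \sum_i F (lift ord0 i) z)).
  by apply: continuousD => //; apply: IH.
by apply/funext => z; rewrite big_ord_recl.
Qed.

(** * Chart independence and continuity of the normal; continuity of [normal_part] *)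

Section OutwardNormal.
Context {R : realType}.
Implicit Types (c : @graph_chart R) (D : set 'rV[R]_3) (v x y : 'rV[R]_3).

(** Signed height over the graph; inside the chart ball it is negative exactly on the domain. *)
Let gap c x := gc_vert c x - gc_height c (gc_flat c x).

Lemma gap_continuous c : continuous (gc_height c) -> continuous (gap c).
Proof.
move=> ch x; apply: continuousB; first exact: gc_vert_continuous.
by apply: continuous_comp; [exact: gc_flat_continuous|exact: ch].
Qed.

Lemma bd_gap0 D c y : C4_chart D c -> bd D y -> eball (gc_center c) (gc_radius c) y ->
  gap c y = 0.
Proof.
move=> [r0 _ h4 Dc] [cDy nDy] By.
have cg := gap_continuous (classC_continuous h4).
have nB : nbhs y (eball (gc_center c) (gc_radius c)).
  by apply: open_nbhs_nbhs; split; [exact: eball_open|].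
have [g0|g0|//] := ltgtP (gap c y) 0.
- case: nDy; have /cvgr_lt := cg y; move=> /(_ _ g0).
  by move: nB; apply: filterS2 => z Bz gz; apply/(Dc z Bz); rewrite -subr_lt0.
- have : nbhs y (eball (gc_center c) (gc_radius c) `&` [set z | 0 < gap c z]).
    by apply: filterI => //; have /cvgr_gt := cg y; apply.
  move=> /cDy[z [Dz [Bz]]]; rewrite /= subr_gt0.
  by move: Dz => /(Dc z Bz)/lt_trans h /h; rewrite ltxx.
Qed.

(** Along the ray the gap grows linearly with slope [l - S], a positive multiple of [v . n]. Taking
    the first-order error below half of that slope, the sign of the slope decides on which side of
    the graph the ray starts. *)
Lemma ray_sides D c y v : C4_chart D c -> bd D y ->
  eball (gc_center c) (gc_radius c) y ->
  exists2 r : R, 0 < r & forall t, 0 < t < r ->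
    (dot v (gc_normal c (gc_flat c y)) < 0 -> D (y + t *: v)) /\
    (0 < dot v (gc_normal c (gc_flat c y)) -> ~ D (y + t *: v)).
Proof.
move=> Dc bDy By; have g0 := bd_gap0 Dc bDy By; have [r0 _ h4 Dg] := Dc.
have [->|nz] := eqVneq (dot v (gc_normal c (gc_flat c y))) 0.
  by exists 1 => // t _; rewrite ltxx.
move: nz; rewrite dot_gc_normal; set a := gc_flat c y.
set w := lsubmx _; set l := rsubmx _ 0 0; set S := \sum_k _ => nz.
have j0 : 0 < (gc_jac c a)^-1 by rewrite invr_gt0 (lt_le_trans _ (gc_jac_ge1 c a)).
have lS : 0 < `|l - S| / 2.
  rewrite divr_gt0// normr_gt0; by apply: contraNneq nz => ->; rewrite mulr0.
have h1 : classC 1 (gc_height c) by do 3 apply: classC_le.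
have [r1 r10 hr1] := directional_derivative a w h1 lS.
pose d := gc_radius c - fnorm (y - gc_center c).
have d0 : 0 < d by rewrite subr_gt0.
have v1 : 0 < 1 + fnorm v by rewrite ltr_wpDr// fnorm_ge0.
exists (Num.min r1 (d / (1 + fnorm v))); first by rewrite lt_min r10 divr_gt0.
move=> t; rewrite lt_min => /and3P[t0 tr1]; rewrite ltr_pdivlMr// => tr2.
have Bt : eball (gc_center c) (gc_radius c) (y + t *: v).
  rewrite /eball /= addrAC; apply: le_lt_trans (fnormD _ _) _.
  rewrite fnormZ gtr0_norm//; move: tr2; rewrite /d; lra.
have := hr1 t; rewrite t0 tr1 => /(_ isT).
have gE : gap c (y + t *: v) = t * l - (gc_height c (a + t *: w) - gc_height c a).
  have := g0; rewrite /gap gc_vertD gc_flatD -/a -/w -/l; lra.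
rewrite -/S ler_norml => /andP[h2 h3].
split; rewrite ?pmulr_rlt0 ?pmulr_rgt0// => lS0; [apply/(Dg _ Bt)|move=> /(Dg _ Bt)].
  rewrite -subr_lt0 -/(gap c _) gE.
  have lSE : `|l - S| = S - l by rewrite ltr0_norm// opprB.
  have : t * (l - S) < 0 by rewrite pmulr_rlt0.
  by move: h2 h3; rewrite lSE; lra.
rewrite -subr_lt0 -/(gap c _) gE.
have lSE : `|l - S| = l - S by rewrite gtr0_norm.
have : 0 < t * (l - S) by rewrite pmulr_rgt0.
by move: h2 h3; rewrite lSE; lra.
Qed.

(** Two charts with distinct unit normals [n1] and [n2] would conflict on the ray of direction
    [n2 - n1]: its product with [n1] is negative and with [n2] positive, so its start would lie both
    in [D] and outside. *)
Lemma outward_normal_chart D c y : C4_chart D c -> bd D y ->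
  eball (gc_center c) (gc_radius c) y ->
  outward_normal D y = gc_normal c (gc_flat c y).
Proof.
move=> Dc bDy By; apply: xget_unique; first by exists c.
move=> _ [c' [Dc' By' ->]].
set n1 := gc_normal c _; set n2 := gc_normal c' _.
apply/eqP/negPn/negP => n12.
have [_ F1 _ _] := Dc; have [_ F2 _ _] := Dc'.
have u1 : dot n1 n1 = 1 by exact: gc_normal_unit.
have u2 : dot n2 n2 = 1 by exact: gc_normal_unit.
have dp : 0 < dot (n2 - n1) (n2 - n1).
  rewrite lt_neqAle dot_ge0 andbT eq_sym; apply: contraNneq n12 => d0.
  rewrite -subr_eq0; apply/eqP/fnorm_eq0.
  by rewrite fnormE d0 sqrtr0.
have {}dp : dot n1 n2 < 1.
  move: dp; rewrite dotDl !dotDr !dotNl !dotNr u1 u2 (dotC n2 n1); lra.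
have [r1 r10 h1] := ray_sides (n2 - n1) Dc bDy By.
have [r2 r20 h2] := ray_sides (n2 - n1) Dc' bDy By'.
pose t := Num.min r1 r2 / 2.
have tr : 0 < t < r1 /\ 0 < t < r2.
  have m0 : 0 < Num.min r1 r2 by rewrite lt_min r10.
  have : Num.min r1 r2 <= r1 by rewrite ge_min lexx.
  have : Num.min r1 r2 <= r2 by rewrite ge_min lexx orbT.
  by rewrite /t => ? ?; split; apply/andP; split; lra.
have [_] := h2 t tr.2; have [+ _] := h1 t tr.1.
rewrite -/n1 -/n2 !dotDl !dotNl u1 u2 (dotC n2 n1) => k1 k2.
by apply: k2; [lra|apply: k1; lra].
Qed.

Lemma gc_normal_continuous c : classC 1 (gc_height c) -> continuous (gc_normal c).
Proof.
move=> [ch dh] y; apply: rV_continuous_at => j.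
pose S (z : 'rV[R]_2) : R :=
  1 + \sum_k partial k (gc_height c) z * partial k (gc_height c) z.
have jE : gc_jac c = (fun z => Num.sqrt (S z)).
  apply/funext => z; rewrite /gc_jac sqr_fnorm; congr (Num.sqrt (1 + _)).
  by apply: eq_bigr => k _; rewrite !mxE.
have cS : continuous S.
  have : classC 0 S.
    apply: classCD; first exact: classC_cst.
    by apply: classC_sum => k; apply: classCM; exact: (dh k).2.
  exact: classC_continuous.
have cj : {for y, continuous (fun z => (gc_jac c z)^-1)}.
  apply: continuousV; first by rewrite gt_eqF// (lt_le_trans _ (gc_jac_ge1 c y)).
  by rewrite jE; apply: (continuous_comp (cS y)); exact: sqrt_continuous.
pose g (z : 'rV[R]_2) : R := \sum_(k < 2) (-1 * partial k (gc_height c) z) * gc_frame c j (lshift 1 k)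
   + gc_frame c j (rshift 2 0).
have cg : {for y, continuous g}.
  have : classC 0 g.
    apply: classCD; last exact: classC_cst.
    apply: classC_sum => k; apply: classCM; last exact: classC_cst.
    by apply: classCZ; exact: (dh k).2.
  by move=> /classC_continuous; exact.
rewrite (_ : (fun _ => _) = (fun z => (gc_jac c z)^-1 * g z)); first exact: continuousM.
apply/funext => z; rewrite /gc_normal mxE; congr (_ * _).
rewrite mxE (@big_split_ord _ _ _ 2 1)/= big_ord1 /g; congr (_ + _).
  by apply: eq_bigr => k _; rewrite row_mxEl !mxE mulN1r.
by rewrite row_mxEr !mxE mul1r.
Qed.

Lemma outward_normal_le1 D y (i : 'I_3) : `|outward_normal D y 0 i| <= 1.
Proof.
rewrite /outward_normal; have [[v vP]|nP] := pselect (exists v, is_outward_normal D y v); last first.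
  (* Where no chart provides a normal, [outward_normal] takes the default value [0], which obeys the
     same bound. *)
  by rewrite xgetPN ?mxE ?normr0// => v vP; apply: nP; exists v.
have [c [[_ F _ _] _ ->]] := xgetPex 0 (ex_intro _ v vP).
apply: le_trans (coord_le_fnorm _ _) _.
by rewrite fnormE gc_normal_unit// sqrtr1.
Qed.

Lemma normal_ext_continuous D (delta : R) x : bounded_set D -> C4_boundary D ->
  unique_nearest D delta -> dist x (bd D) < 2 * delta ->
  {for x, continuous (normal_ext D)}.
Proof.
move=> bD C4 uD xd.
have [y [[by_ ey] _]] := uD x (ltW xd).
have [bn _] : is_nearest D x (nearest D x).
  by apply: (xgetPex 0); exists y.
have [c [Dc cE]] := C4 _ bn; have [r0 _ h4 _] := Dc.
have h1 : classC 1 (gc_height c) by do 3 apply: classC_le.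
pose N z := gc_normal c (gc_flat c z).
have cN : continuous N.
  by move=> z; apply: continuous_comp; [exact: gc_flat_continuous|exact: gc_normal_continuous].
have nB : nbhs (nearest D x) (eball (gc_center c) (gc_radius c)).
  apply: open_nbhs_nbhs; split; first exact: eball_open.
  by rewrite cE /eball /= subrr fnormE /dot big1 ?sqrtr0// => i _; rewrite mxE mul0r.
move=> V nV.
have VN : nbhs (nearest D x) (N @^-1` V).
  apply: cN; rewrite /N -(outward_normal_chart Dc)//; exact: nbhs_singleton.
suff : nbhs x (normal_ext D @^-1` V) by [].
apply: (filterS _ (near_nearest bD uD xd (filterI nB VN))) => z [bz [Bz Vz]].
by rewrite /= /normal_ext (outward_normal_chart Dc bz Bz).
Qed.

Lemma normal_part_le D (phi : R -> R) (u : 'rV[R]_3 -> 'rV[R]_3) x (B : R) :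
  (forall r, 0 <= r -> 0 <= phi r <= 1) -> (forall i, `|u x 0 i| <= B) ->
  `|normal_part D phi u x| <= phi (dist x (bd D)) * (3 * B) ^+ 2.
Proof.
move=> phi01 uB; have /andP[p0 p1] := phi01 _ (dist_ge0 x (bd D)).
rewrite /normal_part normrM (ger0_norm p0) ler_wpM2l// normrX.
rewrite lerXn2r ?nnegrE ?mulr_ge0 ?(le_trans _ (uB 0))//.
apply: le_trans (ler_norm_sum _ _ _) _.
rewrite (_ : 3 * B = \sum_(i < 3) B); last by rewrite sumr_const card_ord mulr_natl.
apply: ler_sum => i _; rewrite normrM.
by rewrite -[leRHS]mulr1 ler_pM// outward_normal_le1.
Qed.

Lemma dist_bd_gt0 D x : open D -> bd D !=set0 -> D x -> 0 < dist x (bd D).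
Proof.
move=> oD [y0 by0] Dx.
have [r r0 rD] := nbhs_eball (open_nbhs_nbhs (conj oD Dx)).
apply: lt_le_trans r0 _; apply: lb_le_inf; first by exists (fnorm (x - y0)), y0.
move=> _ [y [_ nDy] <-]; rewrite leNgt; apply/negP => yr; apply: nDy.
by apply: open_nbhs_nbhs; split=> //; apply: rD; rewrite /eball/= fnorm_distC.
Qed.

(** Closer than [2 delta] to the boundary all factors are continuous. From [2 delta] on the extended
    normal may jump, but it stays bounded while [phi] tends to [0], so a squeeze replaces the
    product rule. *)
Lemma normal_part_continuous D (delta : R) (phi : R -> R)
    (u : 'rV[R]_3 -> 'rV[R]_3) x :
  open D -> bounded_set D -> C4_boundary D -> unique_nearest D delta ->
  0 < delta -> cutoff_profile delta phi -> D x ->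
  (forall i, {for x, continuous (fun z => u z 0 i)}) ->
  {for x, continuous (normal_part D phi u)}.
Proof.
move=> oD bD C4 uD delta0 [dphi phi01 _ _ phi0] Dx cu.
(* For an empty boundary the distance would be [0], and [unique_nearest] would produce a boundary
   point. *)
have bd0 : bd D !=set0.
  apply/set0P/negP => /eqP b0.
  have [|y [[]]] := uD x; last by rewrite b0.
  by rewrite b0 /dist image_set0 inf0 mulr_ge0// ltW.
have cphi : {for x, continuous (fun z => phi (dist z (bd D)))}.
  apply: continuous_comp; first exact: dist_continuous.
  apply: differentiable_continuous; apply/derivable1_diffP.
  (* The profile is only assumed differentiable at positive arguments, hence the need for a positive
     distance to the boundary. *)
  exact: (dphi 0%N _ (dist_bd_gt0 oD bd0 Dx)).
have [xd|dx] := ltP (dist x (bd D)) (2 * delta).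
  have cN := normal_ext_continuous bD C4 uD xd.
  have cdot : {for x, continuous (fun z => dot (u z) (normal_ext D z))}.
    apply: continuous_at_sum => i; apply: continuousM; first exact: cu.
    apply: (@continuous_comp _ _ _ (normal_ext D) (fun y : 'rV[R]_3 => y 0 i)) => //.
    exact: coord_continuous.
  by apply: continuousM => //; apply: continuousM.
pose B := 1 + \sum_i `|u x 0 i|.
have /filter_forall uB : forall i, \forall z \near x, `|u z 0 i| < B.
  move=> i.
  have cn : {for x, continuous (fun z => `|u z 0 i|)}.
    by apply: (continuous_comp (cu i)); exact: norm_continuous.
  have /cvgr_lt := cn; apply.
  rewrite /B (bigD1 i)//= addrCA ltrDl ltr_wpDr// sumr_ge0//.
have npx : normal_part D phi u x = 0 by rewrite /normal_part phi0 ?mul0r.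
pose g z := phi (dist z (bd D)) * (3 * B) ^+ 2.
have g0 : g x = 0 by rewrite /g phi0// mul0r.
have cg : {for x, continuous g} by apply: continuousM => //; exact: cst_continuous.
have key : nbhs x [set z | (- g) z <= normal_part D phi u z <= g z].
  have uB' : nbhs x [set z | forall i, `|u z 0 i| < B] by exact: uB.
  apply: (filterS _ uB') => z uz; rewrite /= -ler_norml; apply: normal_part_le => // i.
  exact/ltW/uz.
rewrite /prop_for /continuous_at npx.
apply: (@squeeze_cvgr _ (nbhs x) _ R (- g) g).
- exact: key.
- by rewrite -[0]oppr0 -g0; exact: continuousN.
- by rewrite -g0; exact: cg.
Qed.

End OutwardNormal.

(** * Test functions supported in cubes, and products with functions continuous only on [D] *)

Section LocalIntegrals.
Context {R : realType}.
Implicit Types (D : set 'rV[R]_3) (c x z : 'rV[R]_3) (f g F : 'rV[R]_3 -> R).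

Definition cube (n : nat) (c : 'rV[R]_n) (s : R) : set 'rV[R]_n :=
  [set z | forall i, `|z 0 i - c 0 i| <= s].

(** Unlike [supported_in] this refers to the closed cube, whose complement is open; it therefore
    passes to derivatives without enlarging the cube. *)
Definition vanish_off c (s : R) F : Prop := forall z, ~ cube c s z -> F z = 0.

Lemma not_cube c (s : R) z : ~ cube c s z -> exists i, s < `|z 0 i - c 0 i|.
Proof. by move=> /existsNP[i /negP]; rewrite -ltNge; exists i. Qed.

(** A segment from [x] to a point outside [D] meets the boundary at its first exit time [m], at
    distance at most the length of the segment, hence less than [eta]. *)
Lemma eball_sub D x (eta : R) : open D -> D x -> eta <= dist x (bd D) ->
  eball x eta `<=` D.
Proof.
move=> oD Dx eta_le y xy; apply: contrapT => nDy.
pose ga (t : R) := x + t *: (y - x).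
have cga : continuous ga.
  move=> t; apply: (@continuousD _ _ _ (cst x) (fun t : R => t *: (y - x))).
    exact: cst_continuous.
  exact: scalel_continuous.
pose S := [set t : R | 0 <= t <= 1 /\ ~ D (ga t)].
have S1 : S 1 by split; [rewrite ler01 lexx|rewrite /ga scale1r addrC subrK].
have lS : has_lbound S by exists 0 => t [/andP[]].
have iS : has_inf S by split=> //; exists 1.
pose m := inf S.
have m1 : m <= 1 by exact: ge_inf.
have m0 : 0 <= m by apply: lb_le_inf; [exists 1|move=> t [/andP[]]].
have nDm : ~ D (ga m).
  move=> Dm.
  have : nbhs m (ga @^-1` D) by apply: cga; exact: open_nbhs_nbhs.
  move=> /nbhs_ballP[e /= e0 meD].
  have [t St tm] := inf_adherent e0 iS.
  have mt : m <= t by exact: ge_inf.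
  case: St => _; apply; apply: meD; rewrite /ball/= distrC ger0_norm ?subr_ge0//.
  by rewrite ltrBlDl.
have mp : 0 < m.
  rewrite lt_neqAle m0 andbT; apply/eqP => m00; apply: nDm.
  by rewrite -m00 /ga scale0r addr0.
have bm : bd D (ga m).
  split; last by move=> /interior_subset.
  move=> V nV; have : nbhs m (ga @^-1` V) by exact: cga.
  move=> /nbhs_ballP[e /= e0 meV].
  (* A time slightly before the exit, where the path is still in [D]; this puts the exit point in
     the closure. *)
  pose t := Num.max 0 (m - e / 2).
  have tm : t < m by rewrite /t gt_max mp/=; lra.
  have t0 : 0 <= t by rewrite /t le_max lexx.
  have te : m - e / 2 <= t by rewrite /t le_max lexx orbT.
  exists (ga t); split.
    apply: contrapT => nDt; have : m <= t.
      by apply: ge_inf => //; split=> //; rewrite t0/= (le_trans (ltW tm)).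
    by rewrite leNgt tm.
  by apply: meV; rewrite /ball/= ger0_norm ?subr_ge0 ?ltW//; lra.
have := dist_le x bm; rewrite /ga opprD addNKr fnormN fnormZ (ger0_norm m0).
have := fnorm_ge0 (y - x); move: xy; rewrite /eball/=; nra.
Qed.

Lemma vanish_supported c (s r : R) F : s < r -> vanish_off c s F -> supported_in c r F.
Proof.
move=> sr F0 x i xi; apply: F0 => /(_ i); rewrite leNgt => /negP; apply.
exact: lt_le_trans xi.
Qed.

Lemma compact_cube (n : nat) (c : 'rV[R]_n) (s : R) : compact (cube c s).
Proof.
rewrite (_ : cube c s = [set x | forall i, x 0 i \in `[c 0 i - s, c 0 i + s]]).
  apply: (@rV_compact _ _ (fun i => `[c 0 i - s, c 0 i + s]%classic)).
  by move=> i; exact: segment_compact.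
by apply/seteqP; split => x h i; have := h i; rewrite /= in_itv/= ler_distl.
Qed.

Lemma near_vanish (K : set 'rV[R]_3) F z : closed K -> (forall z, ~ K z -> F z = 0) ->
  ~ K z -> \near z, F z = 0.
Proof.
move=> cK F0 Kz; have : nbhs z (~` K) by apply: open_nbhs_nbhs; split=> //; exact: closed_openC.
by apply: filterS => y; exact: F0.
Qed.

Lemma closed_cube c (s : R) : closed (cube c s).
Proof. by apply: compact_closed; [exact: norm_hausdorff|exact: compact_cube]. Qed.

Lemma vanish_partial_closed (K : set 'rV[R]_3) F i : closed K ->
  (forall z, ~ K z -> F z = 0) -> forall z, ~ K z -> partial i F z = 0.
Proof.
move=> cK F0 z Kz; rewrite /partial (near_eq_derive (g := cst 0)) ?derive_cst//.
exact: near_vanish cK F0 Kz.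
Qed.

Lemma vanish_partial c (s : R) F i : vanish_off c s F -> vanish_off c s (partial i F).
Proof. exact/vanish_partial_closed/closed_cube. Qed.

(** Off [D] nothing is known about [f], but each such point has a neighbourhood missing [K], on
    which the product is identically zero. *)
Lemma ccont_mul_compact D (K : set 'rV[R]_3) f g : compact K -> K `<=` D ->
  (forall z, D z -> {for z, continuous f}) -> continuous g ->
  (forall z, ~ K z -> g z = 0) -> ccont (fun z => f z * g z).
Proof.
move=> cK KD cf cg g0; split; last first.
  have [M [_ KM]] := compact_bounded cK.
  exists (M + 1 + 1) => x i; rewrite mxE subr0 => xi; rewrite g0 ?mulr0// => Kx.
  have M1 : M < M + 1 by rewrite ltrDl.
  have := KM _ M1 _ Kx; apply/negP; rewrite -ltNge.
  apply: (@lt_le_trans _ _ (M + 1 + 1)); first by rewrite ltrDl.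
  apply: le_trans xi _; rewrite [leRHS]/Num.norm/= mx_normrE.
  exact: (le_bigmax _ (fun ij : 'I_1 * 'I_3 => `|x ij.1 ij.2|) (ord0, i)).
move=> z; have [Dz|nDz] := pselect (D z).
  by apply: continuousM; [exact: cf|exact: cg].
have nKz : ~ K z by move=> /KD.
apply: (near_cst_continuous 0).
have Kcl : closed K by apply: compact_closed => //; exact: norm_hausdorff.
by apply: filterS (near_vanish Kcl g0 nKz) => y ->; rewrite mulr0.
Qed.

Lemma ccont_mul D f g c (s : R) : cube c s `<=` D ->
  (forall z, D z -> {for z, continuous f}) -> continuous g -> vanish_off c s g ->
  ccont (fun z => f z * g z).
Proof. exact/ccont_mul_compact/compact_cube. Qed.

Lemma ccont0 : ccont (fun _ : 'rV[R]_3 => 0 : R).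
Proof. by apply: (@ccont_supported _ _ 0 0) => //; exact: cst_continuous. Qed.

Lemma int30 : int3 setT (fun _ : 'rV[R]_3 => 0 : R) = 0.
Proof. by rewrite int3TE /Rintegral integral0. Qed.

Lemma ccontD F1 F2 : ccont F1 -> ccont F2 -> ccont (fun x => F1 x + F2 x).
Proof.
move=> [c1 [r1 h1]] [c2 [r2 h2]]; apply: (@ccont_supported _ _ 0 (Num.max r1 r2)).
  by move=> x; apply: continuousD; [exact: c1|exact: c2].
by move=> x i; rewrite ge_max => /andP[k1 k2]; rewrite (h1 x i k1) (h2 x i k2) addr0.
Qed.

Lemma ccontZ F (k : R) : ccont F -> ccont (fun x => k * F x).
Proof.
move=> [cF [r h]]; split; last by exists r => x i /h ->; rewrite mulr0.
by move=> x; apply: continuousM; [exact: cst_continuous|exact: cF].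
Qed.

Lemma ccontB F1 F2 : ccont F1 -> ccont F2 -> ccont (fun x => F1 x - F2 x).
Proof.
move=> c1 c2; rewrite (_ : (fun _ => _) = (fun x => F1 x + -1 * F2 x)).
  by apply: ccontD => //; exact: ccontZ.
by apply/funext => x; rewrite mulN1r.
Qed.

Lemma ccont_int3_sum (m : nat) (F : 'I_m -> 'rV[R]_3 -> R) : (forall i, ccont (F i)) ->
  ccont (fun x => \sum_i F i x) /\
  int3 setT (fun x => \sum_i F i x) = \sum_i int3 setT (F i).
Proof.
elim: m F => [|m IH] F cF.
  rewrite (_ : (fun _ => _) = (fun _ => 0)); last by apply/funext => x; rewrite big_ord0.
  by rewrite big_ord0 int30; split=> //; exact: ccont0.
rewrite (_ : (fun _ => _) = (fun x => F ord0 x + \sum_i F (lift ord0 i) x)).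
  have [c IHE] := IH _ (fun i => cF (lift ord0 i)).
  by rewrite int3D// IHE big_ord_recl; split=> //; exact: ccontD.
by apply/funext => x; rewrite big_ord_recl.
Qed.

Lemma int3_restrict D F : (forall x, ~ D x -> F x = 0) -> int3 D F = int3 setT F.
Proof.
move=> F0; rewrite /int3 Rintegral_mkcond [RHS]Rintegral_mkcond.
congr Rintegral; apply/funext => z; rewrite !patchE [in RHS]mem_set//.
by case: ifPn => // /negP; rewrite inE => /F0.
Qed.

Lemma test_fun_cube D c (s : R) psi : smooth psi -> vanish_off c s psi ->
  cube c s `<=` D -> test_fun D psi.
Proof.
by move=> spsi psi0 cD; split=> //; exists (cube c s); split=> //; exact: compact_cube.
Qed.

Lemma smooth_partial (n : nat) (psi : 'rV[R]_n.+1 -> R) i : smooth psi -> smooth (partial i psi).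
Proof. by move=> h k; exact: classC_partial (h k.+1). Qed.

Lemma int3_partial_smooth psi c (s : R) i : smooth psi -> vanish_off c s psi ->
  int3 setT (partial i psi) = 0.
Proof.
move=> spsi psi0; have ss : s < s + 1 by rewrite ltrDl.
apply: int3_partial.
- exact: (ccont_supported (classC_continuous (spsi 0%N)) (vanish_supported ss psi0)).
- apply: (ccont_supported (c := c) (r := s + 1)).
    exact: (classC_continuous (smooth_partial i spsi 0%N)).
  exact: (vanish_supported ss (vanish_partial i psi0)).
- by have [_ /(_ i)[]] := spsi 1%N.
Qed.

Lemma partial_lincomb (n m : nat) (a : 'I_m -> R) (h : 'I_m -> 'rV[R]_n.+1 -> R)
    (i : 'I_n.+1) : (forall j, classC 1 (h j)) ->
  partial i (fun y => \sum_j a j * h j y) = (fun y => \sum_j a j * partial i (h j) y).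
Proof.
move=> ch; apply/funext => y; rewrite /partial.
have d j := @is_deriveZ R _ _ (h j) (a j) y _ _ (classC_is_derive i y (ch j)).
have := is_derive_sum d; rewrite (_ : \sum_j _ = (fun y => \sum_j a j * h j y)).
  by move=> [_ ->].
by apply/funext => w; rewrite fct_sumE.
Qed.

End LocalIntegrals.

(** * The local estimate from the double-divergence equation *)

Section WeakPressure.
Context {R : realType}.
Implicit Types (D : set 'rV[R]_3) (c x y z : 'rV[R]_3) (p : 'rV[R]_3 -> R)
  (psi F : 'rV[R]_3 -> R) (u : 'rV[R]_3 -> 'rV[R]_3).

(** The equation for [p] itself, with [normal_part] absorbed: from here on the estimate is purely
    interior. *)
Definition weak_pressure D u p : Prop := forall psi, test_fun D psi ->
  - int3 D (fun z => p z * laplacian psi z) =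
  int3 D (fun z => \sum_(i < 3) \sum_(j < 3)
    u z 0 i * u z 0 j * partial i (partial j psi) z).

(* The divergence constraint allows [u] to be replaced by [u - u c] in the
   double divergence, which gains the square of the oscillation of [u]. *)
Lemma weak_pressure_bound D u p psi c (s M e : R) : 0 < s -> 0 <= e ->
  cube c s `<=` D -> (forall z i, D z -> {for z, continuous (fun z => u z 0 i)}) ->
  (forall z, D z -> {for z, continuous p}) ->
  divergence_free D u -> weak_pressure D u p ->
  smooth psi -> vanish_off c s psi ->
  (forall i j z, partial i (partial j psi) z = partial j (partial i psi) z) ->
  (forall i j z, `|partial i (partial j psi) z| <= M) ->
  (forall z i, cube c s z -> `|u z 0 i - u c 0 i| <= e) ->
  `|int3 setT (fun z => p z * laplacian psi z)| <= 9 * (e ^+ 2 * M) * (4 * s) ^+ 3.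
Proof.
move=> s0 e0 cD cu cp divu weak spsi psi0 sym DM ue.
pose D2 i j := partial i (partial j psi).
have sD2 i j : smooth (D2 i j) by do 2 apply: smooth_partial.
have D20 i j : vanish_off c s (D2 i j) by do 2 apply: vanish_partial.
have D2off i j z : ~ D z -> D2 i j z = 0.
  by move=> nDz; apply: D20 => /cD.
have cD2 i j := classC_continuous (sD2 i j 0%N).
have tpsi := test_fun_cube spsi psi0 cD.
have lap_off z : ~ D z -> p z * laplacian psi z = 0.
  by move=> nDz; rewrite /laplacian big1 ?mulr0// => i _; exact: D2off.
have := weak _ tpsi; rewrite (int3_restrict lap_off) int3_restrict; last first.
  move=> z nDz; rewrite big1// => i _; rewrite big1// => j _.
  by rewrite -/(D2 i j) D2off ?mulr0.
move=> /(congr1 (fun t => `|t|)); rewrite normrN => ->.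
pose v := u c.
have cM (f : 'rV[R]_3 -> R) i j : (forall z, D z -> {for z, continuous f}) -> ccont (fun z => f z * D2 i j z).
  by move=> cf; exact: (ccont_mul cD cf (cD2 i j) (D20 i j)).
have cuv i z : D z -> {for z, continuous (fun z => u z 0 i - v 0 i)}.
  by move=> Dz; apply: continuousB; [exact: cu|exact: cst_continuous].
(* With [v = u c], the product [u_i u_j] is [(u_i - v_i)(u_j - v_j) + v_j u_i + v_i u_j - v_i v_j].
   [F1] is quadratic in the oscillation; the cross terms and the constant term integrate to zero. *)
pose F1 z := \sum_(i < 3) \sum_(j < 3) (u z 0 i - v 0 i) * (u z 0 j - v 0 j) * D2 i j z.
pose F2 z := \sum_(i < 3) \sum_(j < 3) v 0 j * (u z 0 i * D2 i j z).
pose F4 z := \sum_(i < 3) \sum_(j < 3) v 0 i * v 0 j * D2 i j z.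
have cF1 : ccont F1.
  have h i := (ccont_int3_sum (fun j : 'I_3 => cM (fun z => (u z 0 i - v 0 i) * (u z 0 j - v 0 j))
     i j (fun z Dz => continuousM (cuv i z Dz) (cuv j z Dz)))).1.
  exact: (ccont_int3_sum h).1.
have cF2 : ccont F2.
  have h i := (ccont_int3_sum (fun j : 'I_3 => ccontZ (v 0 j) (cM _ i j (fun z => cu z i)))).1.
  exact: (ccont_int3_sum h).1.
have cc i j : ccont (D2 i j).
  apply: (ccont_supported (cD2 i j)); apply: (@vanish_supported _ _ s (s + 1)) => //.
  by rewrite ltrDl.
have h4 i := ccont_int3_sum (fun j : 'I_3 => ccontZ (v 0 i * v 0 j) (cc i j)).
have cF4 : ccont F4 by exact: (ccont_int3_sum (fun i => (h4 i).1)).1.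
have I4 : int3 setT F4 = 0.
  rewrite (ccont_int3_sum (fun i => (h4 i).1)).2 big1// => i _.
  rewrite (h4 i).2 big1// => j _; rewrite int3Z//.
  rewrite (@int3_partial_smooth _ (partial j psi) c s i) ?mulr0//.
    exact: smooth_partial.
  exact: vanish_partial.
have I2 : int3 setT F2 = 0.
  (* The cross term is [u . grad th] for [th = v . grad psi], an admissible test function in the
     divergence constraint. *)
  pose th z := \sum_(j < 3) v 0 j * partial j psi z.
  have sth : smooth th.
    by move=> k; apply: classC_sum => j; apply: classCZ; exact: smooth_partial.
  have th0 : vanish_off c s th.
    by move=> z zc; rewrite /th big1// => j _; rewrite (vanish_partial j psi0 zc) mulr0.
  have := divu _ (test_fun_cube sth th0 cD).
  have F2E : F2 = (fun z => dot (u z) (grad th z)).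
    apply/funext => z; apply: eq_bigr => i _.
    rewrite mxE partial_lincomb ?mulr_sumr; last first.
      by move=> j; exact: smooth_partial spsi 1%N.
    by apply: eq_bigr => j _; rewrite mulrCA.
  rewrite -F2E int3_restrict// => z nDz.
  by rewrite /F2 big1// => i _; rewrite big1// => j _; rewrite D2off// !mulr0.
(* Symmetry of the second derivatives identifies the two cross terms, so [F2] occurs twice. *)
have E : (fun z => \sum_(i < 3) \sum_(j < 3) u z 0 i * u z 0 j * D2 i j z) =
    (fun z => F1 z + F2 z + (F2 z - F4 z)).
  apply/funext => z.
  have F2E : F2 z = \sum_(i < 3) \sum_(j < 3) v 0 i * (u z 0 j * D2 i j z).
    rewrite /F2 exchange_big/=; apply: eq_bigr => i _; apply: eq_bigr => j _.
    by rewrite /D2 sym.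
  rewrite [in X in _ + (X - _)]F2E /F1 /F2 /F4 -sumrB -!big_split/=.
  apply: eq_bigr => i _; rewrite -sumrB -!big_split/=.
  by apply: eq_bigr => j _; ring.
rewrite E (int3D (ccontD cF1 cF2) (ccontB cF2 cF4)) (int3D cF1 cF2) (int3B cF2 cF4).
(* The half-side is doubled because [supported_in] also asks for vanishing on the faces of the
   cube. *)
rewrite I2 I4 subrr !addr0 (_ : 4 * s = 2 * (2 * s)); last by ring.
have M0 : 0 <= M by apply: le_trans (DM 0 0 c).
apply: (@int3_norm_le _ F1 c (2 * s)); first by have [] := cF1.
- by rewrite mulr_ge0// ltW.
- by rewrite !mulr_ge0// exprn_ge0.
- apply: (@vanish_supported _ _ s); first by rewrite ltr_pMl// ltr1n.
  move=> z zc; rewrite /F1 big1// => i _; rewrite big1// => j _.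
  by rewrite D20// mulr0.
move=> z; have [zc|zc] := pselect (cube c s z); last first.
  rewrite /F1 big1 ?normr0 ?mulr_ge0 ?exprn_ge0// => i _; rewrite big1// => j _.
  by rewrite D20// mulr0.
rewrite (_ : 9 * (e ^+ 2 * M) = \sum_(i < 3) \sum_(j < 3) (e ^+ 2 * M)); last first.
  by rewrite !sumr_const !card_ord -mulrnA mulr_natl.
apply: le_trans (ler_norm_sum _ _ _) _; apply: ler_sum => i _.
apply: le_trans (ler_norm_sum _ _ _) _; apply: ler_sum => j _.
rewrite !normrM expr2; apply: ler_pM; [by rewrite mulr_ge0|by []| |exact: DM].
by apply: ler_pM => //; exact: ue.
Qed.

End WeakPressure.

(** * Summation of geometric increments *)

Section DyadicRates.
Context {R : realType}.
Implicit Types (f : nat -> R) (E q l : R).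

(** For a growing geometric series the sum is comparable to its last term. This serves the coarse
    scales, up to the scale [|x - y|]. *)
Lemma increment_sum_le f E q m k : 0 <= E -> 1 < q ->
  (forall n, (m <= n < m + k)%N -> `|f n.+1 - f n| <= E * q ^+ n) ->
  `|f (m + k)%N - f m| <= E * q ^+ (m + k) / (q - 1).
Proof.
move=> E0 q1; have q0 : 0 < q - 1 by lra.
have qp : 0 <= q by lra.
elim: k => [|k IH] fE.
  have q0' := ltW q0.
  by rewrite addn0 subrr normr0 divr_ge0 ?mulr_ge0 ?exprn_ge0.
rewrite addnS; apply: le_trans (ler_distD (f (m + k)%N) _ _) _.
have h1 : `|f (m + k).+1 - f (m + k)%N| <= E * q ^+ (m + k).
  by apply: fE; rewrite leq_addr addnS ltnSn.
have h2 : `|f (m + k)%N - f m| <= E * q ^+ (m + k) / (q - 1).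
  by apply: IH => n /andP[mn nk]; apply: fE; rewrite mn addnS ltnS ltnW.
apply: le_trans (lerD h1 h2) _; rewrite exprS le_eqVlt; apply/orP; left; apply/eqP.
by field; rewrite gt_eqF.
Qed.

(** For a decaying geometric series the tail is comparable to its first term. This serves the scales
    finer than [|x - y|]. *)
Lemma limit_rate f E q l m : 0 <= E -> 0 < q -> q < 1 ->
  (forall n, (m <= n)%N -> `|f n.+1 - f n| <= E * q ^+ n) ->
  (forall e, 0 < e -> exists n0, forall n, (n0 <= n)%N -> `|f n - l| <= e) ->
  `|f m - l| <= E * q ^+ m / (1 - q).
Proof.
move=> E0 q0 q1 fE fl; have q10 : 0 < 1 - q by lra.
have H k : `|f (m + k)%N - f m| <= E * (q ^+ m - q ^+ (m + k)) / (1 - q).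
  elim: k => [|k IH]; first by rewrite addn0 !subrr normr0 mulr0 mul0r.
  rewrite addnS; apply: le_trans (ler_distD (f (m + k)%N) _ _) _.
  apply: le_trans (lerD (fE (m + k)%N (leq_addr _ _)) IH) _.
  rewrite exprS le_eqVlt; apply/orP; left; apply/eqP.
  by field; rewrite gt_eqF.
apply/ler_addgt0Pr => e e0; have [n0 n0e] := fl e e0.
have := n0e (m + n0)%N (leq_addl _ _); have := H n0.
have : E * (q ^+ m - q ^+ (m + n0)) / (1 - q) <= E * q ^+ m / (1 - q).
  have q10' := ltW q10; have q0' := ltW q0.
  by rewrite ler_wpM2r ?invr_ge0// ler_wpM2l// lerBlDr lerDl exprn_ge0.
by have := ler_distD (f (m + n0)%N) (f m) l; rewrite (distrC (f m) (f (m + n0)%N)); lra.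
Qed.

End DyadicRates.

(** * Averages of the pressure at dyadic scales *)

Section MultiscaleAverages.
Context {R : realType} (D : set 'rV[R]_3) (a N B : R).
Context (u : 'rV[R]_3 -> 'rV[R]_3) (p rho Psi : 'rV[R]_3 -> R) (S0 L0 S2 L2 : R).
Implicit Types (x y z : 'rV[R]_3) (n : nat).

Context (a_gt0 : 0 < a) (a_lt : a < 1 / 2) (N_ge0 : 0 <= N) (B_ge0 : 0 <= B).
Context (u_holder : forall x y i, D x -> D y ->
  `|u x 0 i - u y 0 i| <= N * fnorm (x - y) `^ a).
Context (u_continuous : forall z i, D z -> {for z, continuous (fun z => u z 0 i)}).
Context (p_continuous : forall z, D z -> {for z, continuous p}).
Context (p_le : forall z, D z -> `|p z| <= B).
Context (divu : divergence_free D u) (weak : weak_pressure D u p).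
Context (rho_smooth : smooth rho) (Psi_smooth : smooth Psi).
Context (rho0 : forall x i, 1 < `|x 0 i| -> rho x = 0).
Context (Psi0 : forall x i, 1 < `|x 0 i| -> Psi x = 0).
Context (lap_Psi : forall x, laplacian Psi x = 8 * rho (2 *: x) - rho x).
Context (Psi_sym : forall i j x,
  partial i (partial j Psi) x = partial j (partial i Psi) x).
Context (rho_le : forall x, `|rho x| <= S0).
Context (rho_lip : forall x y, `|rho y - rho x| <= L0 * \sum_k `|y 0 k - x 0 k|).
Context (Psi_le : forall i j x, `|partial i (partial j Psi) x| <= S2).
Context (Psi_lip : forall i j x y,
  `|partial i (partial j Psi) y - partial i (partial j Psi) x|
    <= L2 * \sum_k `|y 0 k - x 0 k|).

Definition scale n : R := (2^-1) ^+ n.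

Definition rho_scaled n x z : R := 8 ^+ n * rho (2 ^+ n *: (z - x)).

(** The Laplacian contributes [4^n], so the prefactor [2^n] yields the [8^n] of [rho_scaled]. *)
Definition Psi_scaled n x z : R := 2 ^+ n * Psi (2 ^+ n *: (z - x)).

(** Not normalised: the limit is [p x] times the mass of [rho]. *)
Definition average n x : R := int3 setT (fun z => p z * rho_scaled n x z).

Lemma scale_gt0 n : 0 < scale n.
Proof. by rewrite exprn_gt0. Qed.

Lemma scaleK n : 2 ^+ n * scale n = 1.
Proof. by rewrite -exprMn divff ?expr1n// pnatr_eq0. Qed.

Lemma exp8 n : (8 : R) ^+ n = 2 ^+ n * 2 ^+ n * 2 ^+ n.
Proof. by rewrite -!exprMn; congr (_ ^+ n); ring. Qed.

Lemma exp8_scale n : 8 ^+ n * scale n ^+ 3 = 1.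
Proof.
rewrite -[RHS](expr1n _ 3) -[X in _ = X ^+ 3](scaleK n) exp8.
by move: (2 ^+ n) (scale n) => A b; ring.
Qed.

Lemma off_cube_scaled n x z : ~ cube x (scale n) z ->
  exists i, 1 < `|(2 ^+ n *: (z - x)) 0 i|.
Proof.
move=> /not_cube[i zi]; exists i; rewrite !mxE normrM ger0_norm ?exprn_ge0//.
by rewrite -[ltLHS](scaleK n) ltr_pM2l// exprn_gt0.
Qed.

Lemma rho_scaled_off n x : vanish_off x (scale n) (rho_scaled n x).
Proof. by move=> z /off_cube_scaled[i /rho0 h]; rewrite /rho_scaled h mulr0. Qed.

Lemma Psi_scaled_off n x : vanish_off x (scale n) (Psi_scaled n x).
Proof. by move=> z /off_cube_scaled[i /Psi0 h]; rewrite /Psi_scaled h mulr0. Qed.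

Lemma smooth_rho_scaled n x : smooth (rho_scaled n x).
Proof. exact: smooth_affine. Qed.

Lemma smooth_Psi_scaled n x : smooth (Psi_scaled n x).
Proof. exact: smooth_affine. Qed.

Lemma laplacian_Psi_scaled n x z :
  laplacian (Psi_scaled n x) z = rho_scaled n.+1 x z - rho_scaled n x z.
Proof.
rewrite (laplacian_affine _ _ _ _ Psi_smooth) lap_Psi /rho_scaled scalerA.
by rewrite -[in LHS](exprS 2 n) (exprS 8) exp8; move: (rho _) (rho _) => r1 r2; ring.
Qed.

Lemma partial2_Psi_scaled n x i j z : partial i (partial j (Psi_scaled n x)) z =
  8 ^+ n * partial i (partial j Psi) (2 ^+ n *: (z - x)).
Proof.
by rewrite (partial2_affine _ _ _ i j Psi_smooth) exp8; congr (_ * _); ring.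
Qed.

Lemma int3_laplacian psi x (s : R) : smooth psi -> vanish_off x s psi ->
  int3 setT (laplacian psi) = 0.
Proof.
move=> spsi psi0.
have c1 i := smooth_partial i spsi; have v1 i := vanish_partial i psi0.
have cc i : ccont (partial i (partial i psi)).
  apply: (@ccont_supported _ _ x (s + 1)).
    exact: (classC_continuous (smooth_partial i (c1 i) 0%N)).
  by apply: (vanish_supported _ (vanish_partial i (v1 i))); rewrite ltrDl.
rewrite /laplacian (ccont_int3_sum cc).2 big1// => i _.
exact: int3_partial_smooth (c1 i) (v1 i).
Qed.

Lemma ccont_rho_scaled n x : ccont (rho_scaled n x).
Proof.
apply: (ccont_supported (classC_continuous (smooth_rho_scaled n x 0%N))).
by apply: (vanish_supported (r := scale n + 1) _ (@rho_scaled_off n x)); rewrite ltrDl.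
Qed.

(** Consecutive rescalings differ by the Laplacian of a compactly supported function, whose integral
    is zero, so no change of variables under dilation is needed; at [n = 0] only a translation
    remains. *)
Lemma int3_rho_scaled n x : int3 setT (rho_scaled n x) = int3 setT rho.
Proof.
elim: n => [|n IH].
  rewrite (_ : rho_scaled 0 x = (fun z => rho (z + - x))).
    apply: int3_translate; have := ccont_rho_scaled 0 0.
    rewrite (_ : rho_scaled 0 0 = rho)//; apply/funext => z.
    by rewrite /rho_scaled !expr0 mul1r scale1r subr0.
  by apply/funext => z; rewrite /rho_scaled !expr0 mul1r scale1r.
apply/eqP; rewrite -IH -subr_eq0 -int3B; [|exact: ccont_rho_scaled|exact: ccont_rho_scaled].
rewrite -(int3_laplacian (smooth_Psi_scaled n x) (@Psi_scaled_off n x)).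
by apply/eqP; congr int3; apply/funext => z; rewrite laplacian_Psi_scaled.
Qed.

Lemma cube_sub x (s r : R) : s <= r -> cube x s `<=` cube x r.
Proof. by move=> sr z zs i; exact: le_trans (zs i) sr. Qed.

Lemma scaleS_le n : scale n.+1 <= scale n.
Proof. by rewrite /scale exprS ler_piMl ?exprn_ge0// invf_le1// ler1n. Qed.

Lemma ccont_p_rho_scaled n x : cube x (scale n) `<=` D ->
  ccont (fun z => p z * rho_scaled n x z).
Proof.
move=> xD; apply: (ccont_mul xD p_continuous _ (@rho_scaled_off n x)).
exact: (classC_continuous (smooth_rho_scaled n x 0%N)).
Qed.

Lemma averageS n x : cube x (scale n) `<=` D -> average n.+1 x - average n x =
  int3 setT (fun z => p z * laplacian (Psi_scaled n x) z).
Proof.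
move=> xD; have xD' := subset_trans (@cube_sub x _ _ (scaleS_le n)) xD.
rewrite /average -int3B; [|exact: ccont_p_rho_scaled|exact: ccont_p_rho_scaled].
by congr int3; apply/funext => z; rewrite laplacian_Psi_scaled mulrBr.
Qed.

(** The factor [3] passes from coordinates to the Euclidean norm. Since [2 a <= 1] and [3 k >= 1],
    the power [(3 k)^(2 a)] is at most [3 k], which keeps later constants free of [a]. *)
Lemma osc_sqr x z (k s : R) : 1 <= k -> 0 < s -> (forall i, `|z 0 i - x 0 i| <= s * k) ->
  fnorm (z - x) `^ a <= (3 * (s * k)) `^ a /\
  ((3 * (s * k)) `^ a) ^+ 2 <= 3 * k * s `^ (2 * a).
Proof.
move=> k1 s0 zx; have k0 : 0 < k by exact: lt_le_trans k1.
have fle : fnorm (z - x) <= 3 * (s * k) by apply: fnorm_le_coord => i; rewrite !mxE.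
split.
  apply: ge0_ler_powR => //; [exact: ltW|by rewrite nnegrE fnorm_ge0|].
  by rewrite nnegrE (le_trans (fnorm_ge0 _) fle).
have -> : ((3 * (s * k)) `^ a) ^+ 2 = (3 * k) `^ (2 * a) * s `^ (2 * a).
  rewrite -powR_mulrn ?powR_ge0// -powRrM [a * _]mulrC.
  by rewrite -powRM ?mulr_ge0 ?ltW//; congr (_ `^ _); ring.
rewrite ler_wpM2r ?powR_ge0//; apply: ler1_powR; first by nra.
by rewrite mulrC -ler_pdivlMr// ltW.
Qed.

Lemma averageS_le n x : cube x (scale n) `<=` D ->
  `|average n.+1 x - average n x| <= 27 * 4 ^+ 3 * S2 * N ^+ 2 * scale n `^ (2 * a).
Proof.
move=> xD; rewrite averageS//.
have Dx : D x by apply: xD => i; rewrite subrr normr0 ltW// scale_gt0.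
have S20 : 0 <= S2 by apply: le_trans (Psi_le 0 0 x).
have zx z i : cube x (scale n) z -> `|u z 0 i - u x 0 i| <= N * (3 * (scale n * 1)) `^ a.
  move=> zc; apply: le_trans (u_holder i (xD z zc) Dx) _; apply: ler_wpM2l => //.
  by have [] := @osc_sqr x z 1 (scale n) (lexx 1) (scale_gt0 n) _ => // j; rewrite mulr1.
have [_ q] := @osc_sqr x x 1 (scale n) (lexx 1) (scale_gt0 n) (fun i => ltac:(by rewrite subrr normr0 mulr1 ltW// scale_gt0)).
apply: le_trans (weak_pressure_bound (M := 8 ^+ n * S2) (scale_gt0 n) _ xD u_continuous
  p_continuous divu weak (smooth_Psi_scaled n x) (@Psi_scaled_off n x) _ _ zx) _.
- by rewrite mulr_ge0// powR_ge0.
- by move=> i j z; rewrite !partial2_Psi_scaled Psi_sym.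
- move=> i j z; rewrite partial2_Psi_scaled normrM ger0_norm ?exprn_ge0//.
  by rewrite ler_wpM2l// exprn_ge0.
(* The [8^n] from the second derivatives cancels the volume of the cube, leaving only the squared
   oscillation of [u]. *)
rewrite (_ : _ * _ = 9 * 4 ^+ 3 * S2 * N ^+ 2 * (((3 * (scale n * 1)) `^ a) ^+ 2 * (8 ^+ n * scale n ^+ 3))); last by ring.
rewrite exp8_scale mulr1 (_ : 27 * 4 ^+ 3 * S2 * _ * _ = 9 * 4 ^+ 3 * S2 * N ^+ 2 * (3 * 1 * scale n `^ (2 * a))); last by ring.
apply: ler_wpM2l => //.
by rewrite !mulr_ge0 ?exprn_ge0 ?ler0n.
Qed.

Lemma cube_shift_sub n x y : fnorm (x - y) <= scale n ->
  cube y (scale n) `<=` cube x (scale n * 2).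
Proof.
move=> xy z zy i; have := zy i; have := coord_le_fnorm (x - y) i; rewrite !mxE distrC.
by have := ler_distD (y 0 i) (z 0 i) (x 0 i); lra.
Qed.

Lemma sum_scaled_dist n x y z :
  \sum_k `|(2 ^+ n *: (z - x)) 0 k - (2 ^+ n *: (z - y)) 0 k|
    <= 3 * (2 ^+ n * fnorm (x - y)).
Proof.
rewrite (_ : 3 * _ = \sum_(k < 3) (2 ^+ n * fnorm (x - y))); last first.
  by rewrite sumr_const card_ord mulr_natl.
apply: ler_sum => k _; rewrite !mxE -mulrBr normrM ger0_norm ?exprn_ge0//.
rewrite ler_wpM2l ?exprn_ge0//; have := coord_le_fnorm (x - y) k; rewrite !mxE.
by rewrite distrC (_ : z 0 k - x 0 k - _ = y 0 k - x 0 k) //; ring.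
Qed.

Lemma average_diff_le n x y : cube x (scale n * 2) `<=` D -> fnorm (x - y) <= scale n ->
  `|(average n.+1 x - average n x) - (average n.+1 y - average n y)| <=
  162 * 8 ^+ 3 * L2 * N ^+ 2 * (fnorm (x - y) * 2 ^+ n * scale n `^ (2 * a)).
Proof.
move=> xD xy; have s0 := scale_gt0 n; set d := fnorm (x - y) in xy *.
have d0 : 0 <= d by exact: fnorm_ge0.
have x1 : cube x (scale n) `<=` cube x (scale n * 2) by apply: cube_sub; lra.
have y2 := cube_shift_sub xy.
have xD1 := subset_trans x1 xD; have yD1 := subset_trans y2 xD.
have Dx : D x by apply: xD => i; rewrite subrr normr0; lra.
have L20 : 0 <= L2.
  have := Psi_lip 0 0 0 (const_mx 1); rewrite (eq_bigr (fun=> 1)); last first.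
    by move=> i _; rewrite !mxE subr0 normr1.
  rewrite sumr_const card_ord => h; have := le_trans (normr_ge0 _) h.
  by rewrite pmulr_lge0.
pose psi z := Psi_scaled n x z - Psi_scaled n y z.
have sx := smooth_Psi_scaled n x; have sy := smooth_Psi_scaled n y.
have spsi : smooth psi by exact: smoothB.
have psi0 : vanish_off x (scale n * 2) psi.
  move=> z zc; rewrite /psi (@Psi_scaled_off n x z) ?(@Psi_scaled_off n y z) ?subrr//.
    by move=> /y2.
  by move=> /x1.
have D2E i j z : partial i (partial j psi) z =
    8 ^+ n * (partial i (partial j Psi) (2 ^+ n *: (z - x)) -
              partial i (partial j Psi) (2 ^+ n *: (z - y))).
  rewrite /psi (partialB j (sx 1%N) (sy 1%N)).
  rewrite (partialB i (smooth_partial j sx 1%N) (smooth_partial j sy 1%N)).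
  by rewrite !partial2_Psi_scaled mulrBr.
have -> : (average n.+1 x - average n x) - (average n.+1 y - average n y) =
    int3 setT (fun z => p z * laplacian psi z).
  rewrite !averageS// -int3B; last 2 first.
  - apply: (ccont_mul xD1 p_continuous); first exact: classC_continuous (smooth_laplacian sx 0%N).
    move=> z zc; rewrite /laplacian big1// => i _.
    exact: (vanish_partial i (vanish_partial i (@Psi_scaled_off n x)) zc).
  - apply: (ccont_mul yD1 p_continuous); first exact: classC_continuous (smooth_laplacian sy 0%N).
    move=> z zc; rewrite /laplacian big1// => i _.
    exact: (vanish_partial i (vanish_partial i (@Psi_scaled_off n y)) zc).
  by congr int3; apply/funext => z; rewrite (laplacianB z sx sy) mulrBr.
have zx z i : cube x (scale n * 2) z -> `|u z 0 i - u x 0 i| <= N * (3 * (scale n * 2)) `^ a.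
  move=> zc; apply: le_trans (u_holder i (xD z zc) Dx) _; apply: ler_wpM2l => //.
  by have [] := @osc_sqr x z 2 (scale n) (ler1n _ 2) s0 zc.
have x0 : forall i, `|x 0 i - x 0 i| <= scale n * 2 by move=> i; rewrite subrr normr0; lra.
have [_ q] := @osc_sqr x x 2 (scale n) (ler1n _ 2) s0 x0.
have s20 : 0 < scale n * 2 by lra.
pose M := 8 ^+ n * (L2 * (3 * (2 ^+ n * d))).
apply: le_trans (weak_pressure_bound (M := M) s20 _ xD u_continuous
  p_continuous divu weak spsi psi0 _ _ zx) _.
- by rewrite mulr_ge0// powR_ge0.
- by move=> i j z; rewrite !D2E (Psi_sym i j) (Psi_sym i j (_ *: (z - y))).
- move=> i j z; rewrite D2E normrM ger0_norm ?exprn_ge0//.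
  rewrite ler_wpM2l ?exprn_ge0//; apply: le_trans (Psi_lip _ _ _ _) _.
  by rewrite ler_wpM2l//; exact: sum_scaled_dist.
have -> : 9 * ((N * (3 * (scale n * 2)) `^ a) ^+ 2 * M) * (4 * (scale n * 2)) ^+ 3 =
    27 * 8 ^+ 3 * L2 * N ^+ 2 * (d * 2 ^+ n) * (((3 * (scale n * 2)) `^ a) ^+ 2
      * (8 ^+ n * scale n ^+ 3)).
  by rewrite /M; move: (8 ^+ n) (2 ^+ n) (_ `^ a) => r1 r2 r3; ring.
rewrite exp8_scale mulr1.
have -> : 162 * 8 ^+ 3 * L2 * N ^+ 2 * (d * 2 ^+ n * scale n `^ (2 * a)) =
    27 * 8 ^+ 3 * L2 * N ^+ 2 * (d * 2 ^+ n) * (3 * 2 * scale n `^ (2 * a)) by ring.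
apply: ler_wpM2l => //.
by rewrite !mulr_ge0 ?exprn_ge0 ?ler0n.
Qed.

(** Uses no equation, only the sup bound on [p] and the smoothness of [rho]. The loss of [2^n] is
    harmless because this is applied at the fixed coarsest scale only. *)
Lemma average_lip n x y : cube x (scale n * 2) `<=` D -> fnorm (x - y) <= scale n ->
  `|average n x - average n y| <= 3 * 8 ^+ 3 * B * L0 * (2 ^+ n * fnorm (x - y)).
Proof.
move=> xD xy; have s0 := scale_gt0 n; set d := fnorm (x - y) in xy *.
have d0 : 0 <= d by exact: fnorm_ge0.
have x1 : cube x (scale n) `<=` cube x (scale n * 2) by apply: cube_sub; lra.
have y2 := cube_shift_sub xy.
have xD1 := subset_trans x1 xD; have yD1 := subset_trans y2 xD.
have L00 : 0 <= L0.
  have := rho_lip 0 (const_mx 1); rewrite (eq_bigr (fun=> 1)); last first.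
    by move=> i _; rewrite !mxE subr0 normr1.
  rewrite sumr_const card_ord => h; have := le_trans (normr_ge0 _) h.
  by rewrite pmulr_lge0.
pose g z := rho_scaled n x z - rho_scaled n y z.
have sg : smooth g by apply: smoothB; exact: smooth_rho_scaled.
have g0 : vanish_off x (scale n * 2) g.
  move=> z zc; rewrite /g (@rho_scaled_off n x z) ?(@rho_scaled_off n y z) ?subrr//.
    by move=> /y2.
  by move=> /x1.
have g_le z : `|g z| <= 8 ^+ n * (L0 * (3 * (2 ^+ n * d))).
  rewrite /g /rho_scaled -mulrBr normrM ger0_norm ?exprn_ge0//.
  rewrite ler_wpM2l ?exprn_ge0//; apply: le_trans (rho_lip _ _) _.
  by rewrite ler_wpM2l//; exact: sum_scaled_dist.
have cF := ccont_mul xD p_continuous (classC_continuous (sg 0%N)) g0.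
have -> : average n x - average n y = int3 setT (fun z => p z * g z).
  rewrite /average -int3B; [|exact: ccont_p_rho_scaled|exact: ccont_p_rho_scaled].
  by congr int3; apply/funext => z; rewrite mulrBr.
have M0 : 0 <= 8 ^+ n * (L0 * (3 * (2 ^+ n * d))).
  by rewrite !mulr_ge0 ?exprn_ge0 ?ler0n.
apply: le_trans (int3_norm_le (c := x) (r := scale n * 4)
  (B := B * (8 ^+ n * (L0 * (3 * (2 ^+ n * d))))) _ _ _ _ _) _.
- by have [] := cF.
- by lra.
- by rewrite mulr_ge0.
- apply: (@vanish_supported _ _ (scale n * 2)); first by lra.
  by move=> z /g0 ->; rewrite mulr0.
- move=> z; have [zc|/g0 ->] := pselect (cube x (scale n * 2) z).
    by rewrite normrM; apply: ler_pM => //; apply: p_le; exact: xD.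
  by rewrite mulr0 normr0 mulr_ge0.
rewrite (_ : _ * (2 * (scale n * 4)) ^+ 3 =
    3 * 8 ^+ 3 * B * L0 * (2 ^+ n * d) * (8 ^+ n * scale n ^+ 3)).
  by rewrite exp8_scale mulr1.
by move: (2 ^+ n) (8 ^+ n) => r1 r2; ring.
Qed.

Lemma average_cvg x (e : R) : D x -> nbhs x D -> 0 < e ->
  exists n0, forall n, (n0 <= n)%N ->
  `|average n x - int3 setT rho * p x| <= 4 ^+ 3 * S0 * e.
Proof.
move=> Dx nD e0.
have pe : nbhs x [set z | `|p x - p z| < e].
  by have /cvgrPdist_lt := p_continuous Dx; apply.
have [r r0 rV] := nbhs_eball (filterI nD pe).
exists (Num.bound (3 / r)) => n /upper_nthrootP rn.
have s0 := scale_gt0 n.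
have sr : 3 * scale n < r.
  move: rn; rewrite ltr_pdivrMr// -(ltr_pM2r s0) mulrAC scaleK mul1r.
  exact.
have cr : cube x (scale n) `<=` eball x r.
  move=> z zc; apply: le_lt_trans sr; apply: fnorm_le_coord => i.
  by rewrite !mxE; exact: zc.
have S00 : 0 <= S0 by apply: le_trans (rho_le x).
have xD : cube x (scale n) `<=` D by move=> z /cr /rV[].
have c1 := ccont_p_rho_scaled xD; have c2 := ccontZ (p x) (ccont_rho_scaled n x).
rewrite -(int3_rho_scaled n x) mulrC -int3Z; last exact: ccont_rho_scaled.
rewrite /average -int3B//; have cF := ccontB c1 c2.
apply: le_trans (int3_norm_le (c := x) (r := scale n * 2) (B := e * (8 ^+ n * S0)) _ _ _ _ _) _.
- by have [] := cF.
- by lra.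
- by rewrite !mulr_ge0 ?exprn_ge0 ?ler0n// ltW.
- apply: (@vanish_supported _ _ (scale n)); first by lra.
  by move=> z /rho_scaled_off ->; rewrite !mulr0 subr0.
- move=> z; have [zc|/rho_scaled_off ->] := pselect (cube x (scale n) z); last first.
    by rewrite !mulr0 subr0 normr0 !mulr_ge0 ?exprn_ge0 ?ler0n// ltW.
  rewrite -mulrBl normrM; apply: ler_pM => //.
    by rewrite distrC ltW//; have [] := rV _ (cr _ zc).
  by rewrite /rho_scaled normrM ger0_norm ?exprn_ge0// ler_wpM2l// exprn_ge0.
rewrite (_ : _ * (2 * (scale n * 2)) ^+ 3 = 4 ^+ 3 * S0 * e * (8 ^+ n * scale n ^+ 3)).
  by rewrite exp8_scale mulr1.
by move: (8 ^+ n) => r2; ring.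
Qed.

Lemma scale_decr n m : (n <= m)%N -> scale m <= scale n.
Proof.
move=> nm; rewrite /scale -(subnKC nm) exprD ler_piMr ?exprn_ge0// exprn_ile1//.
by rewrite invf_le1// ler1n.
Qed.

(** Takes the least [m] with [2^(-(m+1)) < d]; minimality gives [d <= 2^(-m)]. *)
Lemma dyadic_scale n0 (d : R) : 0 < d -> d <= scale n0 ->
  exists m, [/\ (n0 <= m)%N, d <= scale m & scale m <= 2 * d].
Proof.
move=> d0 dn0.
have ex : exists m, scale m.+1 < d.
  exists (Num.bound (d^-1)); have := @upper_nthrootP _ d^-1 _ (leqnSn (Num.bound d^-1)).
  move=> h; have s0 := scale_gt0 (Num.bound d^-1).+1.
  rewrite -(ltr_pM2r d0) mulVf ?gt_eqF// -(ltr_pM2r s0) mul1r mulrAC scaleK mul1r in h.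
  exact: h.
have [m sm mmin] := ex_minnP ex.
exists m; split.
- rewrite leqNgt; apply/negP => /scale_decr h; move: (le_lt_trans h sm).
  by rewrite ltNge dn0.
- case: m sm mmin => [|m] sm mmin.
    by rewrite (le_trans dn0)// scale_decr.
  by rewrite leNgt; apply/negP => /mmin; rewrite ltnn.
- have -> : scale m = 2 * scale m.+1 by rewrite /scale exprS mulVKf.
  by rewrite ler_wpM2l// ltW.
Qed.

Definition rate : R := 2^-1 `^ (2 * a).

Lemma rate_gt0 : 0 < rate.
Proof. by rewrite powR_gt0// invr_gt0. Qed.

Lemma rate_lt1 : rate < 1.
Proof.
have <- : 1 `^ (2 * a) = (1 : R) by rewrite powR1.
by apply: gt0_ltr_powR; rewrite ?nnegrE ?invr_ge0// ?mulr_gt0// invf_lt1// ltr1n.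
Qed.

(** The product equals [2^(1 - 2 a)]: this is where [a < 1/2] is indispensable. *)
Lemma rate2_gt1 : 1 < 2 * rate.
Proof.
have h : (2 : R) `^ (2 * a) * 2 `^ (1 - 2 * a) = 2.
  by rewrite -powRD ?pnatr_eq0 ?implybT// addrC subrK powRr1.
have hr : rate * 2 `^ (2 * a) = 1.
  by rewrite -powRM// ?invr_ge0// mulVf ?pnatr_eq0// powR1.
have -> : 2 * rate = 2 `^ (1 - 2 * a).
  by rewrite -[2 in LHS]h mulrAC [_ * rate]mulrC hr mul1r.
have {1}<- : 1 `^ (1 - 2 * a) = (1 : R) by rewrite powR1.
have a1 : 0 < 1 - 2 * a by rewrite subr_gt0 mulrC -ltr_pdivlMr.
by apply: gt0_ltr_powR; rewrite ?nnegrE// ltr1n.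
Qed.

Lemma scale_powR n : scale n `^ (2 * a) = rate ^+ n.
Proof.
by rewrite /scale /rate -!powR_mulrn ?powR_ge0 ?invr_ge0// powRAC.
Qed.

(** With [2^(-m)] comparable to [|x - y|], the difference splits into two tails beyond [m], the
    change from scale [n0] to scale [m] of the difference of averages, and that difference at scale
    [n0]. These give the three terms of the constant. *)
Lemma pressure_increment x y n0 : nbhs x D -> nbhs y D ->
  cube x (scale n0 * 2) `<=` D -> cube y (scale n0 * 2) `<=` D ->
  fnorm (x - y) <= scale n0 ->
  `|int3 setT rho * p x - int3 setT rho * p y| <=
  (2 * (2 * (27 * 4 ^+ 3 * S2 * N ^+ 2) / (1 - rate)) +
   2 * (162 * 8 ^+ 3 * L2 * N ^+ 2) / (2 * rate - 1) +
   3 * 8 ^+ 3 * B * L0 * 2 ^+ n0) * fnorm (x - y) `^ (2 * a).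
Proof.
move=> nx ny xD yD xy; set d := fnorm (x - y) in xy *; set K := int3 setT rho.
set E1 := 27 * _ * S2 * _; set E2 := 162 * _ * L2 * _; set E3 := 3 * _ * B * L0.
have Dx := nbhs_singleton nx; have Dy := nbhs_singleton ny.
have S20 : 0 <= S2 by apply: le_trans (Psi_le 0 0 x).
have S00 : 0 <= S0 by apply: le_trans (rho_le x).
have lip0 (L : R) (w : 'rV[R]_3) : (forall x y, w = w -> 0 <= L * \sum_k `|y 0 k - x 0 k|) -> 0 <= L.
  move=> /(_ 0 (const_mx 1) erefl); rewrite (eq_bigr (fun=> 1)).
    by rewrite sumr_const card_ord pmulr_lge0.
  by move=> i _; rewrite !mxE subr0 normr1.
have L20 : 0 <= L2.
  by apply: (lip0 _ 0) => v w _; apply: le_trans (Psi_lip 0 0 v w).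
have L00 : 0 <= L0 by apply: (lip0 _ 0) => v w _; apply: le_trans (rho_lip v w).
have E10 : 0 <= E1 by rewrite !mulr_ge0 ?exprn_ge0 ?ler0n.
have E20 : 0 <= E2 by rewrite !mulr_ge0 ?exprn_ge0 ?ler0n.
have E30 : 0 <= E3 by rewrite !mulr_ge0 ?exprn_ge0 ?ler0n.
have r0 := rate_gt0; have r1 := rate_lt1; have r2 := rate2_gt1.
have r1' : 0 <= (1 - rate)^-1 by rewrite invr_ge0; lra.
have r2' : 0 <= (2 * rate - 1)^-1 by rewrite invr_ge0; lra.
have [d0|dn0] := eqVneq d 0.
  have -> : x = y by apply/eqP; rewrite -subr_eq0; apply/eqP; exact: fnorm_eq0.
  by rewrite subrr normr0 !(addr_ge0, mulr_ge0) ?powR_ge0 ?exprn_ge0 ?ler0n.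
have dp : 0 < d by rewrite lt_neqAle eq_sym dn0 fnorm_ge0.
have [m [n0m dm md]] := dyadic_scale dp xy.
have limit z : nbhs z D -> cube z (scale n0 * 2) `<=` D ->
    `|average m z - K * p z| <= E1 * rate ^+ m / (1 - rate).
  move=> nz zD; apply: (@limit_rate _ (fun n => average n z)) => //.
    move=> n mn; rewrite -scale_powR; apply: averageS_le.
    apply: subset_trans zD; apply: cube_sub.
    have := scale_decr (leq_trans n0m mn); have := scale_gt0 n0; lra.
  move=> e e0.
  have c0 : 0 < 4 ^+ 3 * S0 + 1 by rewrite ltr_wpDl// mulr_ge0// exprn_ge0.
  have [n1 n1P] := average_cvg (nbhs_singleton nz) nz (divr_gt0 e0 c0).
  exists n1 => n /n1P h; apply: le_trans h _.
  by rewrite mulrA ler_pdivrMr// mulrC ler_wpM2l ?lerDl// ltW.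
have hx := limit x nx xD; have hy := limit y ny yD.
have hc : `|(average m x - average m y) - (average n0 x - average n0 y)|
    <= E2 * d * (2 * rate) ^+ m / (2 * rate - 1).
  rewrite -(subnKC n0m).
  apply: (@increment_sum_le _ (fun n => average n x - average n y)) => //.
    by rewrite mulr_ge0// ltW.
  move=> n /andP[n0n]; rewrite subnKC// => nm.
  rewrite (_ : _ - _ - _ = (average n.+1 x - average n x) - (average n.+1 y - average n y)); last by ring.
  rewrite exprMn -scale_powR.
  apply: le_trans (average_diff_le _ (le_trans dm (scale_decr (ltnW nm)))) _.
    apply: subset_trans xD; apply: cube_sub.
    by have := scale_decr n0n; lra.
  by rewrite -/E2 -/d; rewrite !mulrA.
have h0 := average_lip xD xy; rewrite -/E3 -/d in h0.
(* Uses [2^(-m) <= 2 d] and [2^(2 a) <= 2]. *)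
have qm : rate ^+ m <= 2 * d `^ (2 * a).
  rewrite -scale_powR; apply: (@le_trans _ _ ((2 * d) `^ (2 * a))).
    have d0 := ltW dp; have a0 := ltW a_gt0; have sm0 := ltW (scale_gt0 m).
    by apply: ge0_ler_powR; rewrite ?nnegrE ?mulr_ge0.
  rewrite (powRM _ (ler0n _ 2) (ltW dp)); apply: ler_wpM2r; first exact: powR_ge0.
  apply: ler1_powR; first by rewrite ler1n.
  by rewrite mulrC -ler_pdivlMr// ltW.
(* Here [d <= scale n0 <= scale 0 = 1], and the exponent is at most one. *)
have d1 : d <= d `^ (2 * a).
  apply: ger1_powR; last by rewrite mulrC -ler_pdivlMr// ltW.
  rewrite dp; apply: le_trans xy _; exact: (@scale_decr 0 n0).
(* The factor [2^m d] is at most [1] by the choice of [m], which reduces this bound to the previous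
   one. *)
have qd : d * (2 * rate) ^+ m <= 2 * d `^ (2 * a).
  apply: le_trans qm; rewrite exprMn mulrA ler_piMl ?exprn_ge0 ?(ltW r0)//.
  have pw : (0 : R) < 2 ^+ m by rewrite exprn_gt0.
  by rewrite -[leRHS](scaleK m) mulrC ler_pM2l.
set w := d `^ (2 * a) in qm d1 qd *.
have k1 : E1 * rate ^+ m / (1 - rate) <= E1 * (2 * w) / (1 - rate).
  exact: (ler_wpM2r r1' (ler_wpM2l E10 qm)).
have k2 : E2 * d * (2 * rate) ^+ m / (2 * rate - 1) <= E2 * (2 * w) / (2 * rate - 1).
  by rewrite -(mulrA E2); exact: (ler_wpM2r r2' (ler_wpM2l E20 qd)).
have k3 : E3 * (2 ^+ n0 * d) <= E3 * (2 ^+ n0 * w).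
  have pw : 0 <= (2 : R) ^+ n0 by rewrite exprn_ge0.
  exact: (ler_wpM2l E30 (ler_wpM2l pw d1)).
have -> : (2 * (2 * E1 / (1 - rate)) + 2 * E2 / (2 * rate - 1) + E3 * 2 ^+ n0) * w =
   2 * (E1 * (2 * w) / (1 - rate)) + E2 * (2 * w) / (2 * rate - 1) + E3 * (2 ^+ n0 * w).
  by move: (_^-1) (_^-1) (2 ^+ n0) => i1 i2 i3; ring.
have t1 := ler_distD (average m x) (K * p x) (K * p y).
have t2 := ler_distD (average m y) (average m x) (K * p y).
have t3 := ler_distD (average n0 x - average n0 y) (average m x - average m y) 0.
rewrite !subr0 in t3; rewrite (distrC (K * p x) (average m x)) in t1.
move: k1 k2 k3 t1 t2 t3 hx hy hc h0; lra.
Qed.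

End MultiscaleAverages.

(** * Pointwise bounds and Hölder norms *)

Section HolderNorm.
Context {R : realType} {n : nat} {V : zmodType}.
Implicit Types (D : set 'rV[R]_n.+1) (nm : V -> R) (f : 'rV[R]_n.+1 -> V).

Lemma holder_norm_ge nm (a : R) D f (M : R) : nm 0 = 0 -> a != 0 ->
  (holder_norm nm a D f <= M%:E)%E ->
  (forall x, D x -> nm (f x) <= M) /\
  (forall x y, D x -> D y -> nm (f x - f y) <= M * fnorm (x - y) `^ a).
Proof.
move=> nm0 a0; rewrite /holder_norm.
set A := ereal_sup [set _ | _ in D]; set S := holder_seminorm _ _ _ _ => AS.
have AM : (A <= M%:E)%E.
  apply: le_trans AS; apply: (@le_trans _ _ (maxe 0%E A)); first by rewrite le_max lexx orbT.
  by rewrite leeDl// le_max lexx.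
have SM : (S <= M%:E)%E.
  apply: le_trans AS; apply: (@le_trans _ _ (maxe 0%E S)); first by rewrite le_max lexx orbT.
  by rewrite leeDr// le_max lexx.
split=> [x Dx|x y Dx Dy].
  by rewrite -lee_fin; apply: le_trans AM; apply: ereal_sup_ubound; exists x.
have [->|xy] := eqVneq x y.
  by rewrite !subrr nm0 fnormE /dot big1 ?sqrtr0 ?powR0 ?mulr0// => i _; rewrite mxE mul0r.
have d0 : 0 < fnorm (x - y).
  rewrite lt_neqAle fnorm_ge0 andbT eq_sym; apply: contraNneq xy => /fnorm_eq0 h.
  by rewrite -subr_eq0 h.
rewrite -ler_pdivrMr ?powR_gt0// -lee_fin; apply: le_trans SM.
by apply: ereal_sup_ubound; exists x, y.
Qed.

Lemma holder_norm_le nm (a : R) D f (M1 M2 : R) : 0 <= M1 -> 0 <= M2 ->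
  (forall x, D x -> nm (f x) <= M1) ->
  (forall x y, D x -> D y -> nm (f x - f y) <= M2 * fnorm (x - y) `^ a) ->
  (holder_norm nm a D f <= (M1 + M2)%:E)%E.
Proof.
move=> M10 M20 f1 f2; rewrite /holder_norm EFinD; apply: leeD.
  rewrite ge_max lee_fin M10/=; apply: ub_ereal_sup => _ [x Dx <-].
  by rewrite lee_fin; exact: f1.
rewrite ge_max lee_fin M20/=; apply: ub_ereal_sup => _ [x [y [Dx Dy ->]]].
(* A zero denominator makes the quotient zero, the inverse of [0] being [0]. *)
rewrite lee_fin; have [d0|d0] := eqVneq (fnorm (x - y) `^ a) 0.
  by rewrite d0 invr0 mulr0.
rewrite ler_pdivrMr; first exact: f2.
by rewrite lt_neqAle eq_sym d0 powR_ge0.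
Qed.

Lemma holder_norm_ge0 nm (a : R) D f : (0 <= holder_norm nm a D f)%E.
Proof. by rewrite /holder_norm adde_ge0// le_max lexx. Qed.

End HolderNorm.

(** * Continuity from a Hölder bound, and the size of matrices *)

Section HolderContinuous.
Context {R : realType}.

Lemma holder_continuous (n : nat) (D : set 'rV[R]_n.+1) (g : 'rV[R]_n.+1 -> R) (a M : R) x :
  open D -> D x -> 0 < a -> 0 <= M ->
  (forall y z, D y -> D z -> `|g y - g z| <= M * fnorm (y - z) `^ a) ->
  {for x, continuous g}.
Proof.
move=> oD Dx a0 M0 gM; apply/(@cvgrPdist_lt _ _ _ (nbhs x)) => e e0.
have M1 : 0 < M + 1 by lra.
pose r := (e / (M + 1)) `^ a^-1.
have r0 : 0 < r by rewrite powR_gt0// divr_gt0.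
have nD : nbhs x D by exact: open_nbhs_nbhs.
apply: (filterS _ (filterI nD (near_fnorm x r0))) => y [Dy yr].
apply: le_lt_trans (gM x y Dx Dy) _.
have h : fnorm (x - y) `^ a < e / (M + 1).
  rewrite fnorm_distC; have -> : e / (M + 1) = r `^ a.
    by rewrite -powRrM mulVf ?gt_eqF// powRr1// ltW// divr_gt0.
  by apply: gt0_ltr_powR; rewrite ?nnegrE ?fnorm_ge0// ltW.
have := powR_ge0 (fnorm (x - y)) a; move: h; rewrite ltr_pdivlMr//; nra.
Qed.

Lemma fnorm_mx_le (m n : nat) (A : 'M[R]_(m, n)) (r : R) : 0 <= r ->
  (forall i j, `|A i j| <= r) -> fnorm A <= (m * n)%:R * r.
Proof.
move=> r0 Ar; have k0 : 0 <= (m * n)%:R :> R by [].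
rewrite -(@ler_pXn2r _ 2) ?nnegrE ?sqrtr_ge0 ?mulr_ge0// sqr_sqrtr; last first.
  by apply: sumr_ge0 => i _; apply: sumr_ge0 => j _; rewrite sqr_ge0.
apply: (@le_trans _ _ (\sum_(i < m) \sum_(j < n) r ^+ 2)).
  apply: ler_sum => i _; apply: ler_sum => j _.
  by rewrite -(real_normK (num_real _)) lerXn2r// nnegrE.
rewrite !sumr_const !card_ord -mulrnA exprMn -[leLHS]mulr_natl mulnC.
rewrite ler_wpM2r ?sqr_ge0// -natrX ler_nat.
by case: (m * n)%N => // k; rewrite -mulnn leq_pmull.
Qed.

End HolderContinuous.

(** * Uniform constants for the kernels *)

Section KernelConstants.
Context {R : realType}.

Lemma vanish_bounded (F : 'rV[R]_3 -> R) (s : R) : continuous F -> vanish_off 0 s F ->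
  exists S, forall x, `|F x| <= S.
Proof.
move=> cF F0; have [] := @ccont_bounded R F; last by move=> S _ h; exists S.
apply: (ccont_supported cF (vanish_supported _ F0) (c := 0) (r := s + 1)).
by rewrite ltrDl.
Qed.

(** The sum of the absolute values dominates each constant; used to exchange a finite quantifier
    over indices with the existence of a bound. *)
Lemma uniform_bound (m : nat) (P : 'I_m -> R -> Prop) :
  (forall i S S', S <= S' -> P i S -> P i S') -> (forall i, exists S, P i S) ->
  exists S, forall i, P i S.
Proof.
move=> Ple /choice[S PS]; exists (\sum_i `|S i|) => i.
apply: Ple (PS i); rewrite (bigD1 i)//=; apply: le_trans (ler_norm _) _.
by rewrite lerDl sumr_ge0.
Qed.

Lemma vanish_lipschitz (F : 'rV[R]_3 -> R) (s : R) : smooth F -> vanish_off 0 s F ->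
  exists L, forall x y : 'rV[R]_3, `|F y - F x| <= L * \sum_k `|y 0 k - x 0 k|.
Proof.
move=> sF F0.
have [L LP] : exists S, forall i x, `|partial i F x| <= S.
  apply: uniform_bound => [i S S' SS' h x|i]; first exact: le_trans (h x) SS'.
  apply: (@vanish_bounded _ s); last exact: vanish_partial.
  exact: classC_continuous (smooth_partial i sF 0%N).
exists L => x y; apply: lipschitz_partial => // i z.
by have [_ /(_ i)[]] := sF 1%N.
Qed.

Lemma scaling_kernel_constants (rho Psi : 'rV[R]_3 -> R) (s : R) :
  smooth rho -> smooth Psi -> vanish_off 0 s rho -> vanish_off 0 s Psi ->
  exists S0 L0 S2 L2 : R,
  [/\ forall x, `|rho x| <= S0,
      forall x y, `|rho y - rho x| <= L0 * \sum_k `|y 0 k - x 0 k|,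
      forall i j x, `|partial i (partial j Psi) x| <= S2
    & forall i j x y, `|partial i (partial j Psi) y - partial i (partial j Psi) x|
        <= L2 * \sum_k `|y 0 k - x 0 k|].
Proof.
move=> srho sPsi rho0 Psi0.
have [S0 h0] := vanish_bounded (classC_continuous (srho 0%N)) rho0.
have [L0 h1] := vanish_lipschitz srho rho0.
have sD i j : smooth (partial i (partial j Psi)) by do 2 apply: smooth_partial.
have vD i j : vanish_off 0 s (partial i (partial j Psi)) by do 2 apply: vanish_partial.
have [S2 h2] : exists S, forall i j x, `|partial i (partial j Psi) x| <= S.
  apply: uniform_bound => [i S S' SS' h j x|i]; first exact: le_trans (h j x) SS'.
  apply: uniform_bound => [j S S' SS' h x|j]; first exact: le_trans (h x) SS'.
  exact: vanish_bounded (classC_continuous (sD i j 0%N)) (vD i j).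
have [L2 h3] : exists L, forall i j x y,
    `|partial i (partial j Psi) y - partial i (partial j Psi) x|
      <= L * \sum_k `|y 0 k - x 0 k|.
  have le (S S' : R) (x y : 'rV[R]_3) : S <= S' ->
      S * \sum_k `|y 0 k - x 0 k| <= S' * \sum_k `|y 0 k - x 0 k|.
    by move=> SS'; rewrite ler_wpM2r// sumr_ge0.
  apply: uniform_bound => [i S S' SS' h j x y|i]; first exact: le_trans (h j x y) (le _ _ _ _ SS').
  apply: uniform_bound => [j S S' SS' h x y|j]; first exact: le_trans (h x y) (le _ _ _ _ SS').
  exact: vanish_lipschitz (sD i j) (vD i j).
by exists S0, L0, S2, L2.
Qed.

End KernelConstants.

(** * From the equation for [P] to the interior Hölder bound *)

Section InteriorEstimate.
Context {R : realType}.
Implicit Types (D : set 'rV[R]_3) (u : 'rV[R]_3 -> 'rV[R]_3) (P p : 'rV[R]_3 -> R).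

(** Both sides contain the integral of [normal_part] against the Laplacian; continuity of the two
    functions on [D] makes the products integrable, so the integral of the difference may be
    split. *)
Lemma pressure_equation_weak D (phi : R -> R) u P :
  (forall z, D z -> {for z, continuous P}) ->
  (forall z, D z -> {for z, continuous (normal_part D phi u)}) ->
  pressure_equation D phi u P ->
  weak_pressure D u (fun x => P x - normal_part D phi u x).
Proof.
move=> cP cN eqP psi tpsi; have [spsi [K [cK KD K0]]] := tpsi.
have clK : closed K by apply: compact_closed => //; exact: norm_hausdorff.
have lap0 z : ~ K z -> laplacian psi z = 0.
  move=> Kz; rewrite /laplacian big1// => i _.
  exact: (vanish_partial_closed i clK (vanish_partial_closed i clK K0) Kz).
have clap := classC_continuous (smooth_laplacian spsi 0%N).
have off f z : ~ D z -> f z * laplacian psi z = 0.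
  by move=> nDz; rewrite lap0 ?mulr0// => /KD.
have c1 := ccont_mul_compact cK KD cP clap lap0.
have c2 := ccont_mul_compact cK KD cN clap lap0.
have := eqP _ tpsi; rewrite (int3_restrict (off P)) (int3_restrict (off _)).
rewrite (int3_restrict (off (fun x => P x - normal_part D phi u x))) => h.
have -> : (fun z => (P z - normal_part D phi u z) * laplacian psi z) =
    (fun z => P z * laplacian psi z - normal_part D phi u z * laplacian psi z).
  by apply/funext => z; rewrite mulrBl.
by rewrite (int3B c1 c2) opprB addrC h subrK.
Qed.

(** Each of the nine entries is at most [N^2], with Hölder constant [2 N^2] by the product rule;
    [27 = 9 + 18]. *)
Lemma tensor_holder_le D (a N : R) u : 0 <= N ->
  (forall x i, D x -> `|u x 0 i| <= N) ->
  (forall x y i, D x -> D y -> `|u x 0 i - u y 0 i| <= N * fnorm (x - y) `^ a) ->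
  (holder_norm fnorm a D (fun x => tensor (u x) (u x)) <= (27 * N ^+ 2)%:E)%E.
Proof.
move=> N0 uN uh; rewrite (_ : 27 * N ^+ 2 = (3 * 3)%:R * (N * N) + (3 * 3)%:R * (2 * (N * N))); last by ring.
have N2 : 0 <= N * N by rewrite mulr_ge0.
apply: holder_norm_le; rewrite ?mulr_ge0//.
  move=> x Dx; apply: fnorm_mx_le => // i j.
  rewrite /tensor mxE big_ord1 !mxE normrM; apply: ler_pM => //; exact: uN.
move=> x y Dx Dy; have pw := powR_ge0 (fnorm (x - y)) a.
rewrite -mulrA; apply: fnorm_mx_le; first by rewrite !mulr_ge0.
move=> i j; rewrite /tensor !mxE !big_ord1 !mxE.
rewrite (_ : _ - _ = u x 0 i * (u x 0 j - u y 0 j) + (u x 0 i - u y 0 i) * u y 0 j); last by ring.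
apply: le_trans (ler_normD _ _) _; rewrite !normrM.
have h1 : `|u x 0 i| * `|u x 0 j - u y 0 j| <= N * (N * fnorm (x - y) `^ a).
  by apply: ler_pM => //; [exact: uN|exact: uh].
have h2 : `|u x 0 i - u y 0 i| * `|u y 0 j| <= N * fnorm (x - y) `^ a * N.
  by apply: ler_pM => //; [exact: uh|exact: uN].
lra.
Qed.

(** The constant is fixed before [N], [u] and [p], and all bounds are homogeneous of degree two in
    [N]; this is the uniformity the theorem asserts. *)
Lemma interior_holder D (a eta b : R) : 0 < a -> a < 1 / 2 -> 0 < eta -> 0 <= b ->
  open D -> exists2 C : R, 0 <= C & forall (N : R) u p, 0 <= N ->
    (forall x y i, D x -> D y -> `|u x 0 i - u y 0 i| <= N * fnorm (x - y) `^ a) ->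
    (forall z i, D z -> {for z, continuous (fun z => u z 0 i)}) ->
    (forall z, D z -> {for z, continuous p}) ->
    (forall z, D z -> `|p z| <= b * N ^+ 2) ->
    divergence_free D u -> weak_pressure D u p ->
    forall x y, D x -> D y -> eta <= dist x (bd D) -> eta <= dist y (bd D) ->
    `|p x - p y| <= C * N ^+ 2 * fnorm (x - y) `^ (2 * a).
Proof.
move=> a0 a1 eta0 b0 oD.
have [rho [Psi [[srho sPsi] off [rho_ge0 [z0 rho_z0]] lap sym]]] := @scaling_kernel R.
have offE F : (forall (x : 'rV[R]_3) i, 1 < `|x 0 i| -> F x = 0) -> vanish_off 0 (1 : R) F.
  by move=> h z /not_cube[i]; rewrite mxE subr0; exact: h.
have rho0 (x : 'rV[R]_3) i : 1 < `|x 0 i| -> rho x = 0 by move=> /off[].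
have Psi0 (x : 'rV[R]_3) i : 1 < `|x 0 i| -> Psi x = 0 by move=> /off[].
have [S0 [L0 [S2 [L2 [h1 h2 h3 h4]]]]] :=
  scaling_kernel_constants srho sPsi (offE _ rho0) (offE _ Psi0).
have K0 : 0 < int3 setT rho.
  apply: (int3_gt0 (x0 := z0)) => //.
  apply: (ccont_supported (classC_continuous (srho 0%N)) (c := 0) (r := 1 + 1)).
  by apply: (vanish_supported _ (offE _ rho0)); rewrite ltrDl.
set K := int3 setT rho in K0.
(* Makes [6 * 2^(-n0) < eta], so the cube of half-side [2 * 2^(-n0)] lies in the ball of radius
   [eta]: a factor [3] is lost between the sup and Euclidean norms. *)
pose n0 := Num.bound (6 / eta).
have s0 := @scale_gt0 R n0.
have sn0 : 3 * (scale n0 * 2) < eta.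
  have := @upper_nthrootP R (6 / eta) n0 (leqnn _).
  rewrite ltr_pdivrMr// -(ltr_pM2r s0) mulrAC scaleK mul1r; lra.
have cubeD x : D x -> eta <= dist x (bd D) -> cube x (scale n0 * 2) `<=` D.
  move=> Dx ex; apply: subset_trans (eball_sub oD Dx ex) => z zc.
  by apply: le_lt_trans sn0; apply: fnorm_le_coord => i; rewrite !mxE; exact: zc.
pose q := rate a.
pose C1 := (2 * (2 * (27 * 4 ^+ 3 * S2) / (1 - q)) + 2 * (162 * 8 ^+ 3 * L2) / (2 * q - 1)
  + 3 * 8 ^+ 3 * b * L0 * 2 ^+ n0) / K.
(* For pairs farther apart than [scale n0]: the trivial bound [2 b N^2], divided by the least value
   of the Hölder weight. *)
pose C2 := 2 * b / scale n0 `^ (2 * a).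
have C20 : 0 <= C2 by rewrite divr_ge0 ?powR_ge0 ?mulr_ge0.
exists (`|C1| + C2); first by rewrite addr_ge0.
move=> N u p N0 uh cu cp pb divu weak x y Dx Dy ex ey.
have w0 := powR_ge0 (fnorm (x - y)) (2 * a).
have N2 : 0 <= N ^+ 2 by rewrite sqr_ge0.
have bN : 0 <= b * N ^+ 2 by rewrite mulr_ge0.
have [xy|xy] := leP (fnorm (x - y)) (scale n0).
  have := pressure_increment a0 a1 N0 bN uh cu cp pb divu weak srho sPsi rho0 Psi0
    lap sym h1 h2 h3 h4 (open_nbhs_nbhs (conj oD Dx)) (open_nbhs_nbhs (conj oD Dy))
    (cubeD x Dx ex) (cubeD y Dy ey) xy.
  rewrite -/K -mulrBr normrM (gtr0_norm K0) => h.
  have {}h : `|p x - p y| <= C1 * N ^+ 2 * fnorm (x - y) `^ (2 * a).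
    rewrite -(ler_pM2l K0); apply: le_trans h _.
    rewrite le_eqVlt; apply/orP; left; apply/eqP.
    have Kn : K != 0 by rewrite gt_eqF.
    rewrite /C1 -/q; move: (1 - q)^-1 (2 * q - 1)^-1 (2 ^+ n0) (_ `^ _) => i1 i2 i3 i4.
    by field.
  apply: le_trans h _; apply: ler_wpM2r => //; apply: ler_wpM2r => //.
  by have := ler_norm C1; lra.
have big : 1 <= fnorm (x - y) `^ (2 * a) / scale n0 `^ (2 * a).
  rewrite ler_pdivlMr ?powR_gt0// mul1r.
  by apply: ge0_ler_powR; rewrite ?nnegrE ?fnorm_ge0 ?mulr_ge0 ?(ltW a0) ?(ltW s0) ?(ltW xy).
have pxy : `|p x - p y| <= 2 * (b * N ^+ 2).
  by have := ler_normB (p x) (p y); have := pb x Dx; have := pb y Dy; lra.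
apply: le_trans pxy _.
apply: (@le_trans _ _ (C2 * N ^+ 2 * fnorm (x - y) `^ (2 * a))); last first.
  by apply: ler_wpM2r => //; apply: ler_wpM2r => //; rewrite lerDr.
rewrite (_ : C2 * _ * _ = 2 * (b * N ^+ 2) *
    (fnorm (x - y) `^ (2 * a) / scale n0 `^ (2 * a))); last by rewrite /C2; ring.
by rewrite ler_peMr// mulr_ge0.
Qed.

End InteriorEstimate.

Theorem theorem1p10 (R : realType) (alpha : R) (Omega : set 'rV[R]_3)
    (A : @bd_atlas R) (delta : R) (phi : R -> R)
    (halpha : 0 < alpha < 1 / 2)
    (Omega_open : open Omega) (Omega_bounded : bounded_set Omega)
    (Omega_sc : simply_connected Omega) (Omega_C4 : C4_boundary Omega)
    (HA : C4_atlas Omega A)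
    (hdelta : 0 < delta) (Hdelta : unique_nearest Omega delta)
    (Hphi : cutoff_profile delta phi)
    (HP : P_wellposed Omega A delta phi alpha) :
  forall eta : R, 0 < eta ->
  exists C : R, forall (u : 'rV[R]_3 -> 'rV[R]_3) (p : 'rV[R]_3 -> R),
    velocity Omega alpha u -> is_pressure Omega A delta phi alpha u p ->
    (holder_norm Num.norm (2 * alpha)%R (Omega `\` collar Omega eta) p < +oo)%E /\
    (holder_norm Num.norm (2 * alpha)%R (Omega `\` collar Omega eta) p
       <= C%:E * holder_norm fnorm alpha Omega u ^+ 2)%E.
Proof.
move=> eta eta0; have /andP[a0 a1] := halpha; have [_ _ [C HC]] := HP.
(* Sup bound of the pressure in units of [N^2]: [27 |C|] from the known bound on [P] and the norm of
   the tensor, [9] from the normal part. The absolute value is taken since [C] comes without a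
   sign. *)
pose b := 27 * `|C| + 9.
have b0 : 0 <= b by rewrite addr_ge0 ?mulr_ge0.
have [C0 C00 main] := interior_holder a0 a1 eta0 b0 Omega_open.
exists (b + C0) => u p velu [P isP pE].
have [hu divu _] := velu; have [_ eqP _ _] := isP.
have an0 : alpha != 0 by rewrite gt_eqF.
have fnorm0 : fnorm (0 : 'rV[R]_3) = 0.
  by rewrite fnormE /dot big1 ?sqrtr0// => i _; rewrite mxE mul0r.
pose N := fine (holder_norm fnorm alpha Omega u).
have NE : holder_norm fnorm alpha Omega u = N%:E.
  by rewrite fineK// ge0_fin_numE// holder_norm_ge0.
have N0 : 0 <= N by rewrite fine_ge0// holder_norm_ge0.
have [u1 u2] : (forall x, Omega x -> fnorm (u x) <= N) /\
    (forall x y, Omega x -> Omega y -> fnorm (u x - u y) <= N * fnorm (x - y) `^ alpha).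
  by apply: holder_norm_ge => //; rewrite NE.
have uN x i : Omega x -> `|u x 0 i| <= N.
  by move=> Dx; apply: le_trans (coord_le_fnorm _ i) (u1 x Dx).
have uh x y i : Omega x -> Omega y -> `|u x 0 i - u y 0 i| <= N * fnorm (x - y) `^ alpha.
  move=> Dx Dy; apply: le_trans (u2 x y Dx Dy).
  by have := coord_le_fnorm (u x - u y) i; rewrite !mxE.
have cu z i : Omega z -> {for z, continuous (fun z => u z 0 i)}.
  by move=> Dz; apply: (holder_continuous Omega_open Dz a0 N0) => x y Dx Dy; exact: uh.
have M0 : 0 <= `|C| * (27 * N ^+ 2) by rewrite !mulr_ge0 ?sqr_ge0.
have [P1 P2] : (forall x, Omega x -> `|P x| <= `|C| * (27 * N ^+ 2)) /\
    (forall x y, Omega x -> Omega y ->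
      `|P x - P y| <= `|C| * (27 * N ^+ 2) * fnorm (x - y) `^ alpha).
  apply: (@holder_norm_ge _ _ _ Num.norm) => //; first exact: normr0.
  apply: le_trans (HC u P velu isP) _; rewrite EFinM.
  apply: (@le_trans _ _ (`|C|%:E * holder_norm fnorm alpha Omega (fun x => tensor (u x) (u x)))%E).
    by apply: lee_wpmul2r; [exact: holder_norm_ge0|rewrite lee_fin ler_norm].
  apply: lee_wpmul2l; first by rewrite lee_fin.
  by apply: tensor_holder_le => // x i Dx; exact: uN.
have cP z : Omega z -> {for z, continuous P}.
  by move=> Dz; exact: (holder_continuous Omega_open Dz a0 M0 P2).
have cN z : Omega z -> {for z, continuous (normal_part Omega phi u)}.
  move=> Dz; apply: (normal_part_continuous Omega_open Omega_bounded Omega_C4 Hdelta) => // i.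
  exact: cu.
(* The given [p] is prescribed on [Omega] only; this representative is given by the formula
   everywhere, and the two are exchanged at points of [Omega]. *)
pose p' x := P x - normal_part Omega phi u x.
have cp' z : Omega z -> {for z, continuous p'}.
  by move=> Dz; apply: continuousB; [exact: cP|exact: cN].
have p'b x : Omega x -> `|p' x| <= b * N ^+ 2.
  move=> Dx; have [_ phi01 _ _ _] := Hphi.
  have h1 := P1 x Dx; have h2 := ler_normB (P x) (normal_part Omega phi u x).
  have h3 := normal_part_le Omega phi01 (fun i => uN x i Dx).
  have /andP[f0 f1] := phi01 _ (dist_ge0 x (bd Omega)).
  have h4 : phi (dist x (bd Omega)) * (3 * N) ^+ 2 <= 9 * N ^+ 2.
    have -> : 9 * N ^+ 2 = 1 * (3 * N) ^+ 2 by ring.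
    by rewrite ler_wpM2r// sqr_ge0.
  by rewrite /b; move: h1 h2 h3 h4; rewrite -/(p' x); lra.
have hold := main N u p' N0 uh cu cp' p'b divu (pressure_equation_weak cP cN eqP).
have inS x : (Omega `\` collar Omega eta) x -> Omega x /\ eta <= dist x (bd Omega).
  by move=> [Dx nV]; split=> //; rewrite leNgt; apply/negP => xe; apply: nV.
have N2 : 0 <= N ^+ 2 by rewrite sqr_ge0.
have le : (holder_norm Num.norm (2 * alpha)%R (Omega `\` collar Omega eta) p
    <= (b * N ^+ 2 + C0 * N ^+ 2)%:E)%E.
  apply: holder_norm_le; rewrite ?mulr_ge0//.
    by move=> x /inS[Dx _]; rewrite pE//; exact: p'b.
  by move=> x y /inS[Dx ex] /inS[Dy ey]; rewrite !pE//; exact: hold.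
split; first by apply: le_lt_trans le (ltry _).
by rewrite NE -EFin_expe -EFinM (mulrDl b C0).
Qed.
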